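(* Let $(Z_t)$ be an independent and identically distributed sequence of real random variables such that, for some $\alpha\in(0,2)$ and some normalizing sequence $(a_n)$, $nP(|Z_0|>a_nx)\to x^{-\alpha}$ as $n\to\infty$ for any $x>0$, and such that the limit $\lim_{x\to\infty}P(Z_0>x)/P(|Z_0|>x)=q\in[0,1]$ exists. Let $(\sigma_t)$ with $\sigma_t\ge0$ be a stationary sequence, independent of $(Z_t)$, with $E\sigma_0^{4\alpha}<\infty$, and let $X_t=\sigma_tZ_t$. Let $p=p_n$ be a positive-integer-valued sequence with $p_n\to\infty$ as $n\to\infty$ such that $$0<\liminf_{n\to\infty}\frac{p_n}{n^{\beta_1}}\quad\text{and}\quad\limsup_{n\to\infty}\frac{p_n}{n^{\beta_2}}<\infty$$ for some $0<\beta_1<\beta_2$, where $\beta_2<\frac{2-\alpha}{\alpha-1}$ in case $1<\alpha<2$. Let $\mathbf X=(X_{it})_{1\le i\le p,\,1\le t\le n}$ be the $p\times n$ random matrix whose rows $(X_{it})_{1\le t\le n}$ are independent copies of $(X_t)_{1\le t\le n}$, and let $\lambda_1,\dots,\lambda_p\ge0$ be the eigenvalues of $\mathbf X\mathbf X^{\mathsf T}$. Then, as $n\to\infty$, $$\sum_{i=1}^p\epsilon_{a_{np}^{-2}\lambda_i}\ \xrightarrow{D}\ \sum_{i=1}^\infty\epsilon_{(E\sigma_0^\alpha)^{2/\alpha}\Gamma_i^{-2/\alpha}},$$ where $\Gamma_i=E_1+\dots+E_i$ and $(E_k)$ are independent and identically distributed exponential random variables with mean one.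
   Context: $\epsilon_x$ denotes the Dirac (unit point) measure at $x$; stationary means strictly stationary. $a_{np}$ is the term of the sequence $(a_m)$ with index $m=n\,p_n$. The point processes in the conclusion are point processes on $(0,\infty)$ (points at $0$ are not counted), and $\xrightarrow{D}$ means convergence of Laplace functionals: for every continuous $f:(0,\infty)\to[0,\infty)$ with compact support (with $f(0)$ read as $0$), $E\big(e^{-\sum_{i=1}^pf(a_{np}^{-2}\lambda_i)}\big)\to E\big(e^{-\sum_{i=1}^\infty f((E\sigma_0^\alpha)^{2/\alpha}\Gamma_i^{-2/\alpha})}\big)$. *)

(* Defs.v *)
From HB Require Import structures.
From mathcomp Require Export all_boot all_order all_algebra finmap.
From mathcomp Require Export all_classical all_reals all_analysis measurable_realfun.

Set Implicit Arguments.
Unset Strict Implicit.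
Unset Printing Implicit Defensive.

Import Order.TTheory GRing.Theory Num.Theory.
Import numFieldNormedType.Exports.

Local Open Scope classical_set_scope.
Local Open Scope ring_scope.

Section Probability.
Context {R : realType}.

Definition sigma_gen d d' (T : measurableType d) (U : measurableType d')
    (I : Type) (X : I -> T -> U) : set (set T) :=
  <<s \bigcup_(i in [set: I]) preimage_set_system setT (X i) measurable >>.

Definition independent_classes d (T : measurableType d) (P : probability T R)
    (I : choiceType) (G : I -> set (set T)) : Prop :=
  forall (J : {fset I}) (A : I -> set T),
    (forall i, i \in J -> G i (A i)) ->
    P (\bigcap_(i in [set` J]) A i) = (\prod_(i <- J) P (A i))%E.

Definition independent_families d (T : measurableType d) (P : probability T R)
    (I : choiceType) (K : I -> Type) (X : forall i, K i -> T -> R) : Prop :=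
  independent_classes P (fun i => sigma_gen (X i)).

Definition independent_pair d (T : measurableType d) (P : probability T R)
    (I J : Type) (X : I -> T -> R) (Y : J -> T -> R) : Prop :=
  forall A B, sigma_gen X A -> sigma_gen Y B ->
    P (A `&` B) = (P A * P B)%E.

Definition eq_law d1 d2 d (T1 : measurableType d1) (T2 : measurableType d2)
    (U : measurableType d) (P1 : probability T1 R) (P2 : probability T2 R)
    (X : T1 -> U) (Y : T2 -> U) : Prop :=
  forall B : set U, measurable B -> P1 (X @^-1` B) = P2 (Y @^-1` B).

Definition iid d (T : measurableType d) (P : probability T R)
    (X : nat -> T -> R) : Prop :=
  independent_families P (fun k (_ : unit) => X k) /\
  forall k, eq_law P P (X k) (X 0%N).

(* (X_s, ..., X_(s + n - 1)) *)
Definition window d (T : measurableType d) (X : nat -> T -> R) (s n : nat)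
    (w : T) : n.-tuple R := [tuple X (s + t)%N w | t < n].

Definition stationary d (T : measurableType d) (P : probability T R)
    (X : nat -> T -> R) : Prop :=
  forall h n : nat, eq_law P P (window X h n) (window X 0 n).

End Probability.

Section PointProcesses.
Context {R : realType}.

(* Only the values of f on (0, +oo) matter.  The closure is taken in R;
   requiring it to stay inside (0, +oo) makes it the support in (0, +oo). *)
Definition test_function (f : R -> R) : Prop :=
  let S := [set x | 0 < x /\ f x != 0] in
  [/\ {in `]0, +oo[, continuous f},
      forall x, 0 < x -> 0 <= f x,
      compact (closure S) & closure S `<=` `]0, +oo[%classic].

Definition point_measure (m : nat) (x : nat -> R) : {measure set R -> \bar R} :=
  msum (fun i => \d_(x i)) m.

Definition point_measure_inf (x : nat -> R) : {measure set R -> \bar R} :=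
  mseries (fun i => \d_(x i)) 0.

(* Integrating over (0, +oo) discards the points located at 0. *)
Definition laplace_functional d (T : measurableType d) (P : probability T R)
    (N : T -> {measure set R -> \bar R}) (f : R -> R) : \bar R :=
  (\int[P]_w expeR (- \int[N w]_(x in `]0%R, +oo[) (f x)%:E))%E.

Lemma measurable_test_function (f : R -> R) : test_function f ->
  measurable_fun (`]0%R, +oo[ : set R) (EFin \o f).
Proof.
move=> [fc _ _ _]; apply/measurable_EFinP.
apply: open_continuous_measurable_fun; first exact: interval_open.
by move=> x; rewrite inE/= => xi; exact: fc.
Qed.

Lemma integral_point_measure (f : R -> R) m (x : nat -> R) : test_function f ->
  (\int[point_measure m x]_(y in `]0%R, +oo[) (f y)%:E =
   \sum_(i < m) (if (0 < x i)%R then (f (x i))%:E else 0))%E.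
Proof.
move=> tf; have mf := measurable_test_function tf; case: tf => _ f0 _ _.
rewrite (ge0_integral_measure_sum _ _ _ mf)//=; last first.
  by move=> y/=; rewrite in_itv/= andbT lee_fin => /f0.
apply: eq_bigr => i _; rewrite (integral_dirac _ _ mf)//=.
rewrite diracE; case: ifPn => xi.
  by rewrite mem_set ?mul1e//= in_itv/= xi.
by rewrite memNset ?mul0e//= in_itv/= andbT; exact/negP.
Qed.

Lemma integral_point_measure_inf (f : R -> R) (x : nat -> R) :
  test_function f ->
  (\int[point_measure_inf x]_(y in `]0%R, +oo[) (f y)%:E =
   \sum_(i <oo) (if (0 < x i)%R then (f (x i))%:E else 0))%E.
Proof.
move=> tf; have mf := measurable_test_function tf; case: tf => _ f0 _ _.
rewrite (ge0_integral_measure_series _ _ _ mf)//=; last first.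
  by move=> y/=; rewrite in_itv/= andbT lee_fin => /f0.
apply: eq_eseriesr => i _; rewrite (integral_dirac _ _ mf)//=.
rewrite diracE; case: ifPn => xi.
  by rewrite mem_set ?mul1e//= in_itv/= xi.
by rewrite memNset ?mul0e//= in_itv/= andbT; exact/negP.
Qed.

Definition cvg_point_process (d : nat -> measure_display)
    (T : forall n, measurableType (d n)) (P : forall n, probability (T n) R)
    (N : forall n, T n -> {measure set R -> \bar R})
    (d' : measure_display) (T' : measurableType d') (P' : probability T' R)
    (N' : T' -> {measure set R -> \bar R}) : Prop :=
  forall f : R -> R, test_function f ->
    laplace_functional (P n) (@N n) f @[n --> \oo] -->
    laplace_functional P' N' f.

End PointProcesses.

(* l 0, ..., l (m - 1) list the eigenvalues with algebraic multiplicity. *)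
Definition eigenvalues_of {R : realType} (m : nat) (A : 'M[R]_m)
    (l : nat -> R) : Prop :=
  char_poly A = \prod_(i < m) ('X - (l i)%:P).

(* Exponential distribution of rate 1, i.e. of mean 1. *)
Definition std_exponential {R : realType} d (T : measurableType d)
    (P : probability T R) (X : {RV P >-> R}) : Prop :=
  forall B : set R, measurable B ->
    distribution P X B = exponential_prob 1 B.

(* Main.v *)
Require Import Defs.
From HB Require Import structures.
From mathcomp Require Import all_boot all_order all_algebra finmap.
From mathcomp Require Import all_classical all_reals all_analysis measurable_realfun.
From mathcomp Require Import perm complex spectral sesquilinear ring lra.

(** Write N = n p, b = a_N and y_it = X_it / b.  The theorem holds because the
    eigenvalues of Y Y^T are, in the limit, the squares of the largest entries
    of Y, and these squares form asymptotically a Poisson process.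

    From the spectrum to the entries.  By the spectral theorem every diagonal
    entry D_i of the Gram matrix Y Y^T is a mean of the eigenvalues whose
    variance is the sum of squares of the off-diagonal entries of row i, and
    the weights of these means form a doubly stochastic matrix
    ([spectral_weights]).  Hence sum_k g(lambda_k) and sum_i g(D_i) are close
    for a test function g when the off-diagonal squares are small
    ([eigen_gram_sum]); and D_i, a sum of squares y_it^2, acts on g like its
    largest term when the cross products y_is^2 y_it^2 are small
    ([row_entries_sum]).  The resulting bound, [eigen_entries_close], is
    deterministic.

    The error terms vanish.  Truncate the entries at a level K b; the
    probability of seeing any larger entry is about E(sigma^alpha) K^-alpha,
    small uniformly in n.  Truncated entries satisfy E y^2 = O(1/N),
    E y_s^2 y_t^2 = O(1/N^2) and E |y_s y_t| = o(1/N) within a row; the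
    volatilities are dependent, but max(sigma, 1)^k separates from the
    truncated noise and the Cauchy-Schwarz inequality with stationarity
    handles the rest ([entry_moment], [entry_pair_moment_le]).  Rows are
    independent, so the off-diagonal squares have expectation at most
    p^2 (n O(1/N^2) + n^2 o(1/N^2)), and the cross products inside the rows
    p n^2 O(1/N^2) = O(1/p); both tend to zero ([matrix_laplace_close]).

    The entries are asymptotically Poisson.  Breiman's lemma gives
    N P(|sigma Z| > b x) -> E(sigma^alpha) x^-alpha ([breiman]), whence
    N E(1 - exp(- g(y^2))) converges to J, the integral over (0, oo) of
    1 - exp(- g(c x^(-2/alpha))) with c = (E sigma^alpha)^(2/alpha)
    ([power_tail_integral_cvg]).  Two relevant entries in one row cost
    O(n^2/N^2), so the Laplace functional of a row is 1 - (J + o(1))/p, and the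
    product over the p independent rows tends to exp(-J) ([row_laplace_cvg]).

    The limit process.  Let psi(s) = exp(- int_s^oo (1 - exp(-h))) for
    h(x) = g(c x^(-2/alpha)).  The identity of [laplace_tail_eq] makes
    exp(- sum_(i <= n) h(Gamma_i)) psi(Gamma_n) have constant expectation
    psi(0) = exp(-J); since psi(Gamma_n) tends to 1, the Laplace functional of
    the limit is exp(-J) as well ([laplace_functional_arrivals]). *)

Set Implicit Arguments.
Unset Strict Implicit.
Unset Printing Implicit Defensive.

Import Order.TTheory GRing.Theory Num.Theory.
Import numFieldNormedType.Exports.

Local Open Scope classical_set_scope.
Local Open Scope ring_scope.

(** * Doubly stochastic weights between diagonal and spectrum *)

Lemma prod_XsubC_perm (K : idomainType) (s t : seq K) :
  \prod_(x <- s) ('X - x%:P) = \prod_(x <- t) ('X - x%:P) -> perm_eq s t.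
Proof.
elim: s t => [|x s IH] t.
  rewrite big_nil => /(congr1 (fun p : {poly K} => size p)).
  by rewrite size_prod_XsubC size_poly1; case: t.
move=> E; have xt : x \in t.
  by rewrite -root_prod_XsubC -E root_prod_XsubC mem_head.
rewrite perm_sym (perm_trans (perm_to_rem xt))// perm_cons perm_sym.
apply: IH; move: E; rewrite (perm_big _ (perm_to_rem xt)) !big_cons.
by apply: mulfI; rewrite polyXsubC_eq0.
Qed.

(** The determinant of V' (X - A) V is that of X - A times that of V' V, over K[X]. *)
Lemma char_poly_conj (K : comNzRingType) m (V' V A : 'M[K]_m) :
  V' *m V = 1%:M -> char_poly (V' *m A *m V) = char_poly A.
Proof.
move=> VV; pose f := map_mx (@polyC K).
have fVV : f _ _ V' *m f _ _ V = 1%:M by rewrite -map_mxM VV map_mx1.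
have -> : char_poly (V' *m A *m V) = \det (f _ _ V' *m char_poly_mx A *m f _ _ V).
  congr (\det _); rewrite /char_poly_mx !map_mxM mulmxBr mulmxBl.
  by rewrite scalar_mxC -[X in _ = X - _]mulmxA fVV mulmx1.
by rewrite !det_mulmx mulrAC -[X in X * _]det_mulmx fVV det1 mul1r.
Qed.

Section SpectralWeights.
Local Open Scope sesquilinear_scope.

Lemma conj_diagE (C : numClosedFieldType) m (U : 'M[C]_m) (e : 'rV[C]_m) i :
  (U^t* *m diag_mx e *m U) i i = \sum_k `|U k i| ^+ 2 * e 0 k.
Proof.
rewrite mxE; apply: eq_bigr => k _.
by rewrite mul_mx_diag !mxE normCK mulrAC [_^* * _]mulrC.
Qed.

Lemma sqr_conj_diag (C : numClosedFieldType) m (U : 'M[C]_m) (e : 'rV[C]_m) :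
  U *m U^t* = 1%:M ->
  (U^t* *m diag_mx e *m U) *m (U^t* *m diag_mx e *m U) =
  U^t* *m diag_mx (\row_k e 0 k ^+ 2) *m U.
Proof.
move=> UU; rewrite !mulmxA -(mulmxA _ U) UU mulmx1.
rewrite -(mulmxA _ (diag_mx e) (diag_mx e)); congr (_ *m _ *m _).
rewrite mul_diag_mx; apply/matrixP => i j.
by rewrite !mxE mulrnAr expr2.
Qed.

(** Diagonalise A over the complex numbers by a unitary matrix U: the weights
    |U_ki|^2 are doubly stochastic, and the diagonals of A = U^* D U and of
    A^2 = U^* D^2 U are the corresponding means of the eigenvalues and of their
    squares.  The eigenvalues produced by the spectral theorem are matched to
    the given list by uniqueness of the factorisation of the characteristic
    polynomial. *)
Lemma spectral_weights (R : realType) (m : nat) (A : 'M[R]_m) (l : nat -> R) :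
  A^T = A -> eigenvalues_of A l ->
  exists W : 'I_m -> 'I_m -> R,
  [/\ forall i k, 0 <= W i k,
      forall i, \sum_k W i k = 1,
      forall k, \sum_i W i k = 1,
      forall i, \sum_k W i k * l k = A i i &
      forall i, \sum_k W i k * l k ^+ 2 = (A *m A) i i].
Proof.
move=> symA eigA.
pose B := map_mx (real_complex R) A.
have BT : B^T = B by rewrite /B map_trmx symA.
have hB : B \is hermsymmx.
  apply: realsym_hermsym.
    by apply/is_hermitianmxP; rewrite expr0 scale1r map_mx_id// BT.
  by apply/mxOverP => i j; rewrite mxE; apply/complex_realP; exists (A i j).
have [U [sp [UU BE]]] : exists U, exists sp : 'rV_m,
    U *m U^t* = 1%:M /\ B = U^t* *m diag_mx sp *m U.
  exists (spectralmx B), (spectral_diag B); split.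
    exact/unitarymxP/spectral_unitarymx.
  rewrite -invmx_unitary ?spectral_unitarymx//.
  exact/orthomx_spectralP/hermitian_normalmx.
have UU' : U^t* *m U = 1%:M by exact: mulmx1C.
have BBE : B *m B = U^t* *m diag_mx (\row_k sp 0 k ^+ 2) *m U.
  by rewrite BE sqr_conj_diag.
have one : 1%:M = U^t* *m diag_mx (const_mx 1) *m U.
  by rewrite diag_const_mx mulmx1.
have permsp : perm_eq [tuple (l k)%:C%C | k < m] [tuple sp 0 k | k < m].
  apply: prod_XsubC_perm; rewrite !big_tuple; under eq_bigr do rewrite tnth_mktuple.
  under [RHS]eq_bigr do rewrite tnth_mktuple.
  symmetry.
  transitivity (char_poly B).
    have -> : char_poly B = char_poly (diag_mx sp) by rewrite BE char_poly_conj.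
    rewrite char_poly_trig ?diag_mx_is_trig//.
    by apply: eq_bigr => k _; rewrite mxE eqxx mulr1n.
  rewrite /B -map_char_poly eigA rmorph_prod; apply: eq_bigr => k _ /=.
  by rewrite map_polyXsubC.
have [s sE] : exists s : 'I_m -> 'I_m, injective s /\
    forall k, sp 0 (s k) = (l k)%:C%C.
  have /tuple_permP[s sE] := permsp.
  exists s; split; first exact: perm_inj.
  move=> k; have := congr1 (fun t => tnth t k) (val_inj sE).
  by rewrite !tnth_mktuple.
case: sE => sinj sE.
pose W i k := complex.Re (U (s k) i) ^+ 2 + complex.Im (U (s k) i) ^+ 2.
have WE i k : (W i k)%:C%C = `|U (s k) i| ^+ 2 by rewrite add_Re2_Im2.
exists W; split.
- by move=> i k; rewrite addr_ge0 ?sqr_ge0.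
- move=> i; apply: complexI; rewrite rmorph_sum rmorph1.
  under eq_bigr do rewrite /= WE.
  have := congr1 (fun M : matrix _ m m => M i i) one; rewrite conj_diagE !mxE eqxx mulr1n => ->.
  rewrite [RHS](reindex_inj sinj).
  by apply: eq_bigr => k _; rewrite mxE mulr1.
- move=> k; apply: complexI; rewrite rmorph_sum rmorph1.
  have := congr1 (fun M : matrix _ m m => M (s k) (s k)) UU; rewrite !mxE eqxx mulr1n => <-.
  by apply: eq_bigr => i _; rewrite /= WE !mxE normCK.
- move=> i; apply: complexI; rewrite rmorph_sum.
  have := congr1 (fun M : matrix _ m m => M i i) BE; rewrite conj_diagE !mxE => ->.
  rewrite [RHS](reindex_inj sinj).
  by apply: eq_bigr => k _; rewrite rmorphM/= WE sE.
- move=> i; apply: complexI; rewrite rmorph_sum.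
  have := congr1 (fun M : matrix _ m m => M i i) BBE; rewrite conj_diagE.
  rewrite /B -map_mxM mxE => ->.
  rewrite [RHS](reindex_inj sinj).
  by apply: eq_bigr => k _; rewrite mxE rmorphM rmorphXn/= WE sE.
Qed.
End SpectralWeights.

(** * Functions with compact support in the open half-line *)

Section CompactSupport.
Context {R : realType}.
Implicit Types g h : R -> R.

(** The support stays away from 0 as well as from infinity; the bound below is
    what makes test functions insensitive to the many small points. *)
Definition compact_support_pos g := continuous g /\
  exists delta M : R, 0 < delta /\ forall x, g x != 0 -> delta <= x <= M.

(** Uniform continuity on the segment [delta - 1, M + 1]; outside of it, g
    vanishes at both points. *)
Lemma compact_support_unif g : compact_support_pos g ->
  forall e : R, 0 < e -> exists2 eta : R, 0 < eta &
    forall x y, `|x - y| <= eta -> `|g x - g y| <= e.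
Proof.
move=> [cg [delta [M [d0 supp]]]] e e0.
have /compact_near_coveringP := @segment_compact R (delta - 1) (M + 1).
move=> /(_ R (0^'+)
  (fun eta x => forall y : R, `|(x : R) - y| <= eta -> `|g x - g y| <= e) _).
case.
  move=> x _.
  have /cvgr_dist_lt/(_ (e / 2)) := cg x; rewrite divr_gt0// => /(_ isT).
  move=> /nbhs_ballP[r /= r0 gr].
  exists (ball x (r / 2), [set eta | eta < r / 2]) => /=.
    split; first by apply: nbhsx_ballx; rewrite divr_gt0.
    by apply: nbhs_right_lt; rewrite divr_gt0.
  move=> [x' eta]/= [xx' er] y x'y.
  have xx'r : `|(x : R) - x'| < r.
    by rewrite (lt_le_trans xx')// ler_pdivrMr// ler_peMr// ?ltW// ltr1n.
  rewrite (le_trans (ler_distD (g x) _ _))// [leRHS]splitr lerD//.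
    by rewrite distrC ltW// gr.
  have xyr : `|(x : R) - y| < r.
    rewrite (le_lt_trans (ler_distD x' _ _))// [ltRHS]splitr.
    by rewrite ltrD// (le_lt_trans x'y).
  by rewrite ltW// gr.
move=> r /= r0 rP; rewrite /ball_/= in rP.
pose eta := Num.min (r / 2) 1.
have eta0 : 0 < eta by rewrite lt_min divr_gt0/=.
have etar : eta < r by rewrite gt_min ltr_pdivrMr// ltr_pMr// ltr1n.
have eta1 : eta <= 1 by rewrite ge_min lexx orbT.
have {}rP (x y : R) : delta - 1 <= x <= M + 1 -> `|x - y| <= eta -> `|g x - g y| <= e.
  by move=> xM; apply: rP => //=; rewrite sub0r normrN gtr0_norm.
exists eta => // x y xy.
have [xM|xM] := boolP (delta - 1 <= x <= M + 1); first exact: rP.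
have [yM|yM] := boolP (delta - 1 <= y <= M + 1).
  by rewrite distrC rP// distrC.
have gz z : ~~ (delta - 1 <= z <= M + 1) -> g z = 0.
  move=> zM; apply/eqP; apply: contraNT zM => /supp /andP[]; lra.
by rewrite !gz// subrr normr0 ltW.
Qed.

Lemma compact_support_bounded g : compact_support_pos g ->
  exists2 B : R, 0 < B & forall x, `|g x| <= B.
Proof.
move=> [cg [delta [M [d0 supp]]]].
have [Md|dM] := ltP M delta.
  exists 1 => // x; have [->|] := eqVneq (g x) 0; first by rewrite normr0.
  by move=> /supp /andP[] /le_trans/[apply]; rewrite leNgt Md.
have [|c _ cmax] := @EVT_max R (fun x => `|g x|) _ _ dM.
  apply: continuous_subspaceT => x; apply: continuous_comp; first exact: cg.
  exact: norm_continuous.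
exists (`|g c| + 1) => [|x]; first by rewrite ltr_wpDl.
have [->|/supp xM] := eqVneq (g x) 0; first by rewrite normr0 addr_ge0.
by rewrite (le_trans (cmax x _)) ?in_itv//= lerDl.
Qed.

(** Uniform continuity for close points, boundedness for the others. *)
Lemma compact_support_modulus g : compact_support_pos g ->
  forall e : R, 0 < e -> exists2 C : R, 0 < C &
    forall x y, `|g x - g y| <= e + C * `|x - y|.
Proof.
move=> gP e e0; have [eta eta0 etaP] := compact_support_unif gP e0.
have [B B0 BP] := compact_support_bounded gP.
exists (2 * B / eta) => [|x y]; first by rewrite divr_gt0// mulr_gt0.
have [/etaP xy|xy] := leP `|x - y| eta.
  by rewrite (le_trans xy)// lerDl mulr_ge0// ltW// divr_gt0// mulr_gt0.
rewrite (le_trans (ler_normB _ _))// (@le_trans _ _ (2 * B))//.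
  by rewrite mulr_natl mulr2n lerD.
apply: ler_wpDl; first exact: ltW.
rewrite -mulrA ler_peMr//; first by rewrite mulr_ge0// ltW.
by rewrite mulrC ler_pdivlMr// mul1r ltW.
Qed.

(** The additive error e of a modulus of continuity can be made proportional to
    y: when x and y are close and g x or g y is nonzero, y is bounded below.
    Summed over the diagonal of a Gram matrix, e times the trace stays bounded
    although the number of rows does not. *)
Lemma compact_support_quadratic_modulus g : compact_support_pos g ->
  forall e : R, 0 < e -> exists2 C : R, 0 < C &
    forall x y, 0 <= y -> `|g x - g y| <= e * y + C * (x - y) ^+ 2.
Proof.
move=> gP e e0; have [cg [delta [M [d0 supp]]]] := gP.
have ed0 : 0 < e * (delta / 2) by rewrite mulr_gt0// divr_gt0.
have [eta eta0 etaP] := compact_support_unif gP ed0.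
have [B B0 BP] := compact_support_bounded gP.
(* |x - y| <= delta / 2 forces y >= delta / 2 when x or y is in the support *)
pose m := Num.min eta (delta / 2).
have m0 : 0 < m by rewrite lt_min eta0 divr_gt0.
exists (2 * B / m ^+ 2) => [|x y y0].
  by rewrite divr_gt0// ?mulr_gt0// exprn_gt0.
have sq0 : 0 <= 2 * B / m ^+ 2 * (x - y) ^+ 2.
  by rewrite mulr_ge0 ?sqr_ge0// ltW// divr_gt0// ?mulr_gt0// exprn_gt0.
have [xy|xy] := leP `|x - y| m; last first.
  rewrite (le_trans (ler_normB _ _))// (@le_trans _ _ (2 * B))//.
    by rewrite mulr_natl mulr2n lerD.
  apply: ler_wpDl; first by rewrite mulr_ge0// ltW.
  rewrite -mulrA ler_peMr//; first by rewrite mulr_ge0// ltW.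
  rewrite mulrC ler_pdivlMr ?exprn_gt0// mul1r.
  by rewrite -[leRHS]real_normK ?num_real// lerXn2r// ?nnegrE ltW.
have [gxy|] := eqVneq (`|g x - g y|) 0.
  by rewrite gxy addr_ge0// mulr_ge0// ltW.
move=> gxy; have yd : delta / 2 <= y.
  have : m <= delta / 2 by rewrite ge_min lexx orbT.
  have [gx|/supp/andP[]] := eqVneq (g x) 0; last first.
    by move: xy; rewrite ler_norml => /andP[]; lra.
  have [gy|/supp/andP[]] := eqVneq (g y) 0; last by lra.
  by move: gxy; rewrite gx gy subrr normr0 eqxx.
rewrite (@le_trans _ _ (e * y))// ?lerDl//.
rewrite (le_trans (etaP _ _ _))// ?(le_trans xy)// ?ge_min ?lexx//.
by rewrite ler_wpM2l// ltW.
Qed.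

(** g x / x extends continuously by 0 since g vanishes near 0.  Writing
    g u = u (g u / u) turns a modulus of continuity into an error weighted
    by u. *)
Lemma compact_support_div g : compact_support_pos g ->
  compact_support_pos (fun x => g x / x).
Proof.
move=> [cg [delta [M [d0 supp]]]]; split; last first.
  exists delta, M; split => // x gx0; apply: supp.
  by apply: contra gx0 => /eqP ->; rewrite mul0r.
move=> x; have [xd|xd] := ltP x delta.
  have gz : \forall y \near x, g y / y = 0.
    near=> y; have yd : y < delta by near: y; exact: lt_nbhsl.
    suff -> : g y = 0 by rewrite mul0r.
    apply/eqP; apply: contraTT yd => /supp/andP[]; by rewrite -leNgt.
  rewrite /continuous_at (nbhs_singleton gz).
  exact: cvg_near_cst.
apply: cvgM; first exact: cg.
by apply: cvgV; [rewrite gt_eqF// (lt_le_trans d0)|exact: cvg_id].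
Unshelve. all: by end_near. Qed.
End CompactSupport.

(** * Spectrum and entries of a Gram matrix *)

Section GramSpectrum.
Context {R : realType} (m n : nat) (y : 'I_m -> 'I_n -> R).

Definition row_cross :=
  \sum_i \sum_(j | j != i) (\sum_t y i t * y j t) ^+ 2.
Definition entry_cross :=
  \sum_i \sum_t \sum_(s | s != t) y i s ^+ 2 * y i t ^+ 2.

Definition gram_mx : 'M[R]_m := \matrix_(i, j) \sum_t y i t * y j t.

Lemma gram_mx_sym : gram_mx^T = gram_mx.
Proof.
by apply/matrixP => i j; rewrite !mxE; apply: eq_bigr => t _; rewrite mulrC.
Qed.

Let rowsq i := \sum_t y i t ^+ 2.

Lemma gram_mx_diag i : gram_mx i i = rowsq i.
Proof. by rewrite mxE; apply: eq_bigr => t _; rewrite expr2. Qed.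

(** The squared deviations of the eigenvalues from the i-th diagonal entry,
    averaged with the weights of row i, sum to the off-diagonal squares of that
    row, so a quadratic modulus of continuity transfers from points to
    spectra. *)
Lemma eigen_gram_sum (f : R -> R) (e C : R) (l : nat -> R) :
  eigenvalues_of gram_mx l ->
  (forall u v, 0 <= v -> `|f u - f v| <= e * v + C * (u - v) ^+ 2) ->
  `|\sum_(k < m) f (l k) - \sum_i f (rowsq i)| <=
  e * (\sum_i rowsq i) + C * row_cross.
Proof.
move=> eigl fP.
have [W [W0 Wr Wc Wl Wl2]] := spectral_weights gram_mx_sym eigl.
have -> : \sum_(k < m) f (l k) = \sum_i \sum_k W i k * f (l k).
  by rewrite exchange_big; apply: eq_bigr => k _; rewrite -mulr_suml Wc mul1r.
have -> : \sum_i f (rowsq i) = \sum_i \sum_k W i k * f (rowsq i).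
  by apply: eq_bigr => i _; rewrite -mulr_suml Wr mul1r.
rewrite -sumrB (le_trans (ler_norm_sum _ _ _))// /row_cross !mulr_sumr -big_split/=.
apply: ler_sum => i _; set D := rowsq i.
have D0 : 0 <= D by rewrite sumr_ge0// => t _; rewrite sqr_ge0.
rewrite -sumrB (le_trans (ler_norm_sum _ _ _))//.
rewrite (@le_trans _ _ (\sum_k W i k * (e * D + C * (l k - D) ^+ 2)))//.
  by apply: ler_sum => k _; rewrite -mulrBr normrM ger0_norm// ler_wpM2l// fP.
rewrite le_eqVlt; apply/orP; left; apply/eqP.
have alg (v : R) : \sum_k W i k * (e * v + C * (l k - v) ^+ 2) =
    e * v * (\sum_k W i k) + C * (\sum_k W i k * l k ^+ 2
      - 2 * v * (\sum_k W i k * l k) + v ^+ 2 * (\sum_k W i k)).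
  rewrite mulrDr mulrBr !mulr_sumr -sumrB -!big_split/=.
  by apply: eq_bigr => k _; ring.
rewrite alg Wr Wl Wl2 mulr1 gram_mx_diag mxE.
congr (_ + C * _); rewrite mulr1.
rewrite (bigD1 i)//= gram_mx_diag.
transitivity (\sum_(j < m | j != i) gram_mx i j * gram_mx j i).
  by rewrite -/D; ring.
apply: eq_bigr => j _; rewrite !mxE.
have -> : \sum_t y j t * y i t = \sum_t y i t * y j t.
  by apply: eq_bigr => t _; rewrite mulrC.
by rewrite expr2.
Qed.

(** With f u = u h(u), both f(sum_t u_t) and sum_t f(u_t) are sums over t of
    u_t times a value of h, at the points sum_s u_s and u_t, whose difference is
    the sum of the remaining u_s. *)
Lemma row_entries_sum (f : R -> R) (e C : R) :
  (forall u v, `|f u / u - f v / v| <= e + C * `|u - v|) ->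
  f 0 = 0 ->
  `|\sum_i f (rowsq i) - \sum_i \sum_t f (y i t ^+ 2)| <=
  e * (\sum_i rowsq i) + C * entry_cross.
Proof.
move=> fP f00.
have fE u : f u = u * (f u / u).
  have [->|u0] := eqVneq u 0; first by rewrite f00 mul0r.
  by rewrite mulrC divfK.
rewrite -sumrB (le_trans (ler_norm_sum _ _ _))// /entry_cross !mulr_sumr -big_split/=.
apply: ler_sum => i _.
rewrite [X in X - _]fE [X in X * (_ / _)]/rowsq mulr_suml -sumrB.
rewrite (le_trans (ler_norm_sum _ _ _))// /rowsq !mulr_sumr -big_split/=.
apply: ler_sum => t _; rewrite -/(rowsq i) [X in _ - X]fE -mulrBr normrM.
have w0 : 0 <= y i t ^+ 2 := sqr_ge0 _.
rewrite ger0_norm// (le_trans (ler_wpM2l w0 (fP _ _)))//.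
rewrite mulrDr lerD//; first by rewrite mulrC.
have -> : rowsq i - y i t ^+ 2 = \sum_(s | s != t) y i s ^+ 2.
  by rewrite /rowsq (bigD1 t)//=; ring.
rewrite ger0_norm; last by rewrite sumr_ge0// => s _; rewrite sqr_ge0.
rewrite le_eqVlt; apply/orP; left; apply/eqP.
by rewrite -mulr_suml; ring.
Qed.

End GramSpectrum.

Lemma eigen_entries_close {R : realType} (g : R -> R) (e : R) :
  compact_support_pos g -> 0 < e -> exists2 C : R, 0 < C &
  forall m n (y : 'I_m -> 'I_n -> R) l, eigenvalues_of (gram_mx y) l ->
  `|\sum_(k < m) g (l k) - \sum_i \sum_t g (y i t ^+ 2)| <=
  e * (\sum_i \sum_t y i t ^+ 2) + C * (row_cross y + entry_cross y).
Proof.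
move=> gP e0; have e2 : 0 < e / 2 by rewrite divr_gt0.
have [C1 C10 H1] := compact_support_quadratic_modulus gP e2.
have [C2 C20 H2] := compact_support_modulus (compact_support_div gP) e2.
exists (C1 + C2) => [|m n y l eigl]; first exact: addr_gt0.
have g00 : g 0 = 0.
  have [_ [delta [M [d0 supp]]]] := gP.
  by apply/eqP; apply/negP => /negP/supp/andP[+ _]; rewrite leNgt d0.
have := eigen_gram_sum eigl H1; have := row_entries_sum y H2 g00.
set S1 := \sum_(k < m) _; set S2 := \sum_i g _; set S3 := \sum_i \sum_t g _.
set Q := \sum_i _; rewrite -/Q.
have r0 : 0 <= row_cross y.
  by apply: sumr_ge0 => i _; apply: sumr_ge0 => j _; exact: sqr_ge0.
have c0 : 0 <= entry_cross y.
  apply: sumr_ge0 => i _; apply: sumr_ge0 => t _; apply: sumr_ge0 => s _.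
  by rewrite mulr_ge0// sqr_ge0.
have p1 : 0 <= C1 * entry_cross y by rewrite mulr_ge0// ltW.
have p2 : 0 <= C2 * row_cross y by rewrite mulr_ge0// ltW.
move=> E1 E2; have := ler_distD S1 S2 S3; lra.
Qed.

(** X - c A is c times the substitution of X / c into X - A. *)
Lemma eigenvalues_of_scale {R : realType} m (A : 'M[R]_m) (c : R) l :
  c != 0 -> eigenvalues_of A l -> eigenvalues_of (c *: A) (fun i => c * l i).
Proof.
move=> c0; rewrite /eigenvalues_of => eigl.
have cq : c%:P * (c^-1 *: 'X) = 'X by rewrite mul_polyC scalerA mulfV// scale1r.
have -> : char_poly (c *: A) = c%:P ^+ m * (char_poly A \Po (c^-1 *: 'X)).
  rewrite /char_poly -det_map_mx -detZ; congr (\det _).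
  apply/matrixP => i j; rewrite !mxE rmorphB rmorphMn/= comp_polyX comp_polyC.
  by rewrite mulrBr mulrnAr cq polyCM.
rewrite eigl rmorph_prod/= -[m in c%:P ^+ m]card_ord -prodr_const -big_split/=.
apply: eq_bigr => i _; rewrite rmorphB/= comp_polyX comp_polyC mulrBr cq.
by rewrite polyCM.
Qed.

(** * Comparison of integrals, laws and independence *)

Section Integration.
Context d (T : measurableType d) (R : realType).
Local Open Scope ereal_scope.

(** The integral of a nonnegative function is the supremum of the integrals of
    the simple functions below it, which is monotone for arbitrary functions.
    The eigenvalues are arbitrary functions of the outcome, so their Laplace
    functional has to be handled at this level. *)
Lemma le_integral_nonmeasurable (mu : {measure set T -> \bar R}) (f g : T -> \bar R) :
  (forall x, 0 <= f x) -> (forall x, f x <= g x) ->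
  \int[mu]_x f x <= \int[mu]_x g x.
Proof.
move=> f0 fg; have g0 x : 0 <= g x by exact: le_trans (f0 x) (fg x).
rewrite !ge0_integralTE//; apply: ereal_sup_le => _ [h hf <-].
by exists h => // x; exact: le_trans (hf x) (fg x).
Qed.

(** An arbitrary h within err of a measurable e is squeezed between the
    measurable functions max(e - err, 0) and e + err. *)
Lemma integral_close (P : probability T R) (h e err : T -> R) :
  (forall x, 0 <= h x)%R ->
  measurable_fun setT e -> (forall x, 0 <= e x)%R ->
  measurable_fun setT err -> (forall x, 0 <= err x)%R ->
  (forall x, `|h x - e x| <= err x)%R ->
  \int[P]_x (h x)%:E <= \int[P]_x (e x)%:E + \int[P]_x (err x)%:E /\
  \int[P]_x (e x)%:E <= \int[P]_x (h x)%:E + \int[P]_x (err x)%:E.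
Proof.
move=> h0 me e0 merr err0 he; split.
  rewrite -ge0_integralD//=; try by move=> x _; rewrite lee_fin.
  - apply: le_integral_nonmeasurable => x; first by rewrite lee_fin.
    rewrite -EFinD lee_fin.
    by have := he x; rewrite ler_norml => /andP[_]; lra.
  - exact/measurable_EFinP.
  - exact/measurable_EFinP.
have mb : measurable_fun setT (fun x => Num.max (e x - err x) 0)%R.
  by apply: measurable_maxr => //; exact: measurable_funB.
apply: (@le_trans _ _
   (\int[P]_x (Num.max (e x - err x) 0)%:E + \int[P]_x (err x)%:E)).
  rewrite -ge0_integralD//=.
  - apply: ge0_le_integral => //=.
    + by move=> x _; rewrite lee_fin.
    + exact/measurable_EFinP.
    + by apply/measurable_EFinP; apply: measurable_funD.
    + by move=> x _; rewrite -EFinD lee_fin -lerBlDr le_max lexx.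
  - by move=> x _; rewrite lee_fin le_max lexx orbT.
  - exact/measurable_EFinP.
  - by move=> x _; rewrite lee_fin.
  - exact/measurable_EFinP.
rewrite leeD2r//; apply: le_integral_nonmeasurable => x.
  by rewrite lee_fin le_max lexx orbT.
rewrite lee_fin ge_max h0 andbT.
by have := he x; rewrite ler_norml => /andP[+ _]; lra.
Qed.

End Integration.

Section Transfer.
Context {R : realType}.
Local Open Scope ereal_scope.

Lemma eq_law_integral d1 d2 d (T1 : measurableType d1) (T2 : measurableType d2)
    (U : measurableType d) (P1 : probability T1 R) (P2 : probability T2 R)
    (X : T1 -> U) (Y : T2 -> U) (F : U -> \bar R) :
  eq_law P1 P2 X Y -> measurable_fun setT X -> measurable_fun setT Y ->
  measurable_fun setT F -> (forall u, 0 <= F u) ->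
  \int[P1]_w F (X w) = \int[P2]_w F (Y w).
Proof.
move=> XY mX mY mF F0.
have HX := ge0_integral_pushforward mX P1 measurableT mF (fun y _ => F0 y).
have HY := ge0_integral_pushforward mY P2 measurableT mF (fun y _ => F0 y).
rewrite !preimage_setT in HX HY.
transitivity (\int[pushforward P1 X]_y F y); first by rewrite HX.
transitivity (\int[pushforward P2 Y]_y F y); last by rewrite HY.
by apply: eq_measure_integral => A mA _; exact: XY.
Qed.

End Transfer.

Section IndependentPair.
Context {R : realType} d d1 d2 (T : measurableType d) (P : probability T R)
  (U1 : measurableType d1) (U2 : measurableType d2) (U : T -> U1) (V : T -> U2).
Local Open Scope ereal_scope.
Hypotheses (mU : measurable_fun setT U) (mV : measurable_fun setT V).
Hypothesis UV : forall A B, measurable A -> measurable B ->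
  P (U @^-1` A `&` V @^-1` B) = P (U @^-1` A) * P (V @^-1` B).

(** Independence says that the joint law of U and V is the product of their
    laws; the formula is then the Fubini-Tonelli theorem. *)
Lemma independent_fubini (F : U1 * U2 -> \bar R) :
  measurable_fun setT F -> (forall z, 0 <= F z) ->
  \int[P]_w F (U w, V w) = \int[P]_w \int[P]_w' F (U w, V w').
Proof.
move=> mF F0.
pose mUi := isMeasurableFun.Build _ _ _ _ U mU.
pose mVi := isMeasurableFun.Build _ _ _ _ V mV.
pose Um : {mfun T >-> U1} := HB.pack U mUi.
pose Vm : {mfun T >-> U2} := HB.pack V mVi.
have mW : measurable_fun setT (fun w => (U w, V w)).
  exact: measurable_fun_pair.
pose mWi := isMeasurableFun.Build _ _ _ _ (fun w => (U w, V w)) mW.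
pose W : {mfun T >-> (U1 * U2)%type} := HB.pack (fun w => (U w, V w)) mWi.
transitivity (\int[distribution P W]_z F z).
  by rewrite ge0_integral_distribution.
transitivity (\int[distribution P Um \x distribution P Vm]_z F z).
  apply: eq_measure_integral => A mA _; apply/esym.
  by apply: product_measure_unique => // B C mB mC; exact: UV.
rewrite fubini_tonelli1// ge0_integral_distribution//.
- apply: eq_integral => w _ /=; rewrite /fubini_F.
  rewrite ge0_integral_distribution//.
  exact: measurableT_comp.
- exact: measurable_fun_fubini_tonelli_F.
- by move=> y; exact: integral_ge0.
Qed.

End IndependentPair.

Section IndependentClasses.
Context {R : realType} d (T : measurableType d) (P : probability T R)
  (I : choiceType) (G : I -> set (set T)).
Local Open Scope ereal_scope.
Hypothesis mG : forall i, G i `<=` measurable.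
Hypothesis GI : forall i, setI_closed (G i).
Hypothesis GT : forall i, G i setT.
Hypothesis indG : independent_classes P G.

(** Intersections of events taken from the G j, j in J, form a pi-system on which
    B |-> P(A & B) and P A * P B agree by hypothesis; the two finite measures then
    agree on the sigma-algebra it generates. *)
Lemma independent_classes_join (i : I) (J : {fset I}) A B :
  i \notin J -> G i A -> <<s \bigcup_(j in [set` J]) G j >> B ->
  P (A `&` B) = P A * P B.
Proof.
move=> iJ GA sB; have mA := mG GA.
pose E := [set B | exists2 C : I -> set T, (forall j, j \in J -> G j (C j)) &
  B = \bigcap_(j in [set` J]) C j].
have PE C : (forall j, j \in J -> G j (C j)) ->
    P (A `&` \bigcap_(j in [set` J]) C j) =
    P A * P (\bigcap_(j in [set` J]) C j).
  move=> GC; pose C' j := if j == i then A else C j.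
  have C'J j : j \in J -> C' j = C j.
    by rewrite /C'; case: eqP => // -> iJ'; rewrite iJ' in iJ.
  have C'i : C' i = A by rewrite /C' eqxx.
  have GC' j : j \in (i |` J)%fset -> G j (C' j).
    by rewrite !inE => /predU1P[->|jJ]; rewrite ?C'i// C'J//; exact: GC.
  have := indG GC'; rewrite big_fsetU1//= C'i (indG GC).
  have -> : \prod_(j <- J) P (C' j) = \prod_(j <- J) P (C j).
    by apply: eq_big_seq => j jJ; rewrite C'J.
  move=> <-; congr (P _).
  rewrite set_fsetU1 bigcap_setU1 C'i; congr (_ `&` _).
  by apply: eq_bigcapr => j jJ; rewrite C'J.
have Em : E `<=` measurable.
  move=> _ [C GC ->]; apply: fin_bigcap_measurable => //.
  by move=> j /GC /mG.
have mE : <<s E >> `<=` measurable.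
  by apply: smallest_sub => //; exact: sigma_algebra_measurable.
have sE : <<s \bigcup_(j in [set` J]) G j >> `<=` <<s E >>.
  apply: smallest_sub; first exact: smallest_sigma_algebra.
  move=> C [j /= jJ GjC]; apply: sub_gen_smallest.
  exists (fun k => if k == j then C else setT).
    by move=> k _; case: eqP => [->|].
  apply/seteqP; split=> [w Cw k _|w /(_ j jJ)]; last by rewrite eqxx.
  by case: eqP.
have PAfin : P A \is a fin_num by exact: fin_num_measure.
pose r := NngNum (fine_ge0 (measure_ge0 P A)).
have rE : r%:num%:E = P A by rewrite /= fineK.
transitivity (mrestr P mA B); first by rewrite /mrestr setIC.
transitivity (mscale r P B); last by rewrite /mscale rE.
apply: (@g_sigma_algebra_measure_unique _ _ _ E Em (fun=> setT)) => //.
- by move=> _; exists (fun=> setT) => //; apply/seteqP; split.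
- by apply/seteqP; split => // w _; exists 0%N.
- move=> _ _ [C GC ->] [C' GC' ->]; exists (fun j => C j `&` C' j).
    by move=> j jJ; apply: GI; [exact: GC|exact: GC'].
  by rewrite bigcapI.
- move=> _ [C GC ->].
  transitivity (P A * P (\bigcap_(j in [set` J]) C j)); last by rewrite -rE.
  by rewrite -PE// setIC.
- move=> _; suff : P (setT `&` A) < +oo by []. by rewrite setTI ltey_eq PAfin.
- exact: sE.
Qed.

End IndependentClasses.

Section IndependentExpectation.
Context {R : realType} d (T : measurableType d) (P : probability T R).
Local Open Scope ereal_scope.

(** The sample space with the sigma-algebra generated by the family X, so that
    measurability with respect to that family is ordinary measurability. *)
Definition gen_space (I : Type) (X : I -> T -> R) :=
  g_sigma_algebraType
    (\bigcup_(i in [set: I]) preimage_set_system setT (X i) measurable).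

Lemma measurable_gen_space (I : Type) (X : I -> T -> R) i :
  measurable_fun [set: gen_space X] (X i : gen_space X -> R).
Proof.
move=> _ B mB; rewrite setTI; apply: sub_sigma_algebra.
by exists i => //; exists B => //; rewrite setTI.
Qed.

Lemma gen_space_measurable (I : Type) (X : I -> T -> R) :
  (forall i, measurable_fun setT (X i)) -> sigma_gen X `<=` measurable.
Proof.
move=> mX; apply: smallest_sub; first exact: sigma_algebra_measurable.
by move=> _ [i _ [B mB <-]]; exact: mX.
Qed.

Lemma gen_space_measurable_fun (I : Type) (X : I -> T -> R) d' (U : measurableType d') (f : T -> U) :
  (forall i, measurable_fun setT (X i)) ->
  measurable_fun [set: gen_space X] (f : gen_space X -> U) -> measurable_fun setT f.
Proof.
move=> mX mf _ B mB; apply: (gen_space_measurable mX).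
exact: (mf measurableT B mB).
Qed.

Lemma expectation_mul (Y1 Y2 : T -> R) :
  measurable_fun setT Y1 -> measurable_fun setT Y2 ->
  (forall w, 0 <= Y1 w)%R -> (forall w, 0 <= Y2 w)%R ->
  (forall A B, measurable A -> measurable B ->
    P (Y1 @^-1` A `&` Y2 @^-1` B) = P (Y1 @^-1` A) * P (Y2 @^-1` B)) ->
  \int[P]_w (Y1 w * Y2 w)%:E = \int[P]_w (Y1 w)%:E * \int[P]_w (Y2 w)%:E.
Proof.
move=> mY1 mY2 Y10 Y20 ind.
have := @independent_fubini _ _ _ _ _ P _ _ Y1 Y2 mY1 mY2 ind
  (fun z => `|z.1 * z.2|%:E).
rewrite (_ : (fun w => _) = (fun w => (Y1 w * Y2 w)%:E)); last first.
  by apply/funext => w /=; rewrite ger0_norm// mulr_ge0.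
move=> ->; last 2 first.
- apply/measurable_EFinP; apply: measurableT_comp => //.
  by apply: measurable_funM; [exact: measurable_fst|exact: measurable_snd].
- by move=> z; rewrite lee_fin.
have mEY2 : measurable_fun setT (fun w => (Y2 w)%:E) by exact/measurable_EFinP.
under eq_integral => w _.
  under eq_integral do rewrite /= ger0_norm ?mulr_ge0// EFinM.
  rewrite ge0_integralZl//; last 2 first.
  - by move=> w' _; rewrite lee_fin.
  - by rewrite lee_fin.
  over.
rewrite ge0_integralZr//.
- exact/measurable_EFinP.
- by move=> w _; rewrite lee_fin.
- by apply: integral_ge0 => w _; rewrite lee_fin.
Qed.

Lemma expectation_mul_families (I J : Type) (X : I -> T -> R) (X' : J -> T -> R)
    (Y1 Y2 : T -> R) :
  (forall i, measurable_fun setT (X i)) -> (forall i, measurable_fun setT (X' i)) ->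
  independent_pair P X X' ->
  measurable_fun [set: gen_space X] (Y1 : gen_space X -> R) ->
  measurable_fun [set: gen_space X'] (Y2 : gen_space X' -> R) ->
  (forall w, 0 <= Y1 w)%R -> (forall w, 0 <= Y2 w)%R ->
  \int[P]_w (Y1 w * Y2 w)%:E = \int[P]_w (Y1 w)%:E * \int[P]_w (Y2 w)%:E.
Proof.
move=> mX mX' ind mY1 mY2 Y10 Y20; apply: expectation_mul => //.
- exact: gen_space_measurable_fun mY1.
- exact: gen_space_measurable_fun mY2.
- move=> A B mA mB; apply: ind.
  + by have := mY1 measurableT _ mA; rewrite setTI.
  + by have := mY2 measurableT _ mB; rewrite setTI.
Qed.

(** By induction on s: the first factor is independent of the sigma-algebra
    generated by the other families, hence of the product of the others. *)
Lemma expectation_prod (I : choiceType) (K : I -> Type) (X : forall i, K i -> T -> R)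
    (Y : I -> T -> R) (s : seq I) :
  (forall i k, measurable_fun setT (X i k)) ->
  independent_families P X ->
  (forall i, measurable_fun [set: gen_space (X i)] (Y i : gen_space (X i) -> R)) ->
  (forall i w, 0 <= Y i w)%R -> uniq s ->
  \int[P]_w (\prod_(i <- s) Y i w)%:E = \prod_(i <- s) \int[P]_w (Y i w)%:E.
Proof.
move=> mX ind mY Y0; elim: s => [_|i s IH /= /andP[ins us]].
  rewrite big_nil (eq_integral (fun=> 1))//; last by move=> w _; rewrite big_nil.
  by rewrite (integral_cst P measurableT) mul1e; exact: probability_setT.
rewrite big_cons -IH//; under eq_integral do rewrite big_cons.
have mYi j : measurable_fun setT (Y j) by exact: gen_space_measurable_fun (mY j).
apply: expectation_mul => //.
- exact: measurable_prod.
- by move=> w; exact: prodr_ge0.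
move=> A B mA mB.
pose J := [fset j in s]%fset.
apply: (@independent_classes_join _ _ _ P _ (fun i => sigma_gen (X i)) _ _ _ ind i J).
- by move=> j; exact: gen_space_measurable.
- move=> j C D; exact: (@measurableI _ (gen_space (X j))).
- move=> j; exact: (@measurableT _ (gen_space (X j))).
- by rewrite !inE.
- by have := mY i measurableT _ mA; rewrite setTI.
pose GJ := g_sigma_algebraType (\bigcup_(j in [set` J]) sigma_gen (X j)).
have mprod : measurable_fun [set: GJ] ((fun w => \prod_(j <- s) Y j w)%R : GJ -> R).
  apply: measurable_prod => j js _ C mC; rewrite setTI; apply: sub_sigma_algebra.
  exists j; first by rewrite /= !inE.
  by have := mY j measurableT _ mC; rewrite setTI.
by have := mprod measurableT _ mB; rewrite setTI.
Qed.

End IndependentExpectation.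

(** * Integrals of real functions and power functions *)

Section RealIntegrals.
Context {R : realType} d (T : measurableType d) (P : probability T R).
Local Open Scope ereal_scope.
Implicit Types f g : T -> R.

Lemma le_integral_real f g : (forall w, 0 <= f w)%R -> (forall w, f w <= g w)%R ->
  \int[P]_w (f w)%:E <= \int[P]_w (g w)%:E.
Proof.
by move=> f0 fg; apply: le_integral_nonmeasurable => w; rewrite lee_fin.
Qed.

Lemma integral_realD f g : measurable_fun setT f -> measurable_fun setT g ->
  (forall w, 0 <= f w)%R -> (forall w, 0 <= g w)%R ->
  \int[P]_w (f w + g w)%:E = \int[P]_w (f w)%:E + \int[P]_w (g w)%:E.
Proof.
move=> mf mg f0 g0; under eq_integral do rewrite EFinD.
by rewrite ge0_integralD//; try (move=> w _; rewrite lee_fin//); exact/measurable_EFinP.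
Qed.

Lemma integral_realZ (c : R) f : measurable_fun setT f ->
  (forall w, 0 <= f w)%R -> (0 <= c)%R ->
  \int[P]_w (c * f w)%:E = c%:E * \int[P]_w (f w)%:E.
Proof.
move=> mf f0 c0; under eq_integral do rewrite EFinM.
by rewrite ge0_integralZl_EFin//; [move=> w _; rewrite lee_fin|exact/measurable_EFinP].
Qed.

Lemma integral_real_sum (I : Type) (s : seq I) (F : I -> T -> R) :
  (forall i, measurable_fun setT (F i)) -> (forall i w, 0 <= F i w)%R ->
  \int[P]_w (\sum_(i <- s) F i w)%:E = \sum_(i <- s) \int[P]_w (F i w)%:E.
Proof.
move=> mF F0; under eq_integral do rewrite -sumEFin.
rewrite ge0_integral_sum//.
- by move=> i; exact/measurable_EFinP.
- by move=> i w _; rewrite lee_fin.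
Qed.

Lemma integral_real_indic (A : set T) : measurable A ->
  \int[P]_w (\1_A w)%:E = P A.
Proof. by move=> mA; rewrite integral_indic// setIT. Qed.

Lemma integral_real_cst (c : R) : \int[P]_w c%:E = c%:E.
Proof.
rewrite (integral_cst P measurableT) [X in _ * X](_ : _ = 1) ?mule1//.
exact: probability_setT.
Qed.

End RealIntegrals.

Section PowerBounds.
Context {R : realType}.
Implicit Types x r s : R.

Lemma powR_gt1 x r : 1 < x -> 0 < r -> 1 < x `^ r.
Proof.
move=> x1 r0; have := @gt0_ltr_powR R r r0 1 x.
by rewrite !nnegrE powR1; apply => //; rewrite ltW// (lt_trans ltr01).
Qed.

Lemma powR_lt1 x r : 1 < x -> 0 < r -> x `^ (- r) < 1.
Proof.
move=> x1 r0; have xr := powR_gt1 x1 r0.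
by rewrite powRN invf_lt1// (lt_trans ltr01).
Qed.

Lemma ltr_powR x r s : 1 < x -> r < s -> x `^ r < x `^ s.
Proof.
move=> x1 rs; have x0 : 0 < x by exact: lt_trans x1.
rewrite -(subrKC r s) powRD; last by rewrite (gt_eqF x0) implybT.
by rewrite ltr_pMr ?powR_gt0// powR_gt1// subr_gt0.
Qed.

Lemma powR_le1 x r : 0 <= x -> x <= 1 -> 0 <= r -> x `^ r <= 1.
Proof.
move=> x0 x1 r0; have := @ge0_ler_powR R r r0 x 1.
by rewrite !nnegrE powR1; apply.
Qed.

Lemma powRVl x r : 0 <= x -> x^-1 `^ r = x `^ (- r).
Proof. by move=> x0; rewrite -powR_inv1// -powRrM mulN1r. Qed.

Lemma cvg_powRN (u : nat -> R) s : 0 < s -> u n @[n --> \oo] --> +oo ->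
  u n `^ (- s) @[n --> \oo] --> (0 : R).
Proof.
move=> s0 /cvgryPgt uy; apply/cvgr0Pnorm_lt => e e0; near=> n.
have un : e^-1 `^ s^-1 < u n by near: n; exact: uy.
have un0 : 0 < u n by rewrite (le_lt_trans _ un)// powR_ge0.
rewrite ger0_norm ?powR_ge0// powRN -[ltRHS]invrK ltf_pV2 ?posrE ?invr_gt0 ?powR_gt0//.
have -> : e^-1 = (e^-1 `^ s^-1) `^ s.
  by rewrite -powRrM mulVf ?gt_eqF// powRr1// invr_ge0 ltW.
by rewrite gt0_ltr_powR// nnegrE ?powR_ge0// ltW.
Unshelve. all: by end_near. Qed.
End PowerBounds.

(** * Regularly varying tails *)

Section Tail.
Context {R : realType} d (T : measurableType d) (P : probability T R)
  (Z : T -> R) (mZ : measurable_fun setT Z).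

Definition tail (x : R) : R := fine (P [set w | x < `|Z w|]).

Lemma measurable_tail (x : R) : measurable [set w | x < `|Z w|].
Proof.
rewrite (_ : [set w | _] = (fun w => `|Z w|) @^-1` `]x, +oo[%classic); last first.
  by apply/seteqP; split => w /=; rewrite in_itv/= andbT.
by rewrite -[X in measurable X]setTI; apply: measurableT_comp.
Qed.

Lemma tailE x : (tail x)%:E = P [set w | x < `|Z w|].
Proof. by rewrite /tail fineK// fin_num_measure//; exact: measurable_tail. Qed.

Lemma tail_ge0 x : 0 <= tail x.
Proof. exact: fine_ge0. Qed.

Lemma tail_nonincreasing x y : x <= y -> tail y <= tail x.
Proof.
move=> xy; rewrite -lee_fin !tailE; apply: le_measure; rewrite ?inE; try exact: measurable_tail.
by move=> w /=; exact: le_lt_trans.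
Qed.

Lemma tail_neg x : x < 0 -> tail x = 1.
Proof.
move=> x0; apply/eqP; rewrite -eqe tailE (_ : [set w | _] = setT) ?probability_setT//.
by apply/seteqP; split => // w _ /=; exact: lt_le_trans x0 _.
Qed.

Section RegularVariation.
Context (alpha : R) (a : nat -> R) (alpha0 : 0 < alpha).
Hypothesis tail_a : forall x : R, 0 < x ->
  n%:R * tail (a n * x) @[n --> \oo] --> x `^ (- alpha).

Lemma norming_tail_cvg1 : n%:R * tail (a n) @[n --> \oo] --> (1 : R).
Proof.
have := @tail_a 1 ltr01; rewrite powR1.
by under eq_fun do rewrite mulr1.
Qed.

(** If a n = 0 then n * tail 0 approximates both 1 and 2^-alpha, and if a n < 0
    then the tail is 1 and n < 2; neither persists for large n. *)
Lemma norming_gt0 : \forall n \near \oo, 0 < a n.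
Proof.
have c1 : 2 `^ (- alpha) < 1 :> R by rewrite powR_lt1// ltr1n.
have lt2 : \forall n \near \oo, n%:R * tail (a n) < 2.
  by apply: (cvgr_lt 1 norming_tail_cvg1); rewrite ltr1n.
have gtc : \forall n \near \oo, (1 + 2 `^ (- alpha)) / 2 < n%:R * tail (a n).
  by apply: (cvgr_gt 1 norming_tail_cvg1); lra.
have ltc : \forall n \near \oo, n%:R * tail (a n * 2) < (1 + 2 `^ (- alpha)) / 2.
  by apply: (cvgr_lt _ (tail_a _)) => //; lra.
near=> n; rewrite ltNge le_eqVlt; apply/negP => /predU1P[an0|an0].
  have : (1 + 2 `^ (- alpha)) / 2 < n%:R * tail (a n) by near: n.
  have : n%:R * tail (a n * 2) < (1 + 2 `^ (- alpha)) / 2 by near: n.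
  by rewrite an0 mul0r => /lt_trans/[apply]; rewrite ltxx.
have : n%:R * tail (a n) < 2 by near: n.
rewrite tail_neg// mulr1 ltNge => /negP; apply.
by rewrite ler_nat; near: n; exact: nbhs_infty_ge.
Unshelve. all: by end_near. Qed.

(** A variable with bounded absolute value has no norming sequence: the limits
    require n * tail (a n) to stay near 1. *)
Lemma tail_gt0 x : 0 < tail x.
Proof.
rewrite lt_neqAle tail_ge0 andbT; apply/negP => /eqP tx0.
(* the limits force a n < y for large n, so n * tail y <= n * tail (a n) < 2 *)
have small y : 0 < y -> tail y = 0.
  move=> y0; apply/eqP; rewrite eq_le tail_ge0 andbT leNgt; apply/negP => ty.
  have x0 : 0 < x.
    rewrite ltNge; apply/negP => x0.
    have := tail_nonincreasing (le_trans x0 (ltW y0)).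
    by rewrite -tx0 leNgt ty.
  pose b := x / y; have b0 : 0 < b by rewrite divr_gt0.
  have pos : \forall n \near \oo, 0 < n%:R * tail (a n * b).
    by apply: (cvgr_gt _ (tail_a b0)); rewrite powR_gt0.
  have lt2 : \forall n \near \oo, n%:R * tail (a n) < 2.
    by apply: (cvgr_lt 1 norming_tail_cvg1); rewrite ltr1n.
  near \oo => n.
  have any : a n < y.
    have : 0 < n%:R * tail (a n * b) by near: n.
    rewrite ltNge [a n < y]ltNge; apply: contraNN => yan; rewrite pmulr_rle0.
      rewrite (le_trans (tail_nonincreasing (_ : x <= _)))// -?tx0//.
      by rewrite /b mulrCA ler_peMr ?(ltW x0)// ler_pdivlMr// mul1r.
    by rewrite ltr0n; near: n; exact: nbhs_infty_gt.
  have : n%:R * tail (a n) < 2 by near: n.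
  rewrite ltNge => /negP; apply.
  rewrite (@le_trans _ _ (n%:R * tail y))// ?ler_wpM2l// ?tail_nonincreasing 1?ltW//.
  by rewrite -ltr_pdivrMr//; near: n; exact: nbhs_infty_gtr.
near \oo => n.
have : 2^-1 < n%:R * tail (a n).
  by near: n; apply: (cvgr_gt 1 norming_tail_cvg1); rewrite invf_lt1 ?ltr1n.
rewrite small ?mulr0 ?invr_lt0 ?ltrn0//.
by near: n; exact: norming_gt0.
Unshelve. all: by end_near. Qed.

Lemma norming_cvgy : a n @[n --> \oo] --> +oo.
Proof.
apply/cvgryPgt => A; near=> n; rewrite ltNge; apply/negP => anA.
have : n%:R * tail (a n) < 2.
  by near: n; apply: (cvgr_lt 1 norming_tail_cvg1); rewrite ltr1n.
rewrite ltNge => /negP; apply.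
rewrite (@le_trans _ _ (n%:R * tail A))//; last first.
  by rewrite ler_wpM2l// tail_nonincreasing.
rewrite -ler_pdivrMr ?tail_gt0//.
by near: n; exact: nbhs_infty_ger.
Unshelve. all: by end_near. Qed.

Lemma norming_ge A : \forall n \near \oo, A <= a n.
Proof. by have /cvgryPge := norming_cvgy; exact. Qed.

Lemma tail_small e : 0 < e -> exists2 x0 : R, 0 < x0 & forall x, x0 <= x -> tail x <= e.
Proof.
move=> e0; near \oo => n; exists (a n); first by near: n; exact: norming_gt0.
move=> x /tail_nonincreasing /le_trans; apply.
have n0 : 0 < n%:R :> R by rewrite ltr0n; near: n; exact: nbhs_infty_gt.
rewrite -(ler_pM2l n0) (@le_trans _ _ 2)//.
  by apply: ltW; near: n; apply: (cvgr_lt 1 norming_tail_cvg1); rewrite ltr1n.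
by rewrite -ler_pdivrMr//; near: n; exact: nbhs_infty_ger.
Unshelve. all: by end_near. Qed.

(** A Potter bound.  For x large let n be the integer part of 1 / tail x.  Then
    n * tail x is nearly 1, which forces x < s a_n for a fixed s slightly above
    1, and therefore n * tail (2 x) exceeds n * tail (2 s a_n), which is about
    (2 s)^-alpha. *)
Lemma tail_doubling alpha' : alpha < alpha' ->
  exists2 x0 : R, 0 < x0 & forall x, x0 <= x -> tail x <= 2 `^ alpha' * tail (2 * x).
Proof.
move=> aa'.
(* s^alpha = 2^((alpha' - alpha) / 2), so that (2 s)^-alpha > 2^-alpha' *)
pose s : R := 2 `^ ((alpha' - alpha) / (2 * alpha)).
have s1 : 1 < s by rewrite powR_gt1 ?ltr1n// divr_gt0 ?subr_gt0// mulr_gt0.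
have s0 : 0 < s by exact: lt_trans s1.
have sa1 : s `^ (- alpha) < 1 by exact: powR_lt1.
have sa2 : 2 `^ (- alpha') < (s * 2) `^ (- alpha).
  rewrite powRM ?ltW// -powRrM -powRD; last by rewrite pnatr_eq0 implybT.
  apply: ltr_powR; rewrite ?ltr1n//.
  have -> : (alpha' - alpha) / (2 * alpha) * - alpha = - (alpha' - alpha) / 2.
    by field; rewrite gt_eqF.
  lra.
pose c := (s `^ (- alpha) + 1) / 2.
have c1 : c < 1 by rewrite /c; lra.
have [N1 _ HN1] : \forall n \near \oo, 0 < a n by exact: norming_gt0.
have [N2 _ HN2] : \forall n \near \oo, n%:R * tail (a n * s) < c.
  by apply: (cvgr_lt _ (tail_a s0)); rewrite /c; lra.
have [N3 _ HN3] : \forall n \near \oo, 2 `^ (- alpha') < n%:R * tail (a n * (s * 2)).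
  by apply: (cvgr_gt _ (tail_a _)) => //; rewrite mulr_gt0.
pose N := (N1 + N2 + N3).+1.
have NN1 : (N1 <= N)%N by rewrite /N leqW// -addnA leq_addr.
have NN2 : (N2 <= N)%N by rewrite /N leqW// addnAC leq_addl.
have NN3 : (N3 <= N)%N by rewrite /N leqW// leq_addl.
have [x1 x10 Hx1] := @tail_small (1 - c) ltac:(lra).
have [x2 x20 Hx2] := @tail_small (N%:R^-1) ltac:(by rewrite invr_gt0 ltr0n).
exists (Num.max x1 x2) => [|x]; first by rewrite lt_max x10.
rewrite ge_max => /andP[/Hx1 xc /Hx2 xN].
have t0 := tail_gt0 x.
pose n := Num.truncn (tail x)^-1.
have nle : n%:R * tail x <= 1.
  by rewrite -ler_pdivlMr// mul1r truncn_le// invr_ge0 ltW.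
have nlt : 1 < n.+1%:R * tail x by rewrite -ltr_pdivrMr// mul1r truncnS_gt.
have nN : (N <= n)%N.
  rewrite -ltnS -(ltr_nat R) (le_lt_trans _ (truncnS_gt _))//.
  by rewrite -[leLHS]invrK lef_pV2// posrE// invr_gt0 ltr0n.
have cn : c < n%:R * tail x by move: nlt; rewrite -natr1 mulrDl mul1r; lra.
have xa : x < a n * s.
  rewrite ltNge; apply/negP => /tail_nonincreasing ax.
  have : n%:R * tail (a n * s) < c by apply: HN2; exact: leq_trans nN.
  rewrite ltNge => /negP; apply; rewrite (le_trans (ltW cn))// ler_wpM2l//.
have n0 : 0 < n%:R :> R by rewrite ltr0n (leq_trans _ nN).
have low : 2 `^ (- alpha') < n%:R * tail (2 * x).
  have /lt_le_trans : 2 `^ (- alpha') < n%:R * tail (a n * (s * 2)).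
    by apply: HN3; exact: leq_trans nN.
  apply; rewrite ler_wpM2l// tail_nonincreasing// mulrA mulrC ler_pM2r// ltW//.
rewrite -(ler_pM2l n0) (le_trans nle)// mulrCA -ler_pdivrMl ?powR_gt0//.
by rewrite mulr1 -powRN ltW.
Qed.

End RegularVariation.
End Tail.

(** * Truncated moments of a regularly varying variable *)

Section TruncatedMoments.
Context {R : realType}.

Definition trunc_pow (k x z : R) : R := Num.min (`|z| / x) 1 `^ k.

Lemma trunc_pow_ge0 k x z : 0 <= trunc_pow k x z.
Proof. exact: powR_ge0. Qed.

Lemma trunc_pow_le1 k x z : 0 <= k -> 0 < x -> trunc_pow k x z <= 1.
Proof.
move=> k0 x0; apply: powR_le1 => //; last by rewrite ge_min lexx orbT.
by rewrite le_min ler01 andbT divr_ge0// ltW.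
Qed.

Lemma measurable_trunc_pow k x : measurable_fun setT (trunc_pow k x).
Proof.
apply: (measurableT_comp (measurable_powR _)).
apply: measurable_minr => //; apply: measurable_funM => //.
Qed.

Context d (T : measurableType d) (P : probability T R)
  (Z : T -> R) (mZ : measurable_fun setT Z).
Local Notation tail := (tail P Z).

Definition trunc_moment k x : \bar R := (\int[P]_w (trunc_pow k x (Z w))%:E)%E.

Lemma trunc_moment_ge0 k x : (0 <= trunc_moment k x)%E.
Proof. by apply: integral_ge0 => w _; rewrite lee_fin trunc_pow_ge0. Qed.

Lemma measurable_trunc_powZ k x : measurable_fun setT (fun w => trunc_pow k x (Z w)).
Proof. by apply: measurableT_comp => //; exact: measurable_trunc_pow. Qed.

Lemma measurable_tail_indic x : measurable_fun setT (\1_[set w | x < `|Z w|] : T -> R).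
Proof. by apply: measurable_indic; exact: measurable_tail. Qed.

Lemma trunc_moment_le1 k x : 0 <= k -> 0 < x -> (trunc_moment k x <= 1)%E.
Proof.
move=> k0 x0; rewrite -(integral_real_cst P 1).
by apply: le_integral_real => w; rewrite ?trunc_pow_ge0 ?trunc_pow_le1.
Qed.

(** For |z| <= x the ratio |z| / (2 x) is half of |z| / x; for |z| > x the
    truncated power is at most 1. *)
Lemma trunc_moment_doubling k x : 0 <= k -> 0 < x ->
  (trunc_moment k (2 * x) <= (2 `^ (- k))%:E * trunc_moment k x + (tail x)%:E)%E.
Proof.
move=> k0 x0; rewrite /trunc_moment -integral_realZ ?powR_ge0//; last 2 first.
- exact: measurable_trunc_powZ.
- by move=> w; exact: trunc_pow_ge0.
rewrite tailE// -integral_real_indic; last exact: measurable_tail.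
rewrite -integral_realD; last 4 first.
- by apply: measurable_funM => //; exact: measurable_trunc_powZ.
- exact: measurable_tail_indic.
- by move=> w; rewrite mulr_ge0 ?powR_ge0.
- by [].
apply: le_integral_real => w; first exact: trunc_pow_ge0.
rewrite indicE; have [xZ|Zx] := boolP (w \in [set w | x < `|Z w|]).
  by rewrite ler_wpDl ?mulr_ge0 ?powR_ge0// trunc_pow_le1// mulr_gt0.
have {}Zx : `|Z w| <= x.
  by rewrite leNgt; apply: contra Zx => xZ; rewrite inE.
have Zx1 : `|Z w| / x <= 1 by rewrite ler_pdivrMr// mul1r.
have Zx0 : 0 <= `|Z w| / x by rewrite divr_ge0// ltW.
have Z2x : `|Z w| / (2 * x) = 2^-1 * (`|Z w| / x) by field; rewrite gt_eqF.
rewrite addr0 /trunc_pow Z2x !min_l//; last by lra.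
by rewrite powRM// powRVl.
Qed.

Section RegularVariation.
Context (alpha : R) (a : nat -> R) (alpha0 : 0 < alpha).
Hypothesis tail_a : forall x : R, 0 < x ->
  n%:R * tail (a n * x) @[n --> \oo] --> x `^ (- alpha).

(** Karamata's estimate, by induction over dyadic scales.  Doubling x multiplies
    the truncated moment by 2^-k up to a tail, while the tail itself shrinks at
    most by 2^-b with b < k, so the constant C is stable under the step. *)
Lemma trunc_moment_le_tail k : alpha < k ->
  exists C x0 : R, [/\ 0 < C, 0 < x0 &
    forall x, x0 <= x -> (trunc_moment k x <= (C * tail x)%:E)%E].
Proof.
move=> ak; have k0 : 0 < k := lt_trans alpha0 ak.
pose b := (alpha + k) / 2.
have ab : alpha < b by rewrite /b; lra.
have bk : b < k by rewrite /b; lra.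
have [x0 x00 Hx0] := tail_doubling mZ alpha0 tail_a ab.
pose r : R := 2 `^ (b - k).
have r1 : r < 1 by rewrite /r -opprB powR_lt1 ?ltr1n// subr_gt0.
(* the first value covers the scales below 2 x0, the second is the fixed
   point of the doubling recursion *)
pose C := Num.max (tail (2 * x0))^-1 (2 `^ b / (1 - r)).
have C0 : 0 < C by rewrite lt_max invr_gt0 (tail_gt0 mZ alpha0 tail_a).
have C1 : (tail (2 * x0))^-1 <= C by rewrite le_max lexx.
have C2 : 2 `^ b + r * C <= C.
  have : 2 `^ b / (1 - r) <= C by rewrite le_max lexx orbT.
  by rewrite ler_pdivrMr ?subr_gt0//; lra.
exists C, x0; split => // x x0x.
have xpos : 0 < x by exact: lt_le_trans x0x.
have [n xn] : exists n : nat, x <= 2 ^+ n.+1 * x0.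
  exists (Num.truncn (x / x0)); rewrite -ler_pdivrMr//.
  rewrite (le_trans (ltW (truncnS_gt _)))// -natrX ler_nat ltnW//.
  exact: ltn_expl.
elim: n x x0x xpos xn => [|n IH] x x0x xpos xn.
  rewrite (le_trans (trunc_moment_le1 (ltW k0) xpos))// lee_fin.
  rewrite -ler_pdivrMr ?(tail_gt0 mZ alpha0 tail_a)// mul1r (le_trans _ C1)//.
  rewrite lef_pV2 ?posrE ?(tail_gt0 mZ alpha0 tail_a)//.
  by rewrite tail_nonincreasing// -[2]expr1.
have [x2|x2] := leP x (2 ^+ n.+1 * x0); first exact: IH.
pose y := x / 2.
have xy : x = 2 * y by rewrite /y; field.
have x0y : x0 <= y.
  rewrite -(ler_pM2l (_ : 0 < 2))// -xy (le_trans _ (ltW x2))// ler_pM2r//.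
  by rewrite -{1}[2]expr1 ler_weXn2l// ler1n.
have ypos : 0 < y by exact: lt_le_trans x0y.
have yn : y <= 2 ^+ n.+1 * x0.
  by rewrite -(ler_pM2l (_ : 0 < 2))// -xy mulrA -exprS.
rewrite xy (le_trans (trunc_moment_doubling (ltW k0) ypos))//.
rewrite (@le_trans _ _ ((2 `^ (- k))%:E * (C * tail y)%:E + (tail y)%:E)%E)//.
  by rewrite leeD2r// lee_wpmul2l ?lee_fin ?powR_ge0//; exact: IH.
rewrite -EFinM -EFinD lee_fin.
rewrite (@le_trans _ _ ((2 `^ (- k) * C + 1) * (2 `^ b * tail (2 * y))))//.
  have -> : 2 `^ (- k) * (C * tail y) + tail y = (2 `^ (- k) * C + 1) * tail y by ring.
  rewrite ler_wpM2l ?Hx0//.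
  by rewrite addr_ge0// mulr_ge0 ?powR_ge0// ltW.
have rE : r = 2 `^ b * 2 `^ (- k) by rewrite -powRD// pnatr_eq0 implybT.
rewrite mulrA ler_wpM2r ?tail_ge0// (le_trans _ C2)// rE.
by rewrite le_eqVlt; apply/orP; left; apply/eqP; ring.
Qed.

Lemma trunc_moment_norming k : alpha < k ->
  exists2 C : R, 0 < C & \forall n \near \oo,
    (trunc_moment k (a n) <= (C / n%:R)%:E)%E.
Proof.
move=> /trunc_moment_le_tail[C [x0 [C0 x00 HC]]].
exists (2 * C) => [|]; first by rewrite mulr_gt0.
near=> n.
have n0 : 0 < n%:R :> R by rewrite ltr0n; near: n; exact: nbhs_infty_gt.
have ax0 : x0 <= a n.
  by near: n; exact: (norming_ge mZ alpha0 tail_a).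
rewrite (le_trans (HC _ ax0))// lee_fin ler_pdivlMr//.
have -> : C * tail (a n) * n%:R = n%:R * tail (a n) * C by ring.
rewrite ler_pM2r// ltW//; near: n.
by apply: (cvgr_lt 1 (norming_tail_cvg1 tail_a)); rewrite ltr1n.
Unshelve. all: by end_near. Qed.

(** Markov's inequality for an exponent b between alpha and k bounds a_n^-b by a
    multiple of 1/n, and a_n^(b - k) tends to zero. *)
Lemma norming_pow_cvg0 k : alpha < k -> n%:R * a n `^ (- k) @[n --> \oo] --> (0 : R).
Proof.
move=> ak; pose b := (alpha + k) / 2.
have ab : alpha < b by rewrite /b; lra.
have b0 : 0 < b by exact: lt_trans ab.
have bk : b < k by rewrite /b; lra.
have [C C0 HC] := trunc_moment_norming ab.
have t1 := tail_gt0 mZ alpha0 tail_a 1.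
have step : \forall n \near \oo, n%:R * a n `^ (- k) <= C / tail 1 * a n `^ (b - k).
  near=> n.
  have n0 : 0 < n%:R :> R by rewrite ltr0n; near: n; exact: nbhs_infty_gt.
  have a1 : 1 <= a n.
    by near: n; exact: (norming_ge mZ alpha0 tail_a).
  have a0 : 0 < a n by exact: lt_le_trans a1.
  have low : ((a n `^ (- b))%:E * (tail 1)%:E <= trunc_moment b (a n))%E.
    rewrite tailE// -integral_real_indic; last exact: measurable_tail.
    rewrite -integral_realZ ?powR_ge0//; last exact: measurable_tail_indic.
    apply: le_integral_real => w; first by rewrite mulr_ge0 ?powR_ge0.
    rewrite indicE; have [|_] := boolP (w \in _); last by rewrite mulr0 trunc_pow_ge0.
    rewrite inE /= => Z1; rewrite mulr1.
    rewrite -powRVl ?(ltW a0)// ge0_ler_powR ?nnegrE ?invr_ge0 ?(ltW b0) ?(ltW a0)//.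
      by rewrite le_min divr_ge0// ltW.
    rewrite le_min invf_le1// a1 andbT -[leLHS]mul1r.
    by rewrite ler_pM2r ?invr_gt0// ltW.
  have : (tail 1 * a n `^ (- b) <= C / n%:R).
    rewrite mulrC -lee_fin EFinM (le_trans low)//; near: n; exact: HC.
  rewrite ler_pdivlMr// => H.
  rewrite mulrAC ler_pdivlMr//.
  have -> : a n `^ (- k) = a n `^ (- b) * a n `^ (b - k).
    by rewrite -powRD ?(gt_eqF a0) ?implybT// addrA addNr add0r.
  apply: le_trans (ler_wpM2r (powR_ge0 (a n) (b - k)) H).
  by rewrite le_eqVlt; apply/orP; left; apply/eqP; ring.
have lim0 : C / tail 1 * a n `^ (b - k) @[n --> \oo] --> (0 : R).
  rewrite -[X in _ --> X](mulr0 (C / tail 1)); apply: cvgMr.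
  by rewrite -opprB; apply: cvg_powRN; rewrite ?subr_gt0//; exact: norming_cvgy tail_a.
apply: (squeeze_cvgr _ (cvg_cst 0) lim0).
near=> n; apply/andP; split; first by rewrite mulr_ge0// powR_ge0.
by near: n.
Unshelve. all: by end_near. Qed.

(** With y = min(|Z| / a_n, 1)^(k/2), the moment of y^2 is O(1/n) but y is mostly
    tiny.  On |Z| > L, the inequality y <= th y^2 / 2 + 1 / (2 th) with
    th = (n tail L)^(1/2) yields a constant times (tail L / n)^(1/2), small for L
    large; on |Z| <= L, y is at most (L / a_n)^(k/2) = o(n^(-1/2)). *)
Lemma trunc_moment_half k : alpha < k -> forall e : R, 0 < e ->
  \forall n \near \oo, (trunc_moment (k / 2) (a n) <= (e / Num.sqrt n%:R)%:E)%E.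
Proof.
move=> ak e e0; have k0 : 0 < k := lt_trans alpha0 ak.
have k20 : 0 < k / 2 by lra.
have [C C0 HC] := trunc_moment_norming ak.
(* tail L <= eta makes sqrt(tail L) (C + 1) <= e *)
pose eta := (e / (C + 1)) ^+ 2.
have eta0 : 0 < eta by rewrite exprn_gt0// divr_gt0// addr_gt0.
have [L L0 /(_ L (lexx L)) HL] := tail_small mZ alpha0 tail_a eta0.
pose t := tail L; have t0 : 0 < t := tail_gt0 mZ alpha0 tail_a L.
have st0 : 0 < Num.sqrt t by rewrite sqrtr_gt0.
have ste : Num.sqrt t * (C + 1) <= e.
  rewrite -ler_pdivlMr ?addr_gt0// -[leRHS]ger0_norm; last first.
    by rewrite divr_ge0 ?(ltW e0)// addr_ge0// ltW.
  by rewrite -sqrtr_sqr ler_sqrt// sqr_ge0.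
have H3 : \forall n \near \oo, n%:R * (L / a n) `^ k <= (e / 2) ^+ 2.
  have : n%:R * a n `^ (- k) * L `^ k @[n --> \oo] --> 0 * L `^ k.
    by apply: cvgMl; exact: norming_pow_cvg0.
  rewrite mul0r => /cvgr_lt/(_ ((e / 2) ^+ 2)); rewrite exprn_gt0 ?divr_gt0//.
  move=> /(_ isT) H; near=> n.
  have an : 0 < a n by near: n; exact: (norming_gt0 mZ alpha0 tail_a).
  rewrite powRM ?invr_ge0 ?(ltW L0) ?(ltW an)// powRVl ?(ltW an)//.
  by rewrite mulrCA mulrC ltW//; near: n.
near=> n.
have n0 : 0 < n%:R :> R by rewrite ltr0n; near: n; exact: nbhs_infty_gt.
have an : 0 < a n by near: n; exact: (norming_gt0 mZ alpha0 tail_a).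
pose sn : R := Num.sqrt n%:R; have sn0 : 0 < sn by rewrite sqrtr_gt0.
have snE : sn ^+ 2 = n%:R by rewrite sqr_sqrtr// ltW.
pose th := sn * Num.sqrt t; have th0 : 0 < th by rewrite mulr_gt0.
have La0 : 0 <= (L / a n) `^ (k / 2) by exact: powR_ge0.
have bnd : (L / a n) `^ (k / 2) <= e / 2 / sn.
  rewrite -(ler_pXn2r (n := 2)) ?nnegrE// ?divr_ge0 ?(ltW sn0)//; last lra.
  rewrite -powR_mulrn// -powRrM divfK// exprMn exprVn snE ler_pdivlMr//.
  by rewrite mulrC; near: n; exact: H3.
rewrite -/sn.
apply: (@le_trans _ _ ((th / 2)%:E * trunc_moment k (a n) +
    ((2 * th)^-1 * tail L)%:E + ((L / a n) `^ (k / 2))%:E)%E).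
  have th2 : 0 <= th / 2 by rewrite divr_ge0// ltW.
  have th2' : 0 <= (2 * th)^-1 by rewrite invr_ge0 mulr_ge0// ltW.
  have m1 := measurable_trunc_powZ k (a n).
  have m2 := measurable_tail_indic L.
  rewrite [((2 * th)^-1 * _)%:E]EFinM tailE// -integral_real_indic; last exact: measurable_tail.
  rewrite -(integral_real_cst P ((L / a n) `^ (k / 2))) /trunc_moment.
  rewrite -!integral_realZ//; last by move=> w; exact: trunc_pow_ge0.
  have m3 : measurable_fun setT (fun w => th / 2 * trunc_pow k (a n) (Z w)).
    exact: measurable_funM.
  have m4 : measurable_fun setT (fun w => (2 * th)^-1 * \1_[set w | L < `|Z w|] w : R).
    exact: measurable_funM.
  have p3 w : 0 <= th / 2 * trunc_pow k (a n) (Z w) by rewrite mulr_ge0 ?trunc_pow_ge0.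
  have p4 w : 0 <= (2 * th)^-1 * \1_[set w | L < `|Z w|] w :> R by rewrite mulr_ge0.
  rewrite -integral_realD// -integral_realD//; last 2 first.
  - exact: measurable_funD.
  - by move=> w; rewrite addr_ge0.
  apply: le_integral_real => w; first exact: trunc_pow_ge0.
  rewrite indicE; have [_|ZL] := boolP (w \in _); last first.
    have {}ZL : `|Z w| <= L by rewrite leNgt; apply: contra ZL => LZ; rewrite inE.
    rewrite mulr0 addr0 ler_wpDl// ge0_ler_powR ?nnegrE ?(ltW k20)//.
    + by rewrite le_min divr_ge0// ltW.
    + by rewrite divr_ge0// ltW.
    + by rewrite ge_min ler_pM2r ?invr_gt0// ZL.
  have y0 := trunc_pow_ge0 (k / 2) (a n) (Z w).
  have yE : trunc_pow k (a n) (Z w) = trunc_pow (k / 2) (a n) (Z w) ^+ 2.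
    by rewrite /trunc_pow -powR_mulrn ?powR_ge0// -powRrM divfK.
  rewrite yE mulr1; set y := trunc_pow (k / 2) _ _ in y0 *.
  rewrite ler_wpDr//.
  have : 0 <= (th * y - 1) ^+ 2 / (2 * th).
    by rewrite divr_ge0 ?sqr_ge0// mulr_ge0// ltW.
  have -> : (th * y - 1) ^+ 2 / (2 * th) = th / 2 * y ^+ 2 + (2 * th)^-1 - y.
    by field; rewrite gt_eqF.
  by rewrite subr_ge0.
apply: (@le_trans _ _ ((th / 2 * (C / n%:R))%:E + ((2 * th)^-1 * tail L)%:E +
    (e / 2 / sn)%:E)%E).
  apply: leeD; last by rewrite lee_fin.
  rewrite leeD2r// [X in (_ <= X)%E]EFinM lee_wpmul2l ?lee_fin ?divr_ge0 ?(ltW th0)//.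
  by near: n; exact: HC.
rewrite -!EFinD lee_fin -/t.
have -> : th / 2 * (C / n%:R) + (2 * th)^-1 * t =
    Num.sqrt t * (C + 1) / 2 / sn.
  rewrite -snE /th -[in LHS](sqr_sqrtr (ltW t0)) [Num.sqrt (_ ^+ 2)]sqrtr_sqr.
  rewrite (ger0_norm (ltW st0)).
  by field; rewrite !gt_eqF.
rewrite -mulrDl ler_pM2r ?invr_gt0//; lra.
Unshelve. all: by end_near. Qed.

End RegularVariation.
End TruncatedMoments.

(** * Products of a regularly varying variable with a lighter factor *)

Section Sections.
Context {R : realType} d d1 d2 (T : measurableType d) (P : probability T R)
  (U1 : measurableType d1) (U2 : measurableType d2) (V : T -> U2)
  (mV : measurable_fun setT V).

Lemma measurable_integral_section (F : U1 * U2 -> \bar R) :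
  measurable_fun setT F -> (forall z, 0 <= F z)%E ->
  measurable_fun setT (fun u => \int[P]_w F (u, V w))%E.
Proof.
move=> mF F0.
pose mVi := isMeasurableFun.Build _ _ _ _ V mV.
pose Vm : {mfun T >-> U2} := HB.pack V mVi.
apply: (eq_measurable_fun (fubini_F (distribution P Vm) F)) => [u _|].
  by rewrite /fubini_F ge0_integral_distribution//; exact: measurableT_comp.
exact: measurable_fun_fubini_tonelli_F.
Qed.
End Sections.

Section Breiman.
Context {R : realType} d (T : measurableType d) (P : probability T R)
  (S Z : T -> R) (mS : measurable_fun setT S) (mZ : measurable_fun setT Z).
Hypothesis S0 : forall w, 0 <= S w.
Hypothesis SZ : forall A B, measurable A -> measurable B ->
  (P (S @^-1` A `&` Z @^-1` B) = P (S @^-1` A) * P (Z @^-1` B))%E.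

Lemma min_mul_le (s r : R) : 0 <= s -> 0 <= r ->
  Num.min (s * r) 1 <= Num.max s 1 * Num.min r 1.
Proof.
move=> s0 r0; have [s1|s1] := leP s 1.
  rewrite mul1r le_min !ge_min lexx orbT andbT.
  by rewrite (le_trans _ (_ : s * r <= _)) ?ler_piMl ?orbT//.
have [r1|r1] := leP r 1; first by rewrite ge_min lexx.
by rewrite mulr1 ge_min (ltW s1) orbT.
Qed.

Lemma measurable_abs_gt (x : R) :
  measurable_fun setT (fun z : R * R => (\1_[set y : R | x < `|y|] (z.1 * z.2))%:E : \bar R).
Proof.
apply/measurable_EFinP; apply: measurableT_comp.
  apply: measurable_indic; rewrite (_ : [set y | _] = (@Num.norm R R) @^-1` `]x, +oo[%classic).
    by rewrite -[X in measurable X]setTI; apply: normr_measurable.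
  by apply/seteqP; split => y /=; rewrite in_itv/= andbT.
by apply: measurable_funM; [exact: measurable_fst|exact: measurable_snd].
Qed.

Lemma tail_scaleE (s x : R) :
  (\int[P]_w (\1_[set y : R | x < `|y|] (s * Z w))%:E = (tail P (fun w => s * Z w) x)%:E)%E.
Proof.
have ms : measurable_fun setT (fun w => s * Z w) by exact: measurable_funM.
by rewrite tailE// -integral_real_indic//; exact: measurable_tail.
Qed.

Lemma tail_mulE (x : R) :
  (tail P (fun w => S w * Z w) x)%:E =
  (\int[P]_w (tail P (fun w' => S w * Z w') x)%:E)%E.
Proof.
have mSZ : measurable_fun setT (fun w => S w * Z w) by exact: measurable_funM.
rewrite tailE// -integral_real_indic; last exact: measurable_tail.
have := independent_fubini mS mZ SZ (measurable_abs_gt x).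
rewrite /= => ->; last by move=> z; rewrite lee_fin.
by apply: eq_integral => w _; rewrite -tail_scaleE.
Qed.

Lemma measurable_tail_scale (x : R) :
  measurable_fun setT (fun w => tail P (fun w' => S w * Z w') x).
Proof.
apply/measurable_EFinP => /=.
have := @measurable_integral_section _ _ _ _ _ P _ _ Z mZ _ (measurable_abs_gt x).
move=> /(_ (fun z => _)) H.
apply: (eq_measurable_fun ((fun s => \int[P]_w (\1_[set y : R | (x < `|y|)%R] (s * Z w)%R)%:E)%E \o S)).
  by move=> w _ /=; rewrite tail_scaleE.
apply: (measurableT_comp _ mS); apply: H => z.
by rewrite lee_fin indicE.
Qed.

Context (alpha k : R) (N : nat -> nat) (b : nat -> R).
Hypotheses (alpha0 : 0 < alpha) (alphak : alpha < k).
Let k0 : 0 < k := lt_trans alpha0 alphak.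
Hypothesis b0 : \forall n \near \oo, 0 < b n.
Hypothesis tail_b : forall x : R, 0 < x ->
  (N n)%:R * tail P Z (b n * x) @[n --> \oo] --> x `^ (- alpha).
Hypothesis moment_b : exists2 C : R, 0 < C & \forall n \near \oo,
  (trunc_moment P Z k (b n) <= (C / (N n)%:R)%:E)%E.
Hypothesis moment_S : (\int[P]_w (Num.max (S w) 1 `^ k)%:E < +oo)%E.
Hypothesis N0 : \forall n \near \oo, (0 < N n)%N.

(** Markov's inequality for the truncated power, after separating s from Z;
    this is the dominating function in the proof of Breiman's lemma. *)
Lemma tail_scale_le (s x y : R) : 0 <= s -> 0 < x -> 0 < y ->
  ((tail P (fun w => s * Z w) (y * x))%:E <=
   ((Num.max x^-1 1 * Num.max s 1) `^ k)%:E * trunc_moment P Z k y)%E.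
Proof.
move=> s0 x0 y0; rewrite -integral_realZ ?powR_ge0//; last 2 first.
- exact: measurable_trunc_powZ.
- by move=> w; exact: trunc_pow_ge0.
rewrite -tail_scaleE; apply: le_integral_real => w; first by rewrite indicE.
rewrite indicE; have [|_] := boolP (_ \in _); last first.
  by rewrite mulr_ge0 ?powR_ge0.
rewrite inE /= => yx; rewrite /trunc_pow.
have z0 : 0 <= `|Z w| / y by rewrite divr_ge0// ltW.
have xV : 0 <= x^-1 by rewrite invr_ge0 ltW.
rewrite -powRM; last 2 first.
- by rewrite mulr_ge0// le_max ler01 orbT.
- by rewrite le_min z0 ler01.
have : 1 <= Num.max x^-1 1 * Num.max s 1 * Num.min (`|Z w| / y) 1.
  rewrite -mulrA (@le_trans _ _ (Num.max x^-1 1 * Num.min (s * (`|Z w| / y)) 1))//.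
    rewrite (le_trans _ (min_mul_le xV (mulr_ge0 s0 z0)))//.
    rewrite le_min lexx andbT normrM (ger0_norm s0) in yx *.
    have -> : x^-1 * (s * (`|Z w| / y)) = s * `|Z w| / (y * x) by field; rewrite !gt_eqF.
    by rewrite ler_pdivlMr ?mulr_gt0// mul1r ltW.
  by rewrite ler_wpM2l ?min_mul_le// le_max ler01 orbT.
move=> H; rewrite -[leLHS](powRr0 (Num.max x^-1 1 * Num.max s 1 * Num.min (`|Z w| / y) 1)).
by rewrite ler_powR// ltW.
Qed.

(** Breiman's lemma: conditionally on S = s, N P(|s Z| > b x) converges to
    (x / s)^-alpha, and the k-th moment of max(S, 1) dominates. *)
Lemma breiman x : 0 < x ->
  (N n)%:R * tail P (fun w => S w * Z w) (b n * x) @[n --> \oo] -->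
  fine (\int[P]_w (S w `^ alpha)%:E)%E * x `^ (- alpha).
Proof.
move=> x0.
pose g n w := (N n)%:R * tail P (fun w' => S w * Z w') (b n * x).
have gE n : ((N n)%:R * tail P (fun w => S w * Z w) (b n * x))%:E =
    (\int[P]_w (g n w)%:E)%E.
  rewrite EFinM tail_mulE /g -integral_realZ//; first exact: measurable_tail_scale.
  by move=> w; exact: tail_ge0.
pose l w := S w `^ alpha * x `^ (- alpha).
have gl w : g n w @[n --> \oo] --> l w.
  rewrite /l /g; have := S0 w; rewrite le_eqVlt => /predU1P[s0|s0].
    rewrite -s0 powR0 ?gt_eqF// mul0r; apply: cvg_near_cst.
    near=> n; have bn : 0 < b n by near: n.
    rewrite (_ : tail P _ _ = 0) ?mulr0//; apply/eqP; rewrite -eqe tailE; last first.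
      by apply: measurable_funM.
    rewrite (_ : [set w' | _] = set0) ?measure0//; apply/seteqP; split => // w' /=.
    by rewrite mul0r normr0 ltNge mulr_ge0// ltW.
  have -> : S w `^ alpha * x `^ (- alpha) = (x / S w) `^ (- alpha).
    by rewrite powRM ?invr_ge0 ?ltW// powRVl ?ltW// opprK mulrC.
  have := tail_b (divr_gt0 x0 s0); apply: cvg_trans.
  apply: near_eq_cvg; near=> n; congr (_ * fine (P _)).
  apply/seteqP; split => w' /=; rewrite normrM gtr0_norm// mulrA.
    by rewrite ltr_pdivrMr// [_ * S w]mulrC.
  by rewrite ltr_pdivrMr// [_ * S w]mulrC.
have [C C0 HC] := moment_b.
have [n0 _ Hn0] : \forall n \near \oo, [/\ 0 < b n, (0 < N n)%N &
    (trunc_moment P Z k (b n) <= (C / (N n)%:R)%:E)%E].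
  by near=> n; split; near: n.
pose D w := C * Num.max x^-1 1 `^ k * Num.max (S w) 1 `^ k.
have max0 y : 0 <= Num.max y 1 :> R by rewrite le_max ler01 orbT.
have mD : measurable_fun setT (fun w => Num.max (S w) 1 `^ k).
  by apply: (measurableT_comp (measurable_powR _)); exact: measurable_maxr.
have iD : P.-integrable setT (EFin \o D).
  apply/integrableP; split; first by apply/measurable_EFinP; apply: measurable_funM.
  under eq_integral => w _ do rewrite /= ger0_norm ?mulr_ge0 ?powR_ge0 ?(ltW C0)//.
  rewrite integral_realZ//; last 2 first.
  - by move=> w; exact: powR_ge0.
  - by rewrite mulr_ge0 ?powR_ge0// ltW.
  by rewrite lte_mul_pinfty// lee_fin mulr_ge0 ?powR_ge0// ltW.
have mg n : measurable_fun setT (EFin \o g n).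
  by apply/measurable_EFinP; apply: measurable_funM => //; exact: measurable_tail_scale.
have := @dominated_cvg _ _ _ P setT measurableT (fun n w => (g (n + n0)%N w)%:E)
  (fun w => (l w)%:E) (fun w => (D w)%:E) (fun n => mg (n + n0)%N) _ _ iD _.
have -> : (\int[P]_w (l w)%:E =
    (fine (\int[P]_w (S w `^ alpha)%:E)%E * x `^ (- alpha))%:E)%E.
  have mSa : measurable_fun setT (fun w => S w `^ alpha).
    exact: (measurableT_comp (measurable_powR _)).
  rewrite /l; under eq_integral do rewrite mulrC.
  rewrite integral_realZ ?powR_ge0//; last by move=> w; exact: powR_ge0.
  rewrite muleC EFinM fineK//.
  rewrite ge0_fin_numE; last by apply: integral_ge0 => w _; rewrite lee_fin powR_ge0.
  apply: le_lt_trans moment_S; apply: le_integral_real => w; first exact: powR_ge0.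
  apply: (@le_trans _ _ (Num.max (S w) 1 `^ alpha)).
    by rewrite ge0_ler_powR ?nnegrE ?(ltW alpha0)// le_max lexx.
  by rewrite ler_powR ?(ltW alphak)// le_max lexx orbT.
move=> H; rewrite -(cvg_shiftn n0).
have {}H : (((N (n + n0))%:R * tail P (fun w => S w * Z w) (b (n + n0)%N * x))%:E
    @[n --> \oo] --> (fine (\int[P]_w (S w `^ alpha)%:E)%E * x `^ (- alpha))%:E)%E.
  under eq_fun do rewrite gE; apply: H => [w _|w _|n w _].
  - apply: cvg_EFin; first exact: nearW.
    by have := gl w; rewrite -(cvg_shiftn n0).
  - by [].
  - rewrite lee_fin.
    have [bn Nn Cn] : [/\ 0 < b (n + n0)%N, (0 < N (n + n0))%N &
        (trunc_moment P Z k (b (n + n0)%N) <= (C / (N (n + n0))%:R)%:E)%E].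
      by apply: Hn0 => /=; rewrite leq_addl.
    rewrite ger0_norm ?mulr_ge0 ?tail_ge0// /g /D.
    have Nn' : 0 < (N (n + n0))%:R :> R by rewrite ltr0n.
    rewrite mulrC -ler_pdivlMr// -lee_fin.
    apply: (le_trans (tail_scale_le (S0 w) x0 bn)).
    apply: (le_trans (lee_wpmul2l _ Cn)); first by rewrite lee_fin powR_ge0.
    rewrite -EFinM lee_fin.
    by rewrite powRM// le_eqVlt; apply/orP; left; apply/eqP; ring.
exact: (fine_cvg H).
Unshelve. all: by end_near. Qed.

End Breiman.

(** * Expectations of test functions from tails *)

Section StepApproximation.
Context {R : realType} (phi : R -> R).
Hypothesis phi0 : forall x, 0 <= phi x.
Hypothesis phiP : compact_support_pos phi.

Let above (t : nat -> R) j (y : R) : R := (t j < y)%R%:R.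

(** The step function takes the value phi (t (j+1)) on the cell from t j to
    t (j+1), at distance at most eta from y, and 0 outside of the cells. *)
Lemma step_pointwise (t : nat -> R) (e eta : R) (k : nat) (y : R) :
  (forall j, t j.+1 = t j + eta) -> 0 <= eta ->
  (forall x z, `|x - z| <= eta -> `|phi x - phi z| <= e) ->
  (y <= t 0%N -> phi y = 0) ->
  (y <= t k -> `|phi y - \sum_(j < k) phi (t j.+1) * (above t j y - above t j.+1 y)| <=
     e * above t 0%N y) /\
  (t k < y -> \sum_(j < k) phi (t j.+1) * (above t j y - above t j.+1 y) = 0).
Proof.
move=> tS eta0 He y0.
have ab0 j : y <= t j -> above t j y = 0 by rewrite /above ltNge => ->.
have ab1 j : t j < y -> above t j y = 1 by rewrite /above => ->.
elim: k => [|k [IH1 IH2]].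
  split=> yt; rewrite big_ord0// y0// ab0// mulr0 subrr normr0//.
rewrite big_ord_recr/=; split=> yt; last first.
  have ky : t k < y by rewrite (le_lt_trans _ yt)// tS lerDl.
  by rewrite IH2// !ab1// subrr mulr0 addr0.
have [yk|ky] := leP y (t k).
  rewrite [above t k y]ab0// [above t k.+1 y]ab0// subrr mulr0 addr0; exact: IH1.
rewrite IH2// add0r [above t k y]ab1// [above t k.+1 y]ab0// subr0 mulr1.
have -> : above t 0%N y = 1.
  apply: ab1; apply: le_lt_trans ky; elim: k {IH1 IH2 yt} => // k IH.
  by rewrite (le_trans IH)// tS lerDl.
rewrite mulr1 He// distrC ler_norml; move: yt; rewrite tS; lra.
Qed.

(** Replaces the integral of phi (Y x) by a combination of finitely many tails
    V of Y, with an error proportional to V t0.  The level t0 is fixed before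
    the accuracy e, and the mesh t does not depend on the measure, so that one
    mesh serves the converging measures and their limit. *)
Lemma step_integral : exists2 t0 : R, 0 < t0 &
  forall e : R, 0 < e -> exists (t : nat -> R) (k : nat),
  [/\ t 0%N = t0, (forall j, 0 < t j) &
  forall d (T : measurableType d) (m : {measure set T -> \bar R}) (D : set T)
    (Y : T -> R), measurable D -> measurable_fun D Y ->
    (forall u : R, 0 < u -> (m (D `&` [set x | (u < Y x)%R]) < +oo)%E) ->
    let V (u : R) := fine (m (D `&` [set x | (u < Y x)%R])) in
    exists2 I : R, (\int[m]_(x in D) (phi (Y x))%:E = I%:E)%E &
      `|I - \sum_(j < k) phi (t j.+1) * (V (t j) - V (t j.+1))| <= e * V (t 0%N)].
Proof.
have [cphi [delta [M [d0 supp]]]] := phiP.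
exists (delta / 2); first exact: divr_gt0.
move=> e e0.
have [eta eta0 etaP] := compact_support_unif phiP e0.
pose t j : R := delta / 2 + j%:R * eta.
have t0 j : 0 < t j by rewrite ltr_pwDl ?divr_gt0// mulr_ge0// ltW.
have tS j : t j.+1 = t j + eta by rewrite /t -[j.+1%:R]natr1; ring.
pose k := (Num.truncn (`|M| / eta)).+1.
have kM : M < t k.
  apply: (@lt_trans _ _ (k%:R * eta)).
    rewrite (le_lt_trans (ler_norm _))// -ltr_pdivrMr//.
    exact: truncnS_gt.
  by rewrite ltrDr divr_gt0.
exists t, k; split => //; first by rewrite /t mul0r addr0.
move=> d T m D Y mD mY fV V.
pose c j x : R := (t j < Y x)%R%:R.
have cE j : c j = \1_[set x | t j < Y x].
  apply/funext => x; rewrite indicE /c; congr (nat_of_bool _)%:R.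
  by apply/idP/idP; rewrite inE.
have mabove (u : R) : measurable (D `&` [set x | (u < Y x)%R]).
  have := mY mD `]u, +oo[%classic (measurable_itv _).
  by rewrite (_ : Y @^-1` _ = [set x | (u < Y x)%R])//; apply/seteqP; split => x /=; rewrite in_itv/= andbT.
have mc j : measurable_fun D (c j).
  apply: (eq_measurable_fun (\1_(D `&` [set x | (t j < Y x)%R]) : T -> R)) => [x xD|].
    by rewrite indicE in_setI xD cE indicE.
  exact: measurable_indic.
have c0 j x : 0 <= c j x by exact: ler0n.
have intc j : (\int[m]_(x in D) (c j x)%:E = (V (t j))%:E)%E.
  rewrite /V fineK; last by rewrite ge0_fin_numE// fV.
  rewrite integral_mkcond (eq_integral (fun x => (\1_(D `&` [set x | t j < Y x]) x)%:E)).
    by rewrite integral_indic// setIT.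
  move=> x _; rewrite patchE indicE in_setI.
  by case: (x \in D) => //=; rewrite cE indicE.
have intS (i : nat) : (\int[m]_(x in D) (\sum_(j < k) phi (t j.+1) * c (j + i)%N x)%:E =
    (\sum_(j < k) phi (t j.+1) * V (t (j + i)%N))%:E)%E.
  under eq_integral do rewrite -sumEFin.
  rewrite ge0_integral_sum//.
  - rewrite -sumEFin; apply: eq_bigr => j _; under eq_integral do rewrite EFinM.
    rewrite ge0_integralZl_EFin//; first by rewrite intc.
    + by move=> x _; rewrite lee_fin.
    + exact/measurable_EFinP.
  - by move=> j; apply/measurable_EFinP; apply: measurable_funM.
  - by move=> j x _; rewrite lee_fin mulr_ge0.
have mS i : measurable_fun D (fun x => \sum_(j < k) phi (t j.+1) * c (j + i)%N x).
  by apply: measurable_sum => j; apply: measurable_funM.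
have S0 i x : 0 <= \sum_(j < k) phi (t j.+1) * c (j + i)%N x.
  by apply: sumr_ge0 => j _; rewrite mulr_ge0.
have mphi : measurable_fun D (fun x => phi (Y x)).
  by apply: measurableT_comp => //; exact: continuous_measurable_fun.
have pt x : `|phi (Y x) - \sum_(j < k) phi (t j.+1) * (c j x - c j.+1 x)| <= e * c 0%N x.
  have y0 : Y x <= t 0%N -> phi (Y x) = 0.
    rewrite /t mul0r addr0 => yd; apply/eqP; apply: contraTT yd => /supp/andP[dy _].
    by rewrite -ltNge (lt_le_trans _ dy)// ltr_pdivrMr// ltr_pMr// ltr1n.
  have [le gt] := step_pointwise k tS (ltW eta0) etaP y0.
  have [/le//|ky] := leP (Y x) (t k).
  rewrite -/(above t _ _) gt// subr0; suff -> : phi (Y x) = 0.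
    by rewrite normr0 mulr_ge0// ltW.
  apply/eqP; apply: contraTT ky => /supp/andP[_ yM].
  by rewrite -leNgt (le_trans yM)// ltW.
have sumE x : \sum_(j < k) phi (t j.+1) * (c j x - c j.+1 x) =
    \sum_(j < k) phi (t j.+1) * c (j + 0)%N x - \sum_(j < k) phi (t j.+1) * c (j + 1)%N x.
  by rewrite -sumrB; apply: eq_bigr => j _; rewrite addn0 addn1 mulrBr.
have mEec0 : measurable_fun D (fun x => (e * c 0%N x)%:E).
  by apply/measurable_EFinP; apply: measurable_funM.
have intec0 : (\int[m]_(x in D) (e * c 0%N x)%:E = (e * V (t 0%N))%:E)%E.
  under eq_integral do rewrite EFinM.
  rewrite ge0_integralZl_EFin ?(ltW e0)//; first by rewrite intc.
  - by move=> x _; rewrite lee_fin.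
  - exact/measurable_EFinP.
have int2 i (f : T -> R) : measurable_fun D f -> (forall x, 0 <= f x) ->
    (\int[m]_(x in D) (f x + \sum_(j < k) phi (t j.+1) * c (j + i)%N x)%:E =
     \int[m]_(x in D) (f x)%:E + (\sum_(j < k) phi (t j.+1) * V (t (j + i)%N))%:E)%E.
  move=> mf f0; rewrite -intS -ge0_integralD//.
  - by move=> x _; rewrite lee_fin.
  - exact/measurable_EFinP.
  - by move=> x _; rewrite lee_fin.
  - exact/measurable_EFinP.
have ec0 x : 0 <= e * c 0%N x by rewrite mulr_ge0// ltW.
have up : (\int[m]_(x in D) (phi (Y x))%:E + (\sum_(j < k) phi (t j.+1) * V (t (j + 1)%N))%:E <=
    (e * V (t 0%N))%:E + (\sum_(j < k) phi (t j.+1) * V (t (j + 0)%N))%:E)%E.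
  rewrite -int2// -intec0 -int2//; last exact/measurable_EFinP.
  apply: ge0_le_integral => //.
  - by move=> x _; rewrite lee_fin addr_ge0.
  - by apply/measurable_EFinP; apply: measurable_funD.
  - apply/measurable_EFinP; apply: measurable_funD => //; exact/measurable_EFinP.
  - move=> x _; rewrite lee_fin; have := pt x; rewrite sumE ler_norml => /andP[_]; lra.
have intphi0 : (0 <= \int[m]_(x in D) (phi (Y x))%:E)%E.
  by apply: integral_ge0 => x _; rewrite lee_fin.
have fin : (\int[m]_(x in D) (phi (Y x))%:E)%E \is a fin_num.
  rewrite ge0_fin_numE//; apply: le_lt_trans (ltry _); apply: le_trans up.
  rewrite leeDl// lee_fin sumr_ge0// => j _; rewrite mulr_ge0//.
  by rewrite -lee_fin -intc integral_ge0// => x _; rewrite lee_fin.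
have low : ((\sum_(j < k) phi (t j.+1) * V (t (j + 0)%N))%:E <=
    \int[m]_(x in D) (phi (Y x))%:E + (e * V (t 0%N))%:E +
    (\sum_(j < k) phi (t j.+1) * V (t (j + 1)%N))%:E)%E.
  rewrite -intS -intec0 -ge0_integralD//; last 3 first.
  - by move=> x _; rewrite lee_fin.
  - exact/measurable_EFinP.
  - by move=> x _; rewrite lee_fin.
  have mpe : measurable_fun D (fun x => phi (Y x) + e * c 0%N x).
    by apply: measurable_funD => //; exact/measurable_EFinP.
  rewrite -(int2 _ (fun x => phi (Y x) + e * c 0%N x))//; last by move=> x; rewrite addr_ge0.
  apply: ge0_le_integral => //.
  - by move=> x _; rewrite lee_fin.
  - exact/measurable_EFinP.
  - by apply/measurable_EFinP; apply: measurable_funD.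
  - move=> x _; rewrite lee_fin; have := pt x; rewrite sumE ler_norml => /andP[+ _]; lra.
exists (fine (\int[m]_(x in D) (phi (Y x))%:E)%E); first by rewrite fineK.
rewrite -(fineK fin) in up low.
rewrite -!EFinD !lee_fin in up low.
have -> : \sum_(j < k) phi (t j.+1) * (V (t j) - V (t j.+1)) =
    \sum_(j < k) phi (t j.+1) * V (t (j + 0)%N) - \sum_(j < k) phi (t j.+1) * V (t (j + 1)%N).
  by rewrite -sumrB; apply: eq_bigr => j _; rewrite addn0 addn1 mulrBr.
rewrite ler_norml; apply/andP; split; lra.
Qed.

End StepApproximation.

Section PowerTailLimit.
Context {R : realType} d (T : measurableType d) (P : probability T R).
Context (A g : R) (A0 : 0 <= A) (g0 : 0 < g).
Local Notation mu := (@lebesgue_measure R).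

Lemma measurable_power_points : measurable_fun (`]0, +oo[ : set R) (fun x => A `^ g * x `^ (- g)).
Proof.
by apply: measurable_funTS; apply: measurable_funM => //; apply: measurable_powR.
Qed.

(** The image of Lebesgue measure on the half-line under
    x |-> A^g x^-g has the power tail A u^(-1/g). *)
Lemma power_points_tail u : 0 < u ->
  mu (`]0, +oo[%classic `&` [set x : R | u < A `^ g * x `^ (- g)]) =
  (A * u `^ (- g^-1))%:E.
Proof.
move=> u0; have [A00|] := eqVneq A 0.
  rewrite A00 mul0r powR0 ?gt_eqF//.
  rewrite (_ : _ `&` _ = set0) ?measure0//.
  by apply/seteqP; split => // x [_]/=; rewrite mul0r ltNge ltW.
rewrite neq_lt ltNge A0/= => Agt.
have r0 : 0 < A * u `^ (- g^-1) by rewrite mulr_gt0// powR_gt0.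
rewrite (_ : _ `&` _ = `]0, (A * u `^ (- g^-1))[%classic).
  rewrite lebesgue_measure_itv/= lte_fin r0 EFinN sube0//.
have rg : (A * u `^ (- g^-1)) `^ g = A `^ g / u.
  rewrite powRM ?powR_ge0// -powRrM mulNr mulVf ?gt_eqF// powRN powRr1//.
  exact: ltW.
apply/seteqP; split => x /=; rewrite !in_itv/= ?andbT.
  move=> [x0]; rewrite powRN ltr_pdivlMr ?powR_gt0// mulrC -ltr_pdivlMr// -rg => H.
  rewrite x0/= ltNge; apply/negP => /(@ge0_ler_powR _ _ (ltW g0)).
  by rewrite !nnegrE (ltW r0) (ltW x0) leNgt H => /(_ isT isT).
move=> /andP[x0 xr]; split => //.
rewrite powRN ltr_pdivlMr ?powR_gt0// mulrC -ltr_pdivlMr// -rg.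
by rewrite gt0_ltr_powR// nnegrE ltW.
Qed.

Lemma power_points_tail_fin u : 0 < u ->
  (mu (`]0%R, +oo[%classic `&` [set x : R | (u < A `^ g * x `^ (- g))%R]) < +oo)%E.
Proof. by move=> u0; rewrite power_points_tail// ltry. Qed.

Context (phi : R -> R).
Hypothesis phi0 : forall x, 0 <= phi x.
Hypothesis phiP : compact_support_pos phi.

(** Convergence of the tails gives convergence of the step approximations, with
    an error that is uniform in n because N P(Y > t0) is bounded. *)
Lemma power_tail_integral_cvg (N : nat -> nat) (Y : nat -> T -> R) :
  (forall n, measurable_fun setT (Y n)) ->
  (forall u : R, 0 < u -> (N n)%:R * fine (P [set w | u < Y n w]) @[n --> \oo] -->
     A * u `^ (- g^-1)) ->
  (N n)%:R * fine (\int[P]_w (phi (Y n w))%:E)%E @[n --> \oo] -->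
  fine (\int[mu]_(x in `]0%R, +oo[) (phi (A `^ g * x `^ (- g)))%:E)%E.
Proof.
move=> mY tailY.
have [t0 t00 step] := step_integral phi0 phiP.
apply/cvgrPdist_le => e e0.
pose V (u : R) := A * u `^ (- g^-1).
have V0 : 0 <= V t0 by rewrite mulr_ge0// powR_ge0.
pose e' := e / (2 * V t0 + 2).
have V20 : 0 < 2 * V t0 + 2 by rewrite ltr_wpDl// mulr_ge0.
have e'0 : 0 < e' by rewrite divr_gt0.
have [t [k [tt0 tpos H]]] := step e' e'0.
pose W n (u : R) := (N n)%:R * fine (P [set w | u < Y n w]).
pose St (V : R -> R) := \sum_(j < k) phi (t j.+1) * (V (t j) - V (t j.+1)).
have [I IE HI] : exists2 I : R,
    (\int[mu]_(x in `]0%R, +oo[) (phi (A `^ g * x `^ (- g)))%:E)%E = I%:E &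
    `|I - St V| <= e' * V t0.
  have [] := H _ _ mu `]0, +oo[%classic _ (measurable_itv _) measurable_power_points _.
    exact: power_points_tail_fin.
  move=> I IE HI; exists I => //; rewrite -tt0.
  have VE (u : R) : 0 < u -> V u = fine (mu (`]0%R, +oo[%classic `&`
      [set x : R | (u < A `^ g * x `^ (- g))%R])).
    by move=> u0; rewrite power_points_tail.
  rewrite VE// /St; under eq_bigr do rewrite !VE//.
  exact: HI.
have Hn n : `|(N n)%:R * fine (\int[P]_w (phi (Y n w))%:E)%E - St (W n)| <= e' * W n t0.
  pose r : {nonneg R} := NngNum (ler0n R (N n)).
  have mabove (u : R) : measurable [set w | u < Y n w].
    have := mY n measurableT `]u, +oo[%classic (measurable_itv _).
    by rewrite setTI (_ : Y n @^-1` _ = [set x | (u < Y n x)%R])//;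
      apply/seteqP; split => x /=; rewrite in_itv/= andbT.
  have [] := H _ _ (mscale r P) setT (Y n) measurableT (mY n).
    move=> u u0; rewrite setTI /mscale/= lte_mul_pinfty ?lee_fin//.
    by rewrite ltey_eq fin_num_measure.
  have WE u : fine (mscale r P ([set: T] `&` [set x | u < Y n x])) = W n u.
    by rewrite setTI /mscale/= fineM ?fin_num_measure.
  move=> J JE; rewrite WE tt0.
  rewrite (eq_bigr (fun j : 'I_k => phi (t j.+1) * (W n (t j) - W n (t j.+1)))); last first.
    by move=> j _; rewrite !WE.
  suff -> : (N n)%:R * fine (\int[P]_w (phi (Y n w))%:E)%E = J by [].
  have mphi : measurable_fun setT (fun w => (phi (Y n w))%:E).
    apply/measurable_EFinP; apply: measurableT_comp => //.
    by apply: continuous_measurable_fun; case: phiP.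
  move: JE; rewrite ge0_integral_mscale//; last by move=> w _; rewrite lee_fin.
  move=> /(congr1 fine) /= <-.
  have fphi : (\int[P]_w (phi (Y n w))%:E)%E \is a fin_num.
    have [B B0 HB] := compact_support_bounded phiP.
    rewrite ge0_fin_numE; last by apply: integral_ge0 => w _; rewrite lee_fin.
    apply: (@le_lt_trans _ _ (\int[P]_w B%:E)%E); last by rewrite integral_real_cst ltry.
    by apply: le_integral_real => // w; rewrite (le_trans (ler_norm _)).
  by rewrite fineM.
have StW : St (W n) @[n --> \oo] --> St V.
  apply: (cvg_big (op := +%R) (x0 := 0)); [exact: add_continuous|].
  by move=> j _; apply: cvgMr; apply: cvgB; exact: tailY.
rewrite IE/=; near=> n.
rewrite (le_trans (ler_distD (St V) _ _))//.
have -> : e = e' * V t0 + (e' + e' * (V t0 + 1)) by rewrite /e'; field; rewrite gt_eqF.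
apply: lerD => //; rewrite (le_trans (ler_distD (St (W n)) _ _))//; apply: lerD.
  near: n; move/cvgrPdist_le : StW; exact.
rewrite distrC (le_trans (Hn n))// ler_pM2l//.
near: n; have := tailY _ t00 => /cvgr_le; apply; rewrite -/(V t0); lra.
Unshelve. all: by end_near. Qed.

End PowerTailLimit.

(** * The Laplace exponent of a unit rate Poisson process *)

Section Density.
Context d (T : measurableType d) (R : realType).
Local Open Scope ereal_scope.

Import HBNNSimple.

(** First for indicators, by definition of the density, then for simple
    functions by linearity and in general by monotone convergence. *)
Lemma integral_density (mu nu : {measure set T -> \bar R}) (p : T -> R) (F : T -> R) :
  measurable_fun setT p -> (forall x, 0 <= p x)%R ->
  (forall B, measurable B -> nu B = \int[mu]_(x in B) (p x)%:E) ->
  measurable_fun setT F -> (forall x, 0 <= F x)%R ->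
  \int[nu]_x (F x)%:E = \int[mu]_x (F x * p x)%:E.
Proof.
move=> mp p0 nuE mF F0.
have mEF : measurable_fun setT (EFin \o F) by exact/measurable_EFinP.
pose f n := nnsfun_approx measurableT mEF n.
have f0 n x : (0 <= f n x)%R by [].
have mf n : measurable_fun setT (f n) by [].
have fF x : (f n x)%:E @[n --> \oo] --> (F x)%:E.
  by apply: cvg_nnsfun_approx => // y _; rewrite lee_fin.
have ndf x : {homo (fun n => f n x) : m n / (m <= n)%N >-> (m <= n)%R}.
  by move=> m n mn; have /lefP := nd_nnsfun_approx measurableT mEF mn; exact.
have step n : \int[nu]_x (f n x)%:E = \int[mu]_x (f n x * p x)%:E.
  under [LHS]eq_integral do rewrite fimfunE -fsumEFin//.
  rewrite [LHS]ge0_integral_fsum//; last 2 first.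
  - by move=> r; exact/measurable_EFinP/measurableT_comp.
  - by move=> r x _; rewrite EFinM nnfun_muleindic_ge0.
  under [RHS]eq_integral.
    move=> x _; rewrite mulrC EFinM fimfunE -fsumEFin// ge0_mule_fsumr; last first.
      by move=> r; rewrite EFinM nnfun_muleindic_ge0.
    over.
  rewrite [RHS]ge0_integral_fsum//; last 2 first.
  - move=> r; under eq_fun do rewrite -EFinM; apply/measurable_EFinP.
    by apply: measurable_funM => //; apply: measurable_funM.
  - move=> r x _; rewrite mule_ge0//; first by rewrite lee_fin.
    by rewrite EFinM nnfun_muleindic_ge0.
  apply: eq_fsbigr => r; rewrite inE => -[t _ rE].
  have r0 : (0 <= r)%R by rewrite -rE.
  have mr : measurable (f n @^-1` [set r]) by [].
  transitivity (r%:E * nu (f n @^-1` [set r])).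
    rewrite integralZl_indic_nnsfun//; congr (_ * _).
    by have := integral_indic nu measurableT mr; rewrite setIT.
  rewrite nuE//.
  under [RHS]eq_integral do rewrite -EFinM mulrCA EFinM.
  rewrite [RHS]ge0_integralZl_EFin//; last 2 first.
  - by move=> x _; rewrite lee_fin mulr_ge0.
  - by apply/measurable_EFinP; apply: measurable_funM.
  congr (_ * _); rewrite integral_mkcond; apply: eq_integral => x _.
  by rewrite patchE indicE; case: (x \in _); rewrite ?mulr1 ?mulr0.
transitivity (limn (fun n => \int[nu]_x (f n x)%:E)).
  rewrite -monotone_convergence//.
  - by apply: eq_integral => x _; apply/esym/cvg_lim.
  - by move=> n; exact/measurable_EFinP.
  - by move=> n x _; rewrite lee_fin.
  - by move=> x _ m n mn; rewrite lee_fin ndf.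
transitivity (limn (fun n => \int[mu]_x (f n x * p x)%:E)).
  by congr (limn _); apply/funext.
rewrite -monotone_convergence//.
- apply: eq_integral => x _; apply/cvg_lim => //; rewrite EFinM.
  under eq_fun do rewrite EFinM.
  by apply: cvgeZr.
- by move=> n; apply/measurable_EFinP; apply: measurable_funM.
- by move=> n x _; rewrite lee_fin mulr_ge0.
- by move=> x _ m n mn; rewrite lee_fin ler_wpM2r// ndf.
Qed.

End Density.

Section LaplaceExponent.
Context {R : realType} (g : R -> R).
Hypothesis g0 : forall x, 0 <= g x.
Hypothesis gP : compact_support_pos g.
Local Notation mu := (@lebesgue_measure R).

Definition laplace_weight x := 1 - expR (- g x).
Local Notation h := laplace_weight.

Lemma laplace_weight_ge0 x : 0 <= h x.
Proof. by rewrite subr_ge0 -expR0 ler_expR oppr_le0. Qed.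

Lemma laplace_weightP : compact_support_pos h.
Proof.
have [cg [delta [M [d0 supp]]]] := gP; split.
  move=> x; apply: cvgB; first exact: cvg_cst.
  apply: continuous_comp; last exact: continuous_expR.
  by apply: cvgN; exact: cg.
exists delta, M; split => // x hx; apply: supp.
by apply: contra hx => /eqP gx; rewrite /h gx oppr0 expR0 subrr.
Qed.

Lemma compact_support_integrable (f : R -> R) :
  compact_support_pos f -> mu.-integrable setT (EFin \o f).
Proof.
move=> [cf [delta [M [d0 supp]]]].
have -> : EFin \o f = (EFin \o f) \_ `[delta, M]%classic.
  apply/funext => x; rewrite patchE; case: ifPn => //= xM.
  congr EFin; apply/eqP; apply: contraNT xM => /supp.
  by rewrite inE/= in_itv.
apply: (iffLR (integrable_mkcond _ _)) => //.
apply: continuous_compact_integrable; first exact: segment_compact.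
exact: continuous_subspaceT.
Qed.

Let hint : mu.-integrable setT (EFin \o h) := compact_support_integrable laplace_weightP.

Let hintS (D : set R) : measurable D -> mu.-integrable D (EFin \o h).
Proof. by move=> mD; exact: integrableS hint. Qed.

Definition laplace_exponent := \int[mu]_x h x.
Local Notation J := laplace_exponent.
Let Q (s : R) := \int[mu]_(x in `]-oo, s]) h x.

Let dQ (x : R) : is_derive x (1 : R) Q (h x).
Proof.
have [dQx QE] := @continuous_FTC1 _ h -oo%O x (x + 1) ltac:(by rewrite ltrDl)
  (hintS (measurable_itv _)) ltac:(by rewrite ltNyr) (laplace_weightP.1 x).
by apply: DeriveDef; [exact: dQx|rewrite -derive1E; exact: QE].
Qed.

Let QJ s : Q s <= J.
Proof.
rewrite /Q /J /Rintegral fine_le//.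
- exact/integrable_fin_num/hintS.
- exact: integrable_fin_num.
apply: ge0_subset_integral => //.
- by have /integrableP[] := hint.
- by move=> x _; rewrite lee_fin laplace_weight_ge0.
Qed.

Lemma laplace_exponentE :
  (\int[mu]_(x in `]0%R, +oo[) (h x)%:E)%E = J%:E.
Proof.
have [_ [delta [M [d0 supp]]]] := laplace_weightP.
rewrite /J /Rintegral fineK; last exact: integrable_fin_num.
rewrite [LHS]integral_mkcond; apply: eq_integral => x _; rewrite patchE; case: ifPn => // x0.
congr EFin; apply/esym/eqP; apply: contraNT x0 => /supp/andP[dx _].
by rewrite inE/= in_itv/= andbT (lt_le_trans d0).
Qed.

(** exp(- int_s^oo (1 - exp(- g))), the Laplace functional at g of a unit rate
    Poisson process restricted to (s, oo). *)
Definition laplace_tail s := expR (Q s - J).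
Local Notation psi := laplace_tail.

Lemma laplace_tail_le1 s : psi s <= 1.
Proof. by rewrite -expR0 ler_expR subr_le0; exact: QJ. Qed.

Lemma laplace_tail0 : psi 0 = expR (- J).
Proof.
have [_ [delta [M [d0 supp]]]] := laplace_weightP.
rewrite /psi; suff -> : Q 0 = 0 by rewrite sub0r.
rewrite /Q /Rintegral integral0_eq// => x; rewrite /= in_itv/= => x0.
congr EFin; apply/eqP; apply/negP => /negP/supp/andP[+ _].
by apply/negP; rewrite -ltNge (le_lt_trans x0).
Qed.

Lemma laplace_tail_eventually : exists2 B : R, 0 <= B &
  forall s, B <= s -> psi s = 1 /\ g s = 0.
Proof.
have [_ [delta [M [d0 supp]]]] := laplace_weightP.
exists (Num.max 0 (M + 1)) => [|s]; first by rewrite le_max lexx.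
rewrite ge_max => /andP[_ Ms].
have hM x : M < x -> h x = 0.
  by move=> Mx; apply/eqP; apply: contraTT Mx => /supp/andP[_]; rewrite -leNgt.
split.
  rewrite /psi (_ : Q s = J) ?subrr ?expR0//; rewrite /Q /J /Rintegral; congr fine.
  rewrite [LHS]integral_mkcond; apply: eq_integral => x _; rewrite patchE; case: ifPn => // xs.
  rewrite hM//; move: xs; rewrite notin_setE/= in_itv/= => /negP; rewrite -ltNge; lra.
apply: oppr_inj; apply: (@expR_inj R); rewrite oppr0 expR0; apply/esym/eqP.
by rewrite -subr_eq0; apply/eqP; apply: hM; lra.
Qed.

Let dpsi (x : R) : is_derive x (1 : R) psi (h x * psi x).
Proof.
have d1 : is_derive x (1 : R) (fun s => Q s - J) (h x).
  apply: is_derive_eq; first exact: (is_deriveB (dQ x) (is_derive_cst J x 1)).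
  by rewrite subr0.
have d2 := is_derive_expR (Q x - J).
have d3 := @is_derive1_comp _ expR (fun s => Q s - J) x _ _ d2 d1.
rewrite (_ : h x * psi x = expR (Q x - J) * h x); first exact: d3.
by rewrite mulrC.
Qed.

Lemma laplace_tail_continuous : continuous psi.
Proof.
move=> x; apply: differentiable_continuous; apply/derivable1_diffP.
by have [] := dpsi x.
Qed.

(** Conditioning on the first arrival after s.  The integrand is the derivative of
    - psi (s + x) exp(- x), because psi' = (1 - exp(- g)) psi. *)
Lemma laplace_tail_eq s :
  (\int[mu]_(x in `[0%R, +oo[) (expR (- g (s + x)) * psi (s + x) * expR (- x))%:E =
   (psi s)%:E)%E.
Proof.
have cs : continuous (fun x => s + x).
  by move=> x; apply: cvgD; [exact: cvg_cst|exact: cvg_id].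
have cN : continuous (fun x : R => expR (- x)).
  by move=> x; apply: continuous_comp; [exact: oppr_continuous|exact: continuous_expR].
pose F x := - (psi (s + x) * expR (- x)).
have cF : continuous F.
  move=> x; apply: cvgN; apply: cvgM; last exact: cN.
  by apply: continuous_comp; [exact: cs|exact: laplace_tail_continuous].
have dF (x : R) : is_derive x (1 : R) F (expR (- g (s + x)) * psi (s + x) * expR (- x)).
  have d1 : is_derive x (1 : R) (fun x => psi (s + x)) (h (s + x) * psi (s + x)).
    have d0 := is_deriveD (is_derive_cst s x (1 : R)) (is_derive_id x (1 : R)).
    rewrite add0r in d0.
    have d01 := @is_derive1_comp _ psi (fun x => s + x) x _ _ (dpsi (s + x)) d0.
    rewrite mulr1 in d01; exact: d01.
  have d2 : is_derive x (1 : R) (fun x : R => expR (- x)) (- expR (- x)).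
    have d0 := @is_derive1_comp _ expR (fun x => - x) x _ _
      (is_derive_expR (- x)) (is_deriveN (is_derive_id x (1 : R))).
    rewrite mulrN1 in d0; exact: d0.
  have d3 := is_deriveN (is_deriveM d1 d2).
  have dE : expR (- g (s + x)) * psi (s + x) * expR (- x) =
      - (psi (s + x) *: - expR (- x) + expR (- x) *: (h (s + x) * psi (s + x))).
    by rewrite /GRing.scale/= /h; ring.
  rewrite dE; exact: d3.
rewrite (@ge0_continuous_FTC2y _ _ F 0 0).
- by rewrite /F addr0 oppr0 expR0 mulr1 EFinN oppeK add0e.
- by move=> x _; rewrite !mulr_ge0// expR_ge0.
- apply: continuous_subspaceT => x; apply: cvgM; last exact: cN.
  apply: cvgM; last by apply: continuous_comp; [exact: cs|exact: laplace_tail_continuous].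
  apply: continuous_comp; last exact: continuous_expR.
  by apply: cvgN; apply: continuous_comp; [exact: cs|exact: gP.1].
- rewrite -oppr0; apply: cvgN.
  apply: (@squeeze_cvgr _ _ _ _ (fun=> 0) (fun x : R => expR (- x))).
  + near=> x; apply/andP; split; first by rewrite mulr_ge0// expR_ge0.
    by rewrite ler_piMl ?expR_ge0// laplace_tail_le1.
  + exact: cvg_cst.
  + exact: cvgr_expR.
- by move=> x _; have [] := dF x.
- exact/cvg_at_right_filter/cF.
- by move=> x _; rewrite derive1E; have [] := dF x.
Unshelve. all: by end_near. Qed.

End LaplaceExponent.

(** * Arrival times with exponential gaps *)

Lemma sigma_gen1 {R : realType} d (T : measurableType d) (f : T -> R) B :
  measurable B -> sigma_gen (fun _ : unit => f) (f @^-1` B).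
Proof.
move=> mB; apply: sub_sigma_algebra; exists tt => //.
by exists B => //; rewrite setTI.
Qed.

Section Arrivals.
Context {R : realType} (T : Type) (E : nat -> T -> R) (g : R -> R).

Definition arrival n w : R := \sum_(k < n) E k w.

Definition arrival_weight n w := \prod_(i < n) expR (- g (arrival i.+1 w)).

End Arrivals.

Lemma measurable_arrivals {R : realType} d (T : measurableType d) (E : nat -> T -> R)
    (g : R -> R) n :
  continuous g -> (forall j, (j < n)%N -> measurable_fun setT (E j)) ->
  measurable_fun setT (fun w => (arrival_weight E g n w, arrival E n w)).
Proof.
move=> cg mE.
have ma i : (i <= n)%N -> measurable_fun setT (arrival E i).
  move=> i_n; apply: measurable_sum => k; apply: mE.
  exact: leq_trans (ltn_ord k) i_n.
apply: measurable_fun_pair; last exact: ma.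
apply: measurable_prod => i _; apply: measurableT_comp => //.
apply: measurableT_comp => //; apply: measurableT_comp; last exact: ma.
exact: continuous_measurable_fun.
Qed.

Section ExponentialArrivals.
Context {R : realType} d (T : measurableType d) (P : probability T R)
  (E : nat -> {RV P >-> R}).
Hypothesis E_iid : iid P E.
Hypothesis E_exp : forall k, std_exponential (E k).
Local Notation mu := (@lebesgue_measure R).

Lemma exponential_integral k (F : R -> R) :
  measurable_fun setT F -> (forall x, 0 <= F x) ->
  (\int[P]_w (F (E k w))%:E = \int[mu]_(x in `[0%R, +oo[) (F x * expR (- x))%:E)%E.
Proof.
move=> mF F0.
have p0 x : 0 <= exponential_pdf 1 x :> R by exact: exponential_pdf_ge0.
have mp : measurable_fun setT (exponential_pdf (1 : R)) by exact: measurable_exponential_pdf.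
pose RB := measurableTypeR R.
have mE : measurable_fun setT (E k : T -> RB).
  have mEk : measurable_fun setT (E k : T -> R) by exact: measurable_funP.
  by move=> _ B mB; exact: (mEk measurableT B mB).
have mF' : measurable_fun setT (F : RB -> R).
  by move=> _ B mB; exact: (mF measurableT B mB).
have mp' : measurable_fun setT (exponential_pdf (1 : R) : RB -> R).
  by move=> _ B mB; exact: (mp measurableT B mB).
pose mEi := isMeasurableFun.Build _ _ _ _ (E k : T -> RB) mE.
pose E' : {mfun T >-> RB} := HB.pack (E k : T -> RB) mEi.
have law (B : set RB) : measurable B ->
    (distribution P E' B = \int[mu]_(x in B) (exponential_pdf 1 x)%:E)%E.
  by move=> mB; exact: (@E_exp k B mB).
transitivity (\int[distribution P E']_x (F x)%:E)%E.
  by rewrite ge0_integral_distribution//; exact/measurable_EFinP.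
have -> := @integral_density _ _ R mu (distribution P E') _ F mp' p0 law mF' F0.
rewrite [RHS]integral_mkcond; apply: eq_integral => x _.
rewrite /exponential_pdf !patchE; case: ifPn => _; last by rewrite mulr0.
by rewrite mul1r mulN1r.
Qed.

(** Off this null event the partial sums increase, so that they stay beyond the
    support of g once they have left it. *)
Lemma exponential_gt0_ae : P [set w | exists k, E k w <= 0] = 0%E.
Proof.
have mle k : measurable [set w | E k w <= 0].
  rewrite (_ : [set w | _] = E k @^-1` `]-oo, 0]%classic); last first.
    by apply/seteqP; split => w /=; rewrite in_itv.
  by rewrite -[X in measurable X]setTI; exact: measurable_funP.
rewrite (_ : [set w | _] = \bigcup_k [set w | E k w <= 0]); last first.
  by apply/seteqP; split => w /= [k]; [exists k|move=> _; exists k].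
apply: measure_negligible; first by apply: bigcupT_measurable => k; exact: mle.
apply: negligible_bigcup => k; apply/negligibleP; first exact: mle.
transitivity (\int[P]_w (\1_[set w | (E k w <= 0)%R] w)%:E)%E.
  by rewrite integral_real_indic.
have mF : measurable_fun setT (\1_`]-oo, 0]%classic : R -> R) by exact: measurable_indic.
have := exponential_integral k mF (fun x => _) => H.
rewrite (eq_integral (fun w => (\1_`]-oo, 0]%classic (E k w))%:E)); last first.
  by move=> w _; rewrite !indicE; congr ((nat_of_bool _)%:R%:E); apply/idP/idP; rewrite !inE/= in_itv.
rewrite H; last by move=> x; rewrite indicE.
rewrite -integral_itv_obnd_cbnd; last first.
  apply/measurable_EFinP; apply: measurable_funM; first exact: measurable_funTS.
  by apply: measurable_funTS; apply: measurableT_comp.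
rewrite integral0_eq// => x; rewrite /= in_itv/= andbT => x0.
by rewrite indicE memNset ?mul0r//= in_itv/=; apply/negP; rewrite -ltNge.
Qed.

Let past n := \bigcup_(j in [set` [fset k in iota 0 n]%fset])
  sigma_gen (fun _ : unit => E j : T -> R).

Let measurable_past n j : (j < n)%N ->
  measurable_fun [set: g_sigma_algebraType (past n)] (E j : g_sigma_algebraType _ -> R).
Proof.
move=> jn _ B mB; rewrite setTI; apply: sub_sigma_algebra.
exists j; first by rewrite /= !inE mem_iota.
exact: sigma_gen1.
Qed.

Lemma arrival_independent n (U : T -> R * R) A B :
  measurable_fun [set: g_sigma_algebraType (past n)] (U : g_sigma_algebraType _ -> R * R) ->
  measurable A -> measurable B ->
  (P (U @^-1` A `&` E n @^-1` B) = P (U @^-1` A) * P (E n @^-1` B))%E.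
Proof.
move=> mU mA mB; rewrite setIC muleC.
have indE : independent_classes P (fun j => sigma_gen (fun _ : unit => E j : T -> R)) := E_iid.1.
apply: (@independent_classes_join _ _ _ P _ _ _ _ _ indE n [fset k in iota 0 n]%fset).
- by move=> j; apply: gen_space_measurable => _.
- move=> j C D; exact: (@measurableI _ (gen_space (fun _ : unit => E j : T -> R))).
- move=> j; exact: (@measurableT _ (gen_space (fun _ : unit => E j : T -> R))).
- by rewrite !inE mem_iota add0n ltnn andbF.
- exact: sigma_gen1.
- by have := mU measurableT _ mA; rewrite setTI.
Qed.

Lemma exponential_laplace1 k : (\int[P]_w (expR (- E k w))%:E = (2^-1)%:E)%E.
Proof.
have mexp : measurable_fun setT (fun x : R => expR (- x)) by apply: measurableT_comp.
have /= -> := @exponential_integral k (fun x => expR (- x)) mexp (fun x => expR_ge0 _).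
have := @integral_exponential_pdf R 2 ltac:(by []) => /(congr1 (fun x => (2^-1)%:E * x)%E).
rewrite mule1 => <-.
rewrite -ge0_integralZl_EFin//; last 2 first.
- by move=> x _; rewrite lee_fin exponential_pdf_ge0.
- by apply/measurable_EFinP; exact: measurable_exponential_pdf.
rewrite [LHS]integral_mkcond; apply: eq_integral => x _.
rewrite /exponential_pdf !patchE; case: ifPn => _; last by rewrite mule0.
by rewrite -EFinM mulrA mulVf// mul1r -expRD mulNr mulr_natl mulr2n opprD.
Qed.

(** Serves as a bound, by Markov's inequality, for the probability that the n-th
    arrival comes before a given time. *)
Lemma arrival_laplace n : (\int[P]_w (expR (- arrival E n w))%:E = ((2^-1) ^+ n)%:E)%E.
Proof.
rewrite (eq_integral (fun w => (\prod_(j <- iota 0 n) expR (- E j w))%:E)); last first.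
  move=> w _; rewrite /arrival -sumrN expR_sum.
  by rewrite -(big_mkord xpredT (fun j => expR (- E j w))) /index_iota subn0.
rewrite (@expectation_prod _ _ _ P _ _ (fun j (_ : unit) => E j : T -> R)
  (fun j w => expR (- E j w)) (iota 0 n))//.
- rewrite (eq_bigr (fun=> (2^-1)%:E)); last by move=> j _; exact: exponential_laplace1.
  rewrite -[in RHS](size_iota 0 n); elim: (iota 0 n) => [|j s IH].
    by rewrite big_nil.
  by rewrite big_cons IH exprS EFinM.
- exact: E_iid.1.
- move=> j; apply: measurableT_comp => //; apply: measurableT_comp => //.
  by move=> _ B mB; rewrite setTI; exact: sigma_gen1.
- exact: iota_uniq.
Qed.

Context (g : R -> R).
Hypothesis g0 : forall x, 0 <= g x.
Hypothesis gP : compact_support_pos g.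

(** Integrating out the last gap with [laplace_tail_eq] turns the expression of
    index n + 1 into that of index n; for n = 0 it is laplace_tail g 0. *)
Lemma arrival_martingale n :
  (\int[P]_w (arrival_weight E g n w * laplace_tail g (arrival E n w))%:E =
   (laplace_tail g 0)%:E)%E.
Proof.
elim: n => [|n <-].
  under eq_integral => w _ do rewrite /arrival_weight /arrival !big_ord0 mul1r.
  exact: integral_real_cst.
pose U w := (arrival_weight E g n w, arrival E n w).
pose H (s v : R) := expR (- g (s + v)) * laplace_tail g (s + v).
have cg : continuous g := gP.1.
have H0 s v : 0 <= H s v by rewrite mulr_ge0 ?expR_ge0.
have cH : continuous (laplace_tail g) := laplace_tail_continuous gP.
have mgen : measurable_fun [set: g_sigma_algebraType (past n)]
    (U : g_sigma_algebraType (past n) -> R * R).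
  exact: (measurable_arrivals cg (@measurable_past n)).
have mU : measurable_fun setT U.
  by apply: measurable_arrivals => // j _; exact: measurable_funP.
have mE : measurable_fun setT (E n : T -> R) by [].
have mH2 : measurable_fun setT (fun z : R * R => H z.1 z.2).
  have mD : measurable_fun setT (fun z : R * R => z.1 + z.2).
    by apply: measurable_funD; [exact: measurable_fst|exact: measurable_snd].
  apply: measurable_funM.
    apply: measurableT_comp => //; apply: measurableT_comp => //.
    by apply: measurableT_comp => //; exact: continuous_measurable_fun.
  by apply: measurableT_comp => //; exact: continuous_measurable_fun.
have mHs s : measurable_fun setT (H s).
  have mp : measurable_fun setT (fun v : R => (s, v)) by apply: measurable_fun_pair.
  exact: (measurableT_comp mH2 mp).
have w0 m w : 0 <= arrival_weight E g m w.
  by apply: prodr_ge0 => i _; exact: expR_ge0.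
pose F (z : (R * R) * R) : \bar R := (`|z.1.1| * H z.1.2 z.2)%:E.
have indUE A B : measurable A -> measurable B ->
    P (U @^-1` A `&` E n @^-1` B) = (P (U @^-1` A) * P (E n @^-1` B))%E.
  exact: arrival_independent mgen.
transitivity (\int[P]_w F (U w, E n w))%E.
  apply: eq_integral => w _; congr EFin.
  rewrite /= ger0_norm// /arrival_weight big_ord_recr/= -mulrA.
  by rewrite /H /arrival big_ord_recr.
have m1 : measurable_fun setT (fun z : (R * R) * R => z.1.1).
  exact: (measurableT_comp measurable_fst measurable_fst).
have m2 : measurable_fun setT (fun z : (R * R) * R => z.1.2).
  exact: (measurableT_comp measurable_snd measurable_fst).
have m3 : measurable_fun setT (fun z : (R * R) * R => z.2) by exact: measurable_snd.
have mF : measurable_fun setT F.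
  apply/measurable_EFinP; apply: measurable_funM; first exact: measurableT_comp.
  exact: (measurableT_comp mH2 (measurable_fun_pair m2 m3)).
rewrite (@independent_fubini _ _ _ _ _ P _ _ U (E n) mU mE indUE F mF); last first.
  by move=> z; rewrite /F lee_fin mulr_ge0.
apply: eq_integral => w _.
rewrite /F/= (@integral_realZ _ _ _ P _ (fun w' => H (arrival E n w) (E n w')))//; last first.
  exact: (measurableT_comp (mHs _) mE).
rewrite (@exponential_integral n (H (arrival E n w)))//.
by rewrite laplace_tail_eq// -EFinM ger0_norm.
Qed.

End ExponentialArrivals.

Section Expectation01.
Context {R : realType} d (T : measurableType d) (P : probability T R).

Lemma expectation01_fin_num (h : T -> R) : (forall w, 0 <= h w <= 1) ->
  (\int[P]_w (h w)%:E)%E \is a fin_num.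
Proof.
move=> h01; rewrite ge0_fin_numE; last first.
  by apply: integral_ge0 => w _; rewrite lee_fin; case/andP: (h01 w).
apply: (@le_lt_trans _ _ 1%E); last by rewrite ltry.
rewrite -(integral_real_cst P 1); apply: le_integral_real => w;
  by case/andP: (h01 w).
Qed.

Lemma expectation01_close (h e err : T -> R) (eps : R) :
  (forall w, 0 <= h w <= 1) -> (forall w, 0 <= e w <= 1) ->
  measurable_fun setT e -> measurable_fun setT err -> (forall w, 0 <= err w) ->
  (forall w, `|h w - e w| <= err w) -> (\int[P]_w (err w)%:E <= eps%:E)%E ->
  `|fine (\int[P]_w (h w)%:E)%E - fine (\int[P]_w (e w)%:E)%E| <= eps.
Proof.
move=> h01 e01 me merr err0 he err_eps.
have h0 w : 0 <= h w by case/andP: (h01 w).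
have e0 w : 0 <= e w by case/andP: (e01 w).
have := @integral_close _ _ _ P _ _ _ h0 me e0 merr err0 he.
have /fineK <- := expectation01_fin_num h01.
have /fineK <- := expectation01_fin_num e01.
move=> [H1 H2]; rewrite ler_norml; apply/andP; split.
  have := le_trans H2 (leeD2l _ err_eps); rewrite -EFinD lee_fin; lra.
have := le_trans H1 (leeD2l _ err_eps); rewrite -EFinD lee_fin; lra.
Qed.

End Expectation01.

Section ArrivalLimit.
Context {R : realType} d (T : measurableType d) (P : probability T R)
  (E : nat -> {RV P >-> R}).
Hypothesis E_iid : iid P E.
Hypothesis E_exp : forall k, std_exponential (E k).
Context (g : R -> R).
Hypothesis g0 : forall x, 0 <= g x.
Hypothesis gP : compact_support_pos g.

(** Once the n-th arrival exceeds the support of g and no gap vanishes, h is the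
    martingale of [arrival_martingale]; the exceptional event has probability at
    most exp(B) 2^-n. *)
Lemma arrival_weight_limit (h : T -> R) :
  (forall w, 0 <= h w <= 1) ->
  (forall n w, (forall k, 0 < E k w) ->
     (forall j, (n <= j)%N -> g (arrival E j.+1 w) = 0) ->
     h w = arrival_weight E g n w) ->
  (\int[P]_w (h w)%:E)%E = (expR (- laplace_exponent g))%:E.
Proof.
move=> h01 hE.
have [B B0 gB] := laplace_tail_eventually gP.
have cg : continuous g := gP.1.
have cpsi := laplace_tail_continuous gP.
pose bad := [set w | exists k, E k w <= 0].
have mbad : measurable bad.
  rewrite (_ : bad = \bigcup_k (E k @^-1` `]-oo, 0]%classic)).
    by apply: bigcupT_measurable => k; rewrite -[X in measurable X]setTI; exact: measurable_funP.
  by apply/seteqP; split => w /= [k]; [|move=> _]; rewrite /= ?in_itv/=; exists k => //; rewrite /= in_itv.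
have ma n : measurable_fun setT (arrival E n) by exact: measurable_sum.
pose e n w := arrival_weight E g n w * laplace_tail g (arrival E n w).
(* exp(B - Gamma_n) is at least 1 exactly when Gamma_n <= B *)
pose err n w := \1_bad w + expR B * expR (- arrival E n w).
have me n : measurable_fun setT (e n).
  apply: measurable_funM; last by apply: measurableT_comp => //; exact: continuous_measurable_fun.
  by apply: (measurableT_comp measurable_fst (measurable_arrivals (n := n) cg _)) => j _.
have mexp n : measurable_fun setT (fun w => expR (- arrival E n w)).
  by apply: measurableT_comp => //; exact: measurableT_comp.
have merr n : measurable_fun setT (err n).
  apply: measurable_funD; first exact: measurable_indic.
  by apply: measurable_funM.
have err0 n w : 0 <= err n w by rewrite addr_ge0 ?mulr_ge0 ?expR_ge0// indicE.
have e01 n w : 0 <= e n w <= 1.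
  have w0 : 0 <= arrival_weight E g n w by apply: prodr_ge0 => i _; exact: expR_ge0.
  rewrite mulr_ge0 ?expR_ge0//=; apply: mulr_ile1; rewrite ?expR_ge0 ?laplace_tail_le1//.
  by rewrite /arrival_weight -expR_sum -expR0 ler_expR; apply: sumr_le0 => i _; rewrite oppr_le0.
have he n w : `|h w - e n w| <= err n w.
  have [Bad|good] := boolP (w \in bad).
    rewrite /err indicE Bad; apply: (@le_trans _ _ 1); last by rewrite lerDl mulr_ge0 ?expR_ge0.
    by rewrite ler_norml; case/andP: (h01 w); case/andP: (e01 n w); lra.
  have Egt0 k : 0 < E k w.
    by rewrite ltNge; apply/negP => Ek; case/negP: good; rewrite inE; exists k.
  rewrite /err indicE (negbTE good) add0r -expRD.
  have [BG|GB] := leP B (arrival E n w); last first.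
    apply: (@le_trans _ _ 1); last by rewrite -expR0 ler_expR subr_ge0 ltW.
    by rewrite ler_norml; case/andP: (h01 w); case/andP: (e01 n w); lra.
  rewrite (hE n w)//.
    by rewrite /e (gB _ BG).1 mulr1 subrr normr0 expR_ge0.
  move=> j nj; apply: (gB _ _).2; apply: (le_trans BG); rewrite /arrival.
  rewrite -!(big_mkord xpredT (fun k => E k w)) [leRHS](@big_cat_nat _ _ _ n)//=; last exact: leqW.
  by rewrite lerDl; apply: sumr_ge0 => k _; exact: ltW.
have errE n : (\int[P]_w (err n w)%:E)%E = (expR B * 2^-1 ^+ n)%:E.
  have m1 : measurable_fun setT (\1_bad : T -> R) by exact: measurable_indic.
  have m2 : measurable_fun setT (fun w => expR B * expR (- arrival E n w)).
    exact: measurable_funM.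
  have p1 w : 0 <= (\1_bad w : R) by rewrite indicE.
  have p2 w : 0 <= expR B * expR (- arrival E n w) by rewrite mulr_ge0 ?expR_ge0.
  rewrite /err (integral_realD P m1 m2 p1 p2) integral_real_indic//.
  rewrite (exponential_gt0_ae E_exp) add0e.
  rewrite integral_realZ ?expR_ge0//.
  by rewrite (arrival_laplace E_iid E_exp).
have close n : `|fine (\int[P]_w (h w)%:E)%E - expR (- laplace_exponent g)| <= expR B * 2^-1 ^+ n.
  have := @expectation01_close _ _ _ P h (e n) (err n) _ h01 (e01 n) (me n) (merr n) (err0 n) (he n).
  by move=> /(_ (expR B * 2^-1 ^+ n)); rewrite errE lexx /e (arrival_martingale E_iid E_exp g0 gP) laplace_tail0//; apply.
rewrite -(fineK (expectation01_fin_num P h01)); congr EFin.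
apply/eqP; rewrite -subr_eq0 -normr_le0.
have lim : expR B * 2^-1 ^+ n @[n --> \oo] --> (0 : R).
  rewrite -(mulr0 (expR B)); apply: cvgM; first exact: cvg_cst.
  by apply: cvg_expr; rewrite ger0_norm ?invr_ge0// invf_lt1// ltr1n.
by apply: (cvgr_to_ge lim); near=> n; exact: close.
Unshelve. all: by end_near. Qed.

End ArrivalLimit.

(** * Test functions and the Laplace functional of the limit *)

Section TestFunctions.
Context {R : realType}.

Definition zero_extension (f : R -> R) x := if 0 < x then f x else 0.

(** The closure of the support is compact and omits 0, hence is bounded and
    omits a neighbourhood of 0. *)
Lemma zero_extension_compact_support f :
  test_function f -> compact_support_pos (zero_extension f).
Proof.
move=> [fc f0 compS subS]; set S := [set x | 0 < x /\ f x != 0] in compS subS.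
have S_ext x : zero_extension f x != 0 -> S x.
  by rewrite /zero_extension; case: ifPn => //; rewrite eqxx.
have [e e0 Se] : exists2 e : R, 0 < e & forall x, S x -> e <= x.
  have [e /= e0 He] : nbhs (0 : R) (~` closure S).
    apply: open_nbhs_nbhs; split; first exact/closed_openC/closed_closure.
    by move=> /subS; rewrite /= in_itv/= ltxx.
  exists e => // x Sx; rewrite leNgt; apply/negP => xe.
  apply: (He x); last exact: subset_closure.
  by rewrite /ball/= sub0r normrN gtr0_norm//; case: Sx.
have [M [_ HM]] := compact_bounded compS.
split; last first.
  exists e, (M + 1); split => // x /S_ext Sx; rewrite Se//=.
  apply: (le_trans (ler_norm _)); apply: HM; first by rewrite ltrDl.
  exact: subset_closure.
move=> x; have [x0|x0] := ltP 0 x.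
  have fx : f y @[y --> x] --> f x by apply: fc; rewrite in_itv/= x0.
  rewrite /continuous_at {2}/zero_extension x0.
  apply: cvg_trans fx; apply: near_eq_cvg.
  near=> y; rewrite /= /zero_extension ifT//; near: y; exact: lt_nbhsr.
have Z0 y : y < e -> zero_extension f y = 0.
  move=> ye; apply/eqP; apply: contraTT ye => /S_ext/Se; by rewrite leNgt.
rewrite /continuous_at Z0 ?(le_lt_trans x0)//.
have fx : (fun=> 0 : R) y @[y --> x] --> (0 : R) by exact: cvg_cst.
apply: cvg_trans fx.
apply: near_eq_cvg; near=> y; rewrite /= Z0//; near: y.
by apply: lt_nbhsl; apply: le_lt_trans e0.
Unshelve. all: by end_near. Qed.

Lemma zero_extension_ge0 f x : test_function f -> 0 <= zero_extension f x.
Proof. by move=> [_ f0 _ _]; rewrite /zero_extension; case: ifPn => // /f0. Qed.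

(** x |-> c x^-gam is a decreasing bijection of the half-line when c > 0, so it
    pulls compact sets back to compact sets; for c = 0 the extension is 0. *)
Lemma zero_extension_power_compact_support (f : R -> R) c gam :
  0 <= c -> 0 < gam -> compact_support_pos f ->
  compact_support_pos (zero_extension (fun x => f (c * x `^ (- gam)))).
Proof.
move=> c0 gam0 [cf [delta [M [d0 supp]]]].
have [->|cN0] := eqVneq c 0.
  rewrite (_ : zero_extension _ = fun=> 0); last first.
    apply/funext => x; rewrite /zero_extension mul0r; case: ifP => // _.
    by apply/eqP; apply/negP => /negP/supp/andP[]; rewrite leNgt d0.
  by split; [exact: cst_continuous|exists 1, 1; split => // x; rewrite eqxx].
have {cN0}c_gt0 : 0 < c by rewrite lt_neqAle eq_sym cN0.
have M1 : 0 < `|M| + 1 by rewrite ltr_wpDl.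
pose lo := (c / (`|M| + 1)) `^ gam^-1; pose hi := (c / delta) `^ gam^-1.
have lo0 : 0 < lo by rewrite powR_gt0// divr_gt0.
have root x y : 0 < x -> 0 < y -> (c * x `^ (- gam) <= y) = ((c / y) `^ gam^-1 <= x).
  move=> x0 y0; rewrite powRN ler_pdivrMr ?powR_gt0// mulrC -ler_pdivrMr//.
  have cy : 0 < c / y by rewrite divr_gt0.
  apply/idP/idP => H.
    have := @ge0_ler_powR _ gam^-1 _ _ _ _ _ H; rewrite ?nnegrE.
    rewrite -powRrM mulfV ?gt_eqF// (powRr1 (ltW x0)).
    by apply; rewrite ?powR_ge0// ?invr_ge0 ltW.
  have := @ge0_ler_powR _ gam _ _ _ _ _ H; rewrite ?nnegrE.
  rewrite -powRrM mulVf ?gt_eqF// (powRr1 (ltW cy)).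
  by apply; rewrite ?powR_ge0// ltW.
have rootd x y : 0 < x -> 0 < y -> y <= c * x `^ (- gam) -> x <= (c / y) `^ gam^-1.
  move=> x0 y0; rewrite powRN ler_pdivlMr ?powR_gt0// mulrC -ler_pdivlMr// => H.
  have := @ge0_ler_powR _ gam^-1 _ _ _ _ _ H; rewrite ?nnegrE.
  rewrite -powRrM mulfV ?gt_eqF// (powRr1 (ltW x0)).
  by apply; rewrite ?powR_ge0// ?invr_ge0 ?divr_ge0// ltW.
have suppE x : zero_extension (fun x => f (c * x `^ (- gam))) x != 0 -> lo <= x <= hi.
  rewrite /zero_extension; case: ifPn => [x0 /supp/andP[dx xM]|]; last by rewrite eqxx.
  rewrite rootd// andbT -root//; apply: (le_trans xM).
  by rewrite (le_trans (ler_norm _))// lerDl.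
split; last by exists lo, hi.
move=> x; have [x0|x0] := ltP 0 x.
  rewrite /continuous_at {2}/zero_extension x0.
  have cpow : {for x, continuous (fun y : R => y `^ (- gam))}.
    by apply: differentiable_continuous; apply/derivable1_diffP; apply: derivable_powR; rewrite in_itv/= x0.
  have fx : f (c * y `^ (- gam)) @[y --> x] --> f (c * x `^ (- gam)).
    apply: (@continuous_comp _ _ _ (fun y => c * y `^ (- gam)) f); last exact: cf.
    apply: cvgM; first exact: cvg_cst.
    exact: cpow.
  apply: cvg_trans fx; apply: near_eq_cvg.
  near=> y; rewrite /= /zero_extension ifT//; near: y; exact: lt_nbhsr.
have Z0 y : y < lo -> zero_extension (fun x => f (c * x `^ (- gam))) y = 0.
  by move=> ye; apply/eqP; apply: contraTT ye => /suppE/andP[+ _]; rewrite leNgt.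
rewrite /continuous_at Z0 ?(le_lt_trans x0)//.
have fx : (fun=> 0 : R) y @[y --> x] --> (0 : R) by exact: cvg_cst.
apply: cvg_trans fx.
apply: near_eq_cvg; near=> y; rewrite /= Z0//; near: y.
by apply: lt_nbhsl; apply: le_lt_trans lo0.
Unshelve. all: by end_near. Qed.

End TestFunctions.

Section LimitLaplace.
Context {R : realType} d (T : measurableType d) (P : probability T R)
  (E : nat -> {RV P >-> R}).
Hypothesis E_iid : iid P E.
Hypothesis E_exp : forall k, std_exponential (E k).

Lemma expeR_oppr_bounds (x : \bar R) : (0 <= x)%E -> 0 <= fine (expeR (- x)) <= 1.
Proof.
case: x => [x| |]//=; rewrite ?lexx ?ler01//.
by rewrite lee_fin => x0; rewrite expR_ge0/= -expR0 ler_expR oppr_le0.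
Qed.

Lemma expeR_oppr_fin_num (x : \bar R) : (0 <= x)%E -> expeR (- x) \is a fin_num.
Proof. by case: x. Qed.

(** The points c Gamma_i^-gam are read as the points Gamma_i and the test
    function as its pull-back; once an arrival has left the support of the
    latter, the series of the point measure is a finite sum, as required by
    [arrival_weight_limit]. *)
Lemma laplace_functional_arrivals (f : R -> R) (c gam : R) :
  test_function f -> 0 <= c -> 0 < gam ->
  laplace_functional P
    (fun w => point_measure_inf (fun i => c * (arrival E i.+1 w) `^ (- gam))) f =
  (expR (- laplace_exponent
     (zero_extension (fun x => zero_extension f (c * x `^ (- gam))))))%:E.
Proof.
move=> tf c0 gam0; rewrite /laplace_functional.
pose g := zero_extension (fun x => zero_extension f (c * x `^ (- gam))).
have g0 x : 0 <= g x by rewrite /g /zero_extension; do 2!case: ifP => //; case: tf => _ + _ _ => f0 *; exact: f0.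
have gP : compact_support_pos g.
  exact/zero_extension_power_compact_support/zero_extension_compact_support.
pose S w := (\sum_(i <oo) (if (0 < c * arrival E i.+1 w `^ (- gam))%R
  then (f (c * arrival E i.+1 w `^ (- gam)))%:E else 0))%E.
have S0 w : (0 <= S w)%E.
  by apply: nneseries_ge0 => i _ _; case: ifP => //; rewrite lee_fin; case: tf => _ + _ _; apply.
rewrite -(arrival_weight_limit E_iid E_exp g0 gP (h := fun w => fine (expeR (- S w)))).
- apply: eq_integral => w _; rewrite integral_point_measure_inf// fineK//.
  exact: expeR_oppr_fin_num.
- by move=> w; exact: expeR_oppr_bounds.
move=> n w Epos gn.
have apos i : 0 < arrival E i.+1 w.
  by rewrite /arrival big_ord_recl/= ltr_pwDl// sumr_ge0// => k _; exact: ltW.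
have SE : S w = (\sum_(i < n) g (arrival E i.+1 w))%:E.
  rewrite /S (eq_eseriesr (g := fun i => (g (arrival E i.+1 w))%:E)); last first.
    by move=> i _; rewrite /g /zero_extension apos; case: ifP.
  rewrite (nneseries_split 0 n)//; last by move=> k _; rewrite lee_fin.
  rewrite add0n eseries0 ?adde0; last by move=> i ni _; rewrite gn.
  by rewrite big_mkord sumEFin.
by rewrite SE /= /arrival_weight -sumrN expR_sum.
Qed.

End LimitLaplace.

(** * Truncated moments of a stochastic volatility sequence *)

Section TruncatedEntries.
Context {R : realType}.

Definition trunc_entry (K b x : R) := Num.min (`|x| / b) K.

Lemma trunc_entry_ge0 K b x : 0 <= K -> 0 < b -> 0 <= trunc_entry K b x.
Proof. by move=> K0 b0; rewrite le_min K0 andbT divr_ge0// ltW. Qed.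

Lemma measurable_trunc_entry K b : measurable_fun setT (trunc_entry K b).
Proof.
apply: measurable_minr; last exact: measurable_cst.
by apply: measurable_funM; [exact: normr_measurable|exact: measurable_cst].
Qed.

(** Bounding the volatility below by 1 lets it factor out of the truncation,
    min (s r) 1 <= max s 1 * min r 1. *)
Definition vol_pow (k s : R) := Num.max s 1 `^ k.

Lemma measurable_vol_pow k : measurable_fun setT (vol_pow k).
Proof.
apply: (measurableT_comp (measurable_powR k)).
by apply: measurable_maxr; [exact: measurable_id|exact: measurable_cst].
Qed.

Lemma vol_pow_sqr k s : vol_pow k s ^+ 2 = vol_pow (2 * k) s.
Proof.
rewrite /vol_pow [2 * k]mulrC powRrM -powR_mulrn ?powR_ge0//.
Qed.

Lemma trunc_pow_sqr k b (z : R) : trunc_pow k b z ^+ 2 = trunc_pow (2 * k) b z.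
Proof. by rewrite /trunc_pow [2 * k]mulrC powRrM -powR_mulrn ?powR_ge0. Qed.

(** Any power of exponent at most 1 dominates the truncated variable; exponent
    k / 2 leaves, after squaring, the k-th truncated moment of the noise. *)
Lemma trunc_entry_le K b s z k : 1 <= K -> 0 < b -> 0 <= s -> 0 <= k <= 1 ->
  trunc_entry K b (s * z) <= K * (vol_pow k s * trunc_pow k b z).
Proof.
move=> K1 b0 s0 /andP[k0 k1]; have K0 : 0 <= K by exact: le_trans K1.
set u := `|s * z| / b; have u0 : 0 <= u by rewrite divr_ge0// ltW.
apply: (@le_trans _ _ (K * Num.min u 1)).
  rewrite /trunc_entry -/u; have [u1|u1] := leP u 1.
    by rewrite ge_min; apply/orP; left; rewrite ler_peMl.
  by rewrite mulr1 ge_min lexx orbT.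
rewrite ler_wpM2l//; set m := Num.min u 1.
have m0 : 0 <= m by rewrite le_min u0 ler01.
have m1 : m <= 1 by rewrite ge_min lexx orbT.
apply: (@le_trans _ _ (m `^ k)).
  have [->|mN0] := eqVneq m 0; first by rewrite powR_ge0.
  by rewrite -[leLHS]powRr1// ger_powR// m1 lt_neqAle eq_sym mN0 m0.
rewrite /vol_pow /trunc_pow -powRM; last 2 first.
- by rewrite le_max ler01 orbT.
- by rewrite le_min ler01 divr_ge0// ltW.
apply: ge0_ler_powR => //; rewrite ?nnegrE//.
  by rewrite mulr_ge0// ?le_max ?le_min ler01 ?orbT// divr_ge0// ltW.
by rewrite /m /u normrM (ger0_norm s0) -mulrA min_mul_le// divr_ge0// ltW.
Qed.

Lemma trunc_entry_sqr_le K b s z k : 1 <= K -> 0 < b -> 0 <= s -> 0 <= k <= 1 ->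
  trunc_entry K b (s * z) ^+ 2 <= K ^+ 2 * (vol_pow (2 * k) s * trunc_pow (2 * k) b z).
Proof.
move=> K1 b0 s0 k01; rewrite -vol_pow_sqr -trunc_pow_sqr -!exprMn.
rewrite ler_sqr ?nnegrE ?trunc_entry_le//.
- by rewrite trunc_entry_ge0// (le_trans _ K1).
- by rewrite !mulr_ge0 ?powR_ge0// (le_trans _ K1).
Qed.

End TruncatedEntries.

Section StochasticVolatility.
Context {R : realType} d (T : measurableType d) (P : probability T R)
  (Z sigma : nat -> {RV P >-> R}).
Hypothesis Z_iid : iid P Z.
Hypothesis sigma_ge0 : forall t w, 0 <= sigma t w.
Hypothesis sigma_stat : stationary P sigma.
Hypothesis sigmaZ : independent_pair P sigma Z.

Lemma stationary_marginal t : eq_law P P (sigma t) (sigma 0%N).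
Proof.
move=> B mB.
have mB' : measurable [set u : 1.-tuple R | B (tnth u ord0)].
  have := measurable_tnth (T := R) (ord0 : 'I_1) measurableT mB.
  by rewrite setTI.
have := @sigma_stat t 1%N _ mB'; rewrite /window /preimage/=.
have H s : [set w | B (tnth [tuple sigma (s + i)%N w | i < 1] ord0)] = sigma s @^-1` B.
  by apply/seteqP; split => w /=; rewrite tnth_mktuple addn0.
by rewrite !H.
Qed.

Lemma sigma_integral t (F : R -> \bar R) : measurable_fun setT F ->
  (forall x, 0 <= F x)%E ->
  (\int[P]_w F (sigma t w) = \int[P]_w F (sigma 0%N w))%E.
Proof. by move=> mF F0; apply: eq_law_integral => //; exact: stationary_marginal. Qed.

Lemma noise_integral t (F : R -> \bar R) : measurable_fun setT F ->
  (forall x, 0 <= F x)%E ->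
  (\int[P]_w F (Z t w) = \int[P]_w F (Z 0%N w))%E.
Proof. by move=> mF F0; apply: eq_law_integral => //; exact: Z_iid.2. Qed.

Lemma sigma_noise_independent t A B : measurable A -> measurable B ->
  (P (sigma t @^-1` A `&` Z t @^-1` B) = P (sigma t @^-1` A) * P (Z t @^-1` B))%E.
Proof.
move=> mA mB; apply: sigmaZ; apply: sub_sigma_algebra; exists t => //.
  by exists A => //; rewrite setTI.
by exists B => //; rewrite setTI.
Qed.

(** Fubini over the independent pair (sigma_t, Z_t): only the two marginal laws
    matter, and these do not depend on t. *)
Lemma product_integral t (F : R -> \bar R) : measurable_fun setT F ->
  (forall x, 0 <= F x)%E ->
  (\int[P]_w F (sigma t w * Z t w)%R = \int[P]_w F (sigma 0%N w * Z 0%N w)%R)%E.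
Proof.
move=> mF F0.
pose G (z : R * R) : \bar R := F (z.1 * z.2).
have mG : measurable_fun setT G.
  by apply: (measurableT_comp mF); apply: measurable_funM; [exact: measurable_fst|exact: measurable_snd].
have G0 z : (0 <= G z)%E by exact: F0.
have fub s := independent_fubini (measurable_funP (sigma s)) (measurable_funP (Z s))
  (@sigma_noise_independent s) mG G0.
rewrite -[LHS]/(\int[P]_w G (sigma t w, Z t w))%E fub.
rewrite -[RHS]/(\int[P]_w G (sigma 0%N w, Z 0%N w))%E fub.
rewrite -(sigma_integral t (F := fun s => \int[P]_w G (s, Z 0%N w))%E).
- apply: eq_integral => w _; rewrite /G/=.
  apply: (@noise_integral t (fun z => F (sigma t w * z))) => //.
  by apply: (measurableT_comp mF); exact: measurable_funM.
- exact: (measurable_integral_section P (measurable_funP (Z 0%N)) mG).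
- by move=> s; apply: integral_ge0.
Qed.

Let msigma j : measurable_fun setT (sigma j) := measurable_funP (sigma j).
Let mnoise j : measurable_fun setT (Z j) := measurable_funP (Z j).

Let gen_vol k j : measurable_fun [set: gen_space sigma]
  ((fun w => vol_pow k (sigma j w)) : gen_space sigma -> R).
Proof.
apply: (measurableT_comp (measurable_vol_pow k)).
exact: (measurable_gen_space (X := fun i => sigma i : T -> R)).
Qed.

Let gen_trunc k b j : measurable_fun [set: gen_space Z]
  ((fun w => trunc_pow k b (Z j w)) : gen_space Z -> R).
Proof.
apply: (measurableT_comp (measurable_trunc_pow k b)).
exact: (measurable_gen_space (X := fun i => Z i : T -> R)).
Qed.

Let vol0 k j w : 0 <= vol_pow k (sigma j w). Proof. exact: powR_ge0. Qed.
Let trunc0 k b j w : 0 <= trunc_pow k b (Z j w). Proof. exact: powR_ge0. Qed.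

Let vol_integral k j :
  (\int[P]_w (vol_pow k (sigma j w))%:E = \int[P]_w (vol_pow k (sigma 0%N w))%:E)%E.
Proof.
apply: (sigma_integral j (F := fun x => (vol_pow k x)%:E)).
- by apply/measurable_EFinP; exact: measurable_vol_pow.
- by move=> x; rewrite lee_fin powR_ge0.
Qed.

Let trunc_integral k b j :
  (\int[P]_w (trunc_pow k b (Z j w))%:E = trunc_moment P (Z 0%N) k b)%E.
Proof.
apply: (noise_integral j (F := fun x => (trunc_pow k b x)%:E)).
- by apply/measurable_EFinP; exact: measurable_trunc_pow.
- by move=> x; rewrite lee_fin powR_ge0.
Qed.

Lemma entry_moment k b t :
  (\int[P]_w (vol_pow k (sigma t w) * trunc_pow k b (Z t w))%:E =
   \int[P]_w (vol_pow k (sigma 0%N w))%:E * trunc_moment P (Z 0%N) k b)%E.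
Proof.
have := expectation_mul_families msigma mnoise sigmaZ (gen_vol k t) (gen_trunc k b t)
  (vol0 k t) (trunc0 k b t).
by move=> ->; rewrite vol_integral trunc_integral.
Qed.

(** The two noises are independent of each other and of the volatilities; the
    product of the two dependent volatilities is bounded by the mean of their
    squares, whose expectations agree by stationarity. *)
Lemma entry_pair_moment_le k b s t : s != t ->
  (\int[P]_w ((vol_pow k (sigma s w) * vol_pow k (sigma t w)) *
              (trunc_pow k b (Z s w) * trunc_pow k b (Z t w)))%:E <=
   \int[P]_w (vol_pow (2 * k) (sigma 0%N w))%:E *
   (trunc_moment P (Z 0%N) k b * trunc_moment P (Z 0%N) k b))%E.
Proof.
move=> st.
have := expectation_mul_families msigma mnoise sigmaZ
  (measurable_funM (gen_vol k s) (gen_vol k t))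
  (measurable_funM (gen_trunc k b s) (gen_trunc k b t))
  (fun w => mulr_ge0 (vol0 k s w) (vol0 k t w))
  (fun w => mulr_ge0 (trunc0 k b s w) (trunc0 k b t w)).
move=> ->.
have mv j : measurable_fun setT (fun w => vol_pow (2 * k) (sigma j w)).
  exact: (measurableT_comp (measurable_vol_pow _)).
have -> : (\int[P]_w (trunc_pow k b (Z s w) * trunc_pow k b (Z t w))%:E =
    trunc_moment P (Z 0%N) k b * trunc_moment P (Z 0%N) k b)%E.
  have := @expectation_prod _ _ _ P _ _ (fun j (_ : unit) => Z j : T -> R)
    (fun j w => trunc_pow k b (Z j w)) [:: s; t] (fun j _ => mnoise j) Z_iid.1.
  rewrite big_cons big_seq1 !trunc_integral => <-//.
  - by apply: eq_integral => w _; rewrite big_cons big_seq1.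
  - move=> j; apply: (measurableT_comp (measurable_trunc_pow k b)).
    exact: (measurable_gen_space (X := fun _ : unit => Z j : T -> R) tt).
  - by rewrite /= inE st.
apply: lee_wpmul2r.
  by apply: mule_ge0; exact: trunc_moment_ge0.
apply: (@le_trans _ _ (\int[P]_w (2^-1 * vol_pow (2 * k) (sigma s w) +
    2^-1 * vol_pow (2 * k) (sigma t w))%:E)%E).
  apply: le_integral_real => w; first by rewrite mulr_ge0 ?powR_ge0.
  rewrite -!vol_pow_sqr /=.
  by have := sqr_ge0 (vol_pow k (sigma s w) - vol_pow k (sigma t w)); lra.
rewrite integral_realD//; last 4 first.
- by apply: measurable_funM => //; exact: measurable_cst.
- by apply: measurable_funM => //; exact: measurable_cst.
- by move=> w; rewrite mulr_ge0 ?powR_ge0.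
- by move=> w; rewrite mulr_ge0 ?powR_ge0.
have vE j : (\int[P]_w (2^-1 * vol_pow (2 * k) (sigma j w))%:E =
    2^-1%:E * \int[P]_w (vol_pow (2 * k) (sigma 0%N w))%:E)%E.
  have c0 : 0 <= 2^-1 :> R by rewrite invr_ge0.
  by rewrite (integral_realZ P (mv j) (vol0 _ j) c0) (vol_integral _ j).
rewrite !vE -ge0_muleDl ?lee_fin//.
by rewrite -EFinD (_ : 2^-1 + 2^-1 = 1 :> R) ?mul1e//; lra.
Qed.

End StochasticVolatility.

Section EntryMoments.
Context {R : realType} d (T : measurableType d) (P : probability T R)
  (Z sigma : nat -> {RV P >-> R}).
Hypothesis Z_iid : iid P Z.
Hypothesis sigma_ge0 : forall t w, 0 <= sigma t w.
Hypothesis sigma_stat : stationary P sigma.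
Hypothesis sigmaZ : independent_pair P sigma Z.
Context (alpha : R) (a : nat -> R) (N : nat -> nat).
Hypothesis alpha0 : 0 < alpha.
Hypothesis tail_a : forall x : R, 0 < x ->
  n%:R * tail P (Z 0%N) (a n * x) @[n --> \oo] --> x `^ (- alpha).
Hypothesis N_oo : N @ \oo --> \oo.
Context (k : R).
Hypotheses (alphak : alpha < k) (k2 : k <= 2).
Hypothesis moment_sigma : (\int[P]_w (vol_pow (2 * k) (sigma 0%N w))%:E < +oo)%E.

Local Notation b n := (a (N n)).
Let X t w := sigma t w * Z t w.
Let m K n t w := trunc_entry K (b n) (X t w).
Let D := fine (\int[P]_w (vol_pow (2 * k) (sigma 0%N w))%:E)%E.
Let mZ0 : measurable_fun setT (Z 0%N) := measurable_funP (Z 0%N).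
Let k0 : 0 < k. Proof. exact: lt_trans alphak. Qed.
Let k01 : 0 <= k / 2 <= 1.
Proof. by rewrite ler_pdivrMr// mul1r k2 divr_ge0// ltW. Qed.
Let k2E : 2 * (k / 2) = k. Proof. by rewrite mulrC divfK. Qed.
Let b_gt0 : \forall n \near \oo, 0 < b n.
Proof. exact: (N_oo (norming_gt0 mZ0 alpha0 tail_a)). Qed.
Let mX t : measurable_fun setT (X t). Proof. exact: measurable_funM. Qed.

Let DE : (\int[P]_w (vol_pow (2 * k) (sigma 0%N w))%:E)%E = D%:E.
Proof.
by rewrite fineK// ge0_fin_numE// integral_ge0// => w _; rewrite lee_fin powR_ge0.
Qed.

Let D0 : 0 <= D.
Proof. by rewrite fine_ge0// integral_ge0// => w _; rewrite lee_fin powR_ge0. Qed.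

Let Dk : (\int[P]_w (vol_pow k (sigma 0%N w))%:E <= D%:E)%E.
Proof.
rewrite -DE; apply: le_integral_real => w; first exact: powR_ge0.
by rewrite /vol_pow ler_powR ?le_max ?lexx ?orbT//; have := k0; lra.
Qed.

Let mvol j q : measurable_fun setT (fun w => vol_pow q (sigma j w)).
Proof. exact: (measurableT_comp (measurable_vol_pow q)). Qed.

Let mtrunc j q c : measurable_fun setT (fun w => trunc_pow q c (Z j w)).
Proof. exact: (measurableT_comp (measurable_trunc_pow q c)). Qed.

Lemma trunc_sqr_moment K : 1 <= K -> exists2 C : R, 0 < C &
  \forall n \near \oo, forall t,
    (\int[P]_w (m K n t w ^+ 2)%:E <= (C / (N n)%:R)%:E)%E.
Proof.
move=> K1; have [C C0 HC] := trunc_moment_norming mZ0 alpha0 tail_a alphak.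
exists (K ^+ 2 * ((D + 1) * C)).
  by rewrite !mulr_gt0// ?exprn_gt0 ?(lt_le_trans _ K1)// ltr_wpDl.
near=> n => t.
have bn : 0 < b n by near: n; exact: b_gt0.
apply: (@le_trans _ _ (\int[P]_w (K ^+ 2 * (vol_pow k (sigma t w) * trunc_pow k (b n) (Z t w)))%:E)%E).
  apply: le_integral_real => w; first exact: sqr_ge0.
  by have := trunc_entry_sqr_le (Z t w) K1 bn (sigma_ge0 t w) k01; rewrite k2E.
have c0 : 0 <= K ^+ 2 by exact: sqr_ge0.
rewrite (integral_realZ P (measurable_funM (mvol t k) (mtrunc t k (b n)))
  (fun w => mulr_ge0 (powR_ge0 _ _) (powR_ge0 _ _)) c0).
rewrite (entry_moment Z_iid sigma_stat sigmaZ) -(mulrA (K ^+ 2)) -(mulrA (D + 1)) [leRHS]EFinM.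
rewrite lee_wpmul2l ?lee_fin// EFinM.
apply: lee_pmul => //.
- by apply: integral_ge0 => w _; rewrite lee_fin powR_ge0.
- exact: trunc_moment_ge0.
- by apply: (le_trans Dk); rewrite lee_fin lerDl.
- by near: n; exact: (N_oo HC).
Unshelve. all: by end_near. Qed.

Lemma trunc_sqr_pair_moment K : 1 <= K -> exists2 C : R, 0 < C &
  \forall n \near \oo, forall s t, s != t ->
    (\int[P]_w (m K n s w ^+ 2 * m K n t w ^+ 2)%:E <= (C / (N n)%:R ^+ 2)%:E)%E.
Proof.
move=> K1; have [C C0 HC] := trunc_moment_norming mZ0 alpha0 tail_a alphak.
exists (K ^+ 4 * ((D + 1) * C ^+ 2)).
  by rewrite !mulr_gt0// ?exprn_gt0 ?(lt_le_trans _ K1)// ltr_wpDl.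
near=> n => s t st.
have bn : 0 < b n by near: n; exact: b_gt0.
have Hn : (trunc_moment P (Z 0%N) k (b n) <= (C / (N n)%:R)%:E)%E.
  by near: n; exact: (N_oo HC).
apply: (@le_trans _ _ (\int[P]_w (K ^+ 4 *
    ((vol_pow k (sigma s w) * vol_pow k (sigma t w)) *
     (trunc_pow k (b n) (Z s w) * trunc_pow k (b n) (Z t w))))%:E)%E).
  apply: le_integral_real => w; first by rewrite mulr_ge0// sqr_ge0.
  have Hs := trunc_entry_sqr_le (Z s w) K1 bn (sigma_ge0 s w) k01.
  have Ht := trunc_entry_sqr_le (Z t w) K1 bn (sigma_ge0 t w) k01.
  rewrite !k2E in Hs Ht.
  apply: (le_trans (ler_pM (sqr_ge0 _) (sqr_ge0 _) Hs Ht)).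
  by rewrite le_eqVlt; apply/orP; left; apply/eqP; ring.
have c0 : 0 <= K ^+ 4 by rewrite -[4%N]/(2 * 2)%N exprM sqr_ge0.
rewrite (integral_realZ P (measurable_funM (measurable_funM (mvol s k) (mvol t k))
   (measurable_funM (mtrunc s k (b n)) (mtrunc t k (b n))))
  (fun w => mulr_ge0 (mulr_ge0 (powR_ge0 _ _) (powR_ge0 _ _))
    (mulr_ge0 (powR_ge0 _ _) (powR_ge0 _ _))) c0).
rewrite -(mulrA (K ^+ 4)) [leRHS]EFinM lee_wpmul2l ?lee_fin//.
apply: (le_trans (entry_pair_moment_le Z_iid sigma_stat sigmaZ k (b n) st)).
rewrite DE -(mulrA (D + 1)) -expr_div_n [leRHS]EFinM.
apply: lee_pmul => //.
- by apply: mule_ge0; exact: trunc_moment_ge0.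
- by rewrite lee_fin lerDl.
- by rewrite expr2 EFinM; apply: lee_pmul => //; exact: trunc_moment_ge0.
Unshelve. all: by end_near. Qed.

(** The o(1/N) comes from the noise: each factor contributes E min(|Z|/b, 1)^(k/2),
    which is o(N^(-1/2)).  Without it the off-diagonal squares would only be
    bounded. *)
Lemma trunc_pair_moment K : 1 <= K -> forall e : R, 0 < e ->
  \forall n \near \oo, forall s t, s != t ->
    (\int[P]_w (m K n s w * m K n t w)%:E <= (e / (N n)%:R)%:E)%E.
Proof.
move=> K1 e e0; have K0 : 0 < K by exact: lt_le_trans K1.
pose e' := Num.sqrt (e / (K ^+ 2 * (D + 1))).
have D1 : 0 < D + 1 by rewrite ltr_wpDl.
have K2 : 0 < K ^+ 2 by rewrite exprn_gt0.
have e'0 : 0 < e' by rewrite sqrtr_gt0 divr_gt0// mulr_gt0.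
have He := trunc_moment_half mZ0 alpha0 tail_a alphak e'0.
near=> n => s t st.
have bn : 0 < b n by near: n; exact: b_gt0.
have Hn : (trunc_moment P (Z 0%N) (k / 2) (b n) <= (e' / Num.sqrt (N n)%:R)%:E)%E.
  by near: n; exact: (N_oo He).
apply: (@le_trans _ _ (\int[P]_w (K ^+ 2 *
    ((vol_pow (k / 2) (sigma s w) * vol_pow (k / 2) (sigma t w)) *
     (trunc_pow (k / 2) (b n) (Z s w) * trunc_pow (k / 2) (b n) (Z t w))))%:E)%E).
  apply: le_integral_real => w.
    by apply: mulr_ge0; apply: trunc_entry_ge0 => //; exact: ltW.
  have Hs := trunc_entry_le (Z s w) K1 bn (sigma_ge0 s w) k01.
  have Ht := trunc_entry_le (Z t w) K1 bn (sigma_ge0 t w) k01.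
  have m0 j : 0 <= m K n j w by apply: trunc_entry_ge0 => //; exact: ltW.
  apply: (le_trans (ler_pM (m0 s) (m0 t) Hs Ht)).
  by rewrite le_eqVlt; apply/orP; left; apply/eqP; ring.
rewrite (integral_realZ P (measurable_funM (measurable_funM (mvol s _) (mvol t _))
   (measurable_funM (mtrunc s _ (b n)) (mtrunc t _ (b n))))
  (fun w => mulr_ge0 (mulr_ge0 (powR_ge0 _ _) (powR_ge0 _ _))
    (mulr_ge0 (powR_ge0 _ _) (powR_ge0 _ _))) (ltW K2)).
have eE : e / (N n)%:R = K ^+ 2 * ((D + 1) * (e' / Num.sqrt (N n)%:R) ^+ 2).
  rewrite expr_div_n !sqr_sqrtr ?ler0n//.
    by rewrite mulrA mulrA [_ * (e / _)]mulrC divfK// gt_eqF// mulr_gt0.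
  by rewrite divr_ge0 ?ltW// mulr_gt0.
rewrite eE [leRHS]EFinM lee_wpmul2l ?lee_fin ?(ltW K2)//.
apply: (le_trans (entry_pair_moment_le Z_iid sigma_stat sigmaZ _ (b n) st)).
rewrite k2E [leRHS]EFinM; apply: lee_pmul => //.
- by apply: integral_ge0 => w _; rewrite lee_fin powR_ge0.
- by apply: mule_ge0; exact: trunc_moment_ge0.
- by apply: (le_trans Dk); rewrite lee_fin lerDl.
- by rewrite expr2 EFinM; apply: lee_pmul => //; exact: trunc_moment_ge0.
Unshelve. all: by end_near. Qed.

End EntryMoments.

(** * Expectations over a matrix with independent rows *)

Lemma measurable_sum_if {R : realType} d (T : measurableType d)
    (I : Type) (s : seq I) (C : pred I) (F : I -> T -> R) :
  (forall i, measurable_fun setT (F i)) ->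
  measurable_fun setT (fun w => \sum_(i <- s | C i) F i w).
Proof.
move=> mF; apply: (eq_measurable_fun (fun w => \sum_(i <- s) if C i then F i w else 0)).
  by move=> w _; rewrite [RHS]big_mkcond.
by apply: measurable_sum => i; case: (C i).
Qed.

Lemma integral_sum_le {R : realType} d (T : measurableType d) (P : probability T R)
    (I : Type) (s : seq I) (C : pred I) (F : I -> T -> R) (c : I -> R) :
  (forall i, measurable_fun setT (F i)) -> (forall i w, 0 <= F i w) ->
  (forall i, C i -> (\int[P]_w (F i w)%:E <= (c i)%:E)%E) ->
  (\int[P]_w (\sum_(i <- s | C i) F i w)%:E <= (\sum_(i <- s | C i) c i)%:E)%E.
Proof.
move=> mF F0 Fc.
pose G i w := if C i then F i w else 0.
rewrite (eq_integral (fun w => (\sum_(i <- s) G i w)%:E)); last first.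
  by move=> w _; rewrite big_mkcond.
rewrite integral_real_sum.
- rewrite [in leRHS]big_mkcond -sumEFin; apply: lee_sum => i _.
  by rewrite /G; case: ifPn => [/Fc //|_]; rewrite integral0.
- by move=> i; rewrite /G; case: (C i).
- by move=> i w; rewrite /G; case: ifP.
Qed.

Section RowIndependentMatrix.
Context {R : realType} d (T : measurableType d) (P : probability T R)
  (X0 : nat -> T -> R) (mX0 : forall t, measurable_fun setT (X0 t)).
Context d' (T' : measurableType d') (Q : probability T' R) (p n : nat)
  (X : 'I_p -> 'I_n -> {RV Q >-> R}).
Hypothesis Xind : independent_families Q (fun i t => X i t).
Hypothesis Xlaw : forall i : 'I_p,
  eq_law Q P (fun w => [tuple X i t w | t < n]) (window X0 1 n).

Lemma row_integral i (F : n.-tuple R -> R) : measurable_fun setT F ->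
  (forall u, 0 <= F u) ->
  (\int[Q]_w (F [tuple X i t w | t < n])%:E = \int[P]_w (F (window X0 1 n w))%:E)%E.
Proof.
move=> mF F0; apply: (eq_law_integral (F := fun u => (F u)%:E) (Xlaw i)).
- apply/measurable_fun_tnthP => t.
  apply: (eq_measurable_fun (X i t)) => [w _|]; last exact: measurable_funP.
  by rewrite /= tnth_mktuple.
- apply/measurable_fun_tnthP => t.
  apply: (eq_measurable_fun (X0 (1 + t)%N)) => [w _|]; last exact: mX0.
  by rewrite /= tnth_mktuple.
- exact/measurable_EFinP.
- by move=> u; rewrite lee_fin.
Qed.

Lemma rows_expectation_prod (F : n.-tuple R -> R) (s : seq 'I_p) :
  measurable_fun setT F -> (forall u, 0 <= F u) -> uniq s ->
  (\int[Q]_w (\prod_(i <- s) F [tuple X i t w | t < n])%:E =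
   \prod_(i <- s) \int[P]_w (F (window X0 1 n w))%:E)%E.
Proof.
move=> mF F0 us.
have := @expectation_prod _ _ _ Q _ _ (fun i t => X i t : T' -> R)
  (fun i w => F [tuple X i t w | t < n]) s (fun i t => measurable_funP (X i t)) Xind.
move=> -> //; first by apply: eq_bigr => i _; exact: row_integral.
move=> i; apply: (measurableT_comp mF); apply/measurable_fun_tnthP => t.
apply: (eq_measurable_fun (X i t : gen_space (fun t => X i t : T' -> R) -> R)) => [w _|].
  by rewrite /= tnth_mktuple.
exact: (measurable_gen_space (X := fun t => X i t : T' -> R)).
Qed.

Lemma measurable_tnth_comp (f : R -> R) (t : 'I_n) : measurable_fun setT f ->
  measurable_fun setT (fun u : n.-tuple R => f (tnth u t)).
Proof. by move=> mf; apply: (measurableT_comp mf); exact: measurable_tnth. Qed.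

Context (f : R -> R) (mf : measurable_fun setT f) (f0 : forall x, 0 <= f x).
Let m i t w := f (X i t w).
Let mm i t : measurable_fun setT (m i t).
Proof. exact: measurableT_comp. Qed.
Let m0 i t w : 0 <= m i t w. Proof. exact: f0. Qed.
Context (q1 q2 q3 : R).
Hypothesis q30 : 0 <= q3.
Hypothesis sqr_le : forall t, (\int[P]_w (f (X0 t w) ^+ 2)%:E <= q1%:E)%E.
Hypothesis pair_le : forall s t, s != t ->
  (\int[P]_w (f (X0 s w) * f (X0 t w))%:E <= q2%:E)%E.
Hypothesis sqr_pair_le : forall s t, s != t ->
  (\int[P]_w (f (X0 s w) ^+ 2 * f (X0 t w) ^+ 2)%:E <= q3%:E)%E.

Lemma matrix_sqr_sum_le :
  (\int[Q]_w (\sum_i \sum_t m i t w ^+ 2)%:E <= (p%:R * (n%:R * q1))%:E)%E.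
Proof.
have msq i t : measurable_fun setT (fun w => m i t w ^+ 2) by exact: measurable_funX.
apply: (@le_trans _ _ (\sum_(i < p) \sum_(t < n) q1)%:E); last first.
  by rewrite !sumr_const !card_ord !mulr_natl.
apply: integral_sum_le => [i|i w|i _]; first exact: measurable_sum.
  by apply: sumr_ge0 => t _; exact: sqr_ge0.
apply: integral_sum_le => [t //|t w|t _]; first exact: sqr_ge0.
have mF : measurable_fun setT (fun u : n.-tuple R => f (tnth u t) ^+ 2).
  by apply: measurable_funX; exact: measurable_tnth_comp.
have := row_integral i mF (fun u => sqr_ge0 _).
under eq_integral do rewrite tnth_mktuple.
under [in RHS]eq_integral do rewrite tnth_mktuple.
by rewrite /m => ->; exact: sqr_le.
Qed.

Lemma matrix_entry_cross_le :
  (\int[Q]_w (entry_cross (fun i t => m i t w))%:E <=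
   (p%:R * (n%:R * (n%:R * q3)))%:E)%E.
Proof.
have mp i s t : measurable_fun setT (fun w => m i s w ^+ 2 * m i t w ^+ 2).
  by apply: measurable_funM; exact: measurable_funX.
have mp0 i s t w : 0 <= m i s w ^+ 2 * m i t w ^+ 2 by rewrite mulr_ge0// sqr_ge0.
apply: (@le_trans _ _ (\sum_(i < p) \sum_(t < n) \sum_(s < n | s != t) q3)%:E); last first.
  apply: (@le_trans _ _ (\sum_(i < p) \sum_(t < n) \sum_(s < n) q3)%:E); last first.
    by rewrite !sumr_const !card_ord !mulr_natl.
  rewrite lee_fin; apply: ler_sum => i _; apply: ler_sum => t _.
  by rewrite [leLHS]big_mkcond; apply: ler_sum => s _; case: ifP.
have ms i t : measurable_fun setT (fun w => \sum_(s < n | s != t) m i s w ^+ 2 * m i t w ^+ 2).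
  by apply: measurable_sum_if.
have ms0 i t w : 0 <= \sum_(s < n | s != t) m i s w ^+ 2 * m i t w ^+ 2.
  by apply: sumr_ge0 => s _; exact: mp0.
apply: integral_sum_le => [i|i w|i _]; first exact: measurable_sum.
  by apply: sumr_ge0 => t _; exact: ms0.
apply: integral_sum_le => [t|t w|t _]; [exact: ms|exact: ms0|].
apply: integral_sum_le => [s|s w|s st]; [exact: mp|exact: mp0|].
have mF : measurable_fun setT (fun u : n.-tuple R => f (tnth u s) ^+ 2 * f (tnth u t) ^+ 2).
  by apply: measurable_funM; apply: measurable_funX; exact: measurable_tnth_comp.
have := row_integral i mF (fun u => mulr_ge0 (sqr_ge0 _) (sqr_ge0 _)).
under eq_integral do rewrite !tnth_mktuple.
under [in RHS]eq_integral do rewrite !tnth_mktuple.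
by rewrite /m => ->; apply: sqr_pair_le.
Qed.

(** For i <> j the square expands into the terms (m_it m_is) (m_jt m_js), whose
    two factors are independent with the same law; the n terms s = t give q1^2
    and the others q2^2. *)
Lemma matrix_row_cross_le :
  (\int[Q]_w (row_cross (fun i t => m i t w))%:E <=
   (p%:R * (p%:R * (n%:R * q1 ^+ 2 + n%:R * (n%:R * q2 ^+ 2))))%:E)%E.
Proof.
pose c (s t : 'I_n) := (if s == t then q1 ^+ 2 else 0) + q2 ^+ 2.
have c0 s t : 0 <= c s t by rewrite addr_ge0 ?sqr_ge0//; case: ifP => // _; exact: sqr_ge0.
have cE : \sum_(t < n) \sum_(s < n) c s t = n%:R * q1 ^+ 2 + n%:R * (n%:R * q2 ^+ 2).
  under eq_bigr do rewrite big_split/= -big_mkcond/= big_pred1_eq sumr_const card_ord.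
  by rewrite sumr_const card_ord mulrnDl !mulr_natl.
have mp i j s t : measurable_fun setT (fun w => (m i t w * m i s w) * (m j t w * m j s w)).
  by apply: measurable_funM; exact: measurable_funM.
have mp0 i j s t w : 0 <= (m i t w * m i s w) * (m j t w * m j s w).
  by rewrite !mulr_ge0.
have sqE i j w : (\sum_t m i t w * m j t w) ^+ 2 =
    \sum_t \sum_s (m i t w * m i s w) * (m j t w * m j s w).
  rewrite expr2 mulr_suml; apply: eq_bigr => t _.
  by rewrite mulr_sumr; apply: eq_bigr => s _; ring.
have msq i j : measurable_fun setT (fun w => (\sum_t m i t w * m j t w) ^+ 2).
  by apply: measurable_funX; apply: measurable_sum => t; exact: measurable_funM.
have mrow i : measurable_fun setT
    (fun w => \sum_(j < p | j != i) (\sum_t m i t w * m j t w) ^+ 2).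
  by apply: measurable_sum_if.
apply: (@le_trans _ _ (\sum_(i < p) \sum_(j < p | j != i) \sum_(t < n) \sum_(s < n) c s t)%:E);
    last first.
  apply: (@le_trans _ _ (\sum_(i < p) \sum_(j < p) \sum_(t < n) \sum_(s < n) c s t)%:E);
      last first.
    by rewrite cE !sumr_const !card_ord !mulr_natl.
  rewrite lee_fin; apply: ler_sum => i _; rewrite [leLHS]big_mkcond.
  apply: ler_sum => j _; case: ifP => // _.
  by apply: sumr_ge0 => t _; apply: sumr_ge0.
apply: integral_sum_le => [i //|i w|i _].
  by apply: sumr_ge0 => j _; exact: sqr_ge0.
apply: integral_sum_le => [j //|j w|j ji]; first exact: sqr_ge0.
under eq_integral do rewrite sqE.
apply: integral_sum_le => [t|t w|t _]; first exact: measurable_sum.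
  by apply: sumr_ge0.
apply: integral_sum_le => [s //|s w //|s _].
pose F (u : n.-tuple R) := f (tnth u t) * f (tnth u s).
have mF : measurable_fun setT F.
  by apply: measurable_funM; exact: measurable_tnth_comp.
have us : uniq [:: i; j] by rewrite /= inE eq_sym ji.
have := rows_expectation_prod mF (fun u => mulr_ge0 (f0 _) (f0 _)) us.
under eq_integral do rewrite big_cons big_seq1 /F !tnth_mktuple.
rewrite big_cons big_seq1 => ->.
under eq_integral do rewrite /F !tnth_mktuple.
have b0 : (0 <= \int[P]_w (f (X0 (1 + t)%N w) * f (X0 (1 + s)%N w))%:E)%E.
  by apply: integral_ge0 => w _; rewrite lee_fin mulr_ge0.
have [->|st] := eqVneq s t.
  apply: (@le_trans _ _ (q1%:E * q1%:E)%E); last first.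
    by rewrite -EFinM lee_fin /c eqxx -expr2 lerDl sqr_ge0.
  have H := sqr_le (1 + t); rewrite /= in H.
  by apply: lee_pmul => //; first [apply: integral_ge0 => w _; rewrite lee_fin mulr_ge0|exact: H].
apply: (@le_trans _ _ (q2%:E * q2%:E)%E); last first.
  by rewrite -EFinM lee_fin /c (negbTE st) add0r -expr2.
have ts : (1 + t)%N != (1 + s)%N by rewrite eqn_add2l eq_sym.
by apply: lee_pmul => //; exact: pair_le.
Qed.

Lemma matrix_exceed_le (b q : R) :
  (forall t, (P [set w | (b < `|X0 t w|)%R] <= q%:E)%E) ->
  (\int[Q]_w (\1_[set w | exists i t, (b < `|X i t w|)%R] w)%:E <=
   (p%:R * (n%:R * q))%:E)%E.
Proof.
move=> Hb.
have mS i t : measurable [set w | b < `|X i t w|].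
  exact: measurable_tail.
have mI i t : measurable_fun setT (\1_[set w | (b < `|X i t w|)%R] : T' -> R).
  exact: measurable_indic.
have I0 i t w : 0 <= (\1_[set w | (b < `|X i t w|)%R] w : R) by rewrite indicE.
apply: (@le_trans _ _ (\int[Q]_w (\sum_i \sum_t \1_[set w | (b < `|X i t w|)%R] w)%:E)%E).
  apply: le_integral_real => w; first by rewrite indicE.
  have [[i [t H]]|nex] := pselect (exists i t, b < `|X i t w|); last first.
    by rewrite indicE memNset//; apply: sumr_ge0 => i _; apply: sumr_ge0.
  rewrite [leLHS]indicE mem_set; last by exists i, t.
  rewrite (bigD1 i)//= (bigD1 t)//= indicE mem_set// -addrA lerDl.
  by rewrite addr_ge0// sumr_ge0// => j _; apply: sumr_ge0.
apply: (@le_trans _ _ (\sum_(i < p) \sum_(t < n) q)%:E); last first.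
  by rewrite !sumr_const !card_ord !mulr_natl.
apply: integral_sum_le => [i|i w|i _]; [exact: measurable_sum|exact: sumr_ge0|].
apply: integral_sum_le => [t //|t w //|t _].
pose F (u : n.-tuple R) : R := \1_[set x : R | b < `|x|] (tnth u t).
have mb : measurable [set x : R | b < `|x|] by exact: (measurable_tail (Z := fun x : R => x)).
have mF : measurable_fun setT F.
  by apply: measurable_tnth_comp; exact: measurable_indic.
have F0 u : 0 <= F u by rewrite /F indicE.
have := row_integral i mF F0.
rewrite (eq_integral (fun w => (\1_[set w | (b < `|X i t w|)%R] w)%:E)); last first.
  by move=> w _; rewrite /F tnth_mktuple.
move=> ->.
rewrite (eq_integral (fun w => (\1_[set w | (b < `|X0 (1 + t)%N w|)%R] w)%:E)); last first.
  by move=> w _; rewrite /F tnth_mktuple.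
by rewrite integral_real_indic//; exact: measurable_tail.
Qed.

End RowIndependentMatrix.

(** * The Laplace functional of one row *)

(** The first two Bonferroni inequalities, for factors in place of events. *)
Lemma prod_one_sub_bounds {R : realType} (v : nat -> R) n :
  (forall t, 0 <= v t <= 1) ->
  \sum_(t < n) v t - \sum_(t < n) \sum_(s < t) v s * v t <=
    1 - \prod_(t < n) (1 - v t) <= \sum_(t < n) v t.
Proof.
move=> v01; elim: n => [|n /andP[IH1 IH2]]; first by rewrite !big_ord0 !subrr lexx.
rewrite !big_ord_recr/=; case/andP: (v01 n) => v0 v1.
have /andP[prod0 prod1] : 0 <= \prod_(t < n) (1 - v t) <= 1.
  apply: (big_ind (fun x => 0 <= x <= 1)) => [|x y /andP[x0 x1] /andP[y0 y1]|t _].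
  - by rewrite ler01 lexx.
  - by rewrite mulr_ge0// mulr_ile1.
  - by case/andP: (v01 t) => *; rewrite subr_ge0 gerBl; apply/andP.
rewrite -mulr_suml; set A := \prod_(t < n) _ in prod0 prod1 IH1 IH2 *.
set S := \sum_(t < n) v t in IH1 IH2 *; set B := \sum_(t < n) _ in IH1 *.
have H1 : (1 - A) * v n <= S * v n by rewrite ler_wpM2r.
have H2 : A * v n <= v n by rewrite ler_piMl.
by apply/andP; split; lra.
Qed.

(** Squeezed by exp(- u / (1 - u)) <= 1 - u <= exp(- u). *)
Lemma expr_one_sub_cvg {R : realType} (u : nat -> R) (p : nat -> nat) (J : R) :
  (forall n, 0 <= u n <= 1) -> p @ \oo --> \oo ->
  (p n)%:R * u n @[n --> \oo] --> J ->
  (1 - u n) ^+ p n @[n --> \oo] --> expR (- J).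
Proof.
move=> u01 poo puJ.
have pV : (p n)%:R^-1 @[n --> \oo] --> (0 : R).
  have p_gt0 : \forall n \near \oo, 0 < (p n)%:R :> R.
    by near=> n; rewrite ltr0n; near: n; exact: (poo _ (nbhs_infty_gt 0)).
  by apply/(gtr0_cvgV0 p_gt0); apply: (cvg_comp _ _ poo); exact: cvgr_idn.
have u0 : u n @[n --> \oo] --> (0 : R).
  have : (p n)%:R * u n * (p n)%:R^-1 @[n --> \oo] --> J * 0 by exact: cvgM.
  rewrite mulr0; apply: cvg_trans; apply: near_eq_cvg; near=> n.
  rewrite /= mulrAC mulfV ?mul1r// pnatr_eq0 -lt0n; near: n; exact: (poo _ (nbhs_infty_gt 0)).
have u1 : 1 - u n @[n --> \oo] --> (1 : R).
  by rewrite -[X in _ --> X]subr0; apply: cvgB => //; exact: cvg_cst.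
have exp_cvg (w : nat -> R) (l : R) : w n @[n --> \oo] --> l ->
    expR (w n) @[n --> \oo] --> expR l.
  by move=> wl; apply: (cvg_comp _ _ wl); exact: continuous_expR.
apply: (@squeeze_cvgr _ _ _ _ (fun n => expR (- ((p n)%:R * u n / (1 - u n))))
  (fun n => expR (- ((p n)%:R * u n)))).
(* the lower bound is 1 / (1 - u) = 1 + u / (1 - u) <= exp(u / (1 - u)) *)
- near=> n; have un1 : u n < 1.
    by near: n; apply: (cvgr_lt _ u0); exact: ltr01.
  have [un0 _] := andP (u01 n).
  have v0 : 0 < 1 - u n by rewrite subr_gt0.
  apply/andP; split.
    rewrite -mulrA -mulrN expRM_natl.
    rewrite lerXn2r ?nnegrE ?expR_ge0 ?(ltW v0)//.
    rewrite expRN -[leRHS]invrK lef_pV2 ?posrE ?invr_gt0 ?expR_gt0//.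
    apply: (le_trans _ (expR_ge1Dx _)).
    by rewrite le_eqVlt; apply/orP; left; apply/eqP; field; rewrite gt_eqF.
  rewrite -mulrN expRM_natl lerXn2r ?nnegrE ?expR_ge0 ?(ltW v0)//.
  exact: expR_ge1Dx.
- apply: exp_cvg; apply: cvgN; rewrite -[J in _ --> J]divr1.
  by apply: cvgM => //; apply: cvgV => //; exact: oner_neq0.
- by apply: exp_cvg; exact: cvgN.
Unshelve. all: by end_near. Qed.

Lemma mul_cvg_infty (p : nat -> nat) : p @ \oo --> \oo ->
  (fun n => (n * p n)%N) @ \oo --> \oo.
Proof.
move=> p_oo; apply/cvgnyPge => A; near=> n.
have n_A : (A <= n)%N by near: n; exact: nbhs_infty_ge.
have p1 : (0 < p n)%N by near: n; exact: (p_oo _ (nbhs_infty_gt 0)).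
exact: leq_trans n_A (leq_pmulr _ p1).
Unshelve. all: by end_near. Qed.

Section RowLaplace.
Context {R : realType} d (T : measurableType d) (P : probability T R)
  (Z sigma : nat -> {RV P >-> R}).
Hypothesis Z_iid : iid P Z.
Hypothesis sigma_ge0 : forall t w, 0 <= sigma t w.
Hypothesis sigma_stat : stationary P sigma.
Hypothesis sigmaZ : independent_pair P sigma Z.
Context (alpha : R) (a : nat -> R) (p : nat -> nat).
Hypothesis alpha0 : 0 < alpha.
Hypothesis tail_a : forall x : R, 0 < x ->
  n%:R * tail P (Z 0%N) (a n * x) @[n --> \oo] --> x `^ (- alpha).
Hypothesis p_oo : p @ \oo --> \oo.
Context (k : R).
Hypotheses (alphak : alpha < k) (k2 : k <= 2).
Hypothesis moment_sigma : (\int[P]_w (vol_pow (2 * k) (sigma 0%N w))%:E < +oo)%E.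

Local Notation N n := (n * p n)%N.
Local Notation b n := (a (N n)).
Local Notation mu := (@lebesgue_measure R).
Let X t w := sigma t w * Z t w.
Let mZ0 : measurable_fun setT (Z 0%N) := measurable_funP (Z 0%N).
Let mX t : measurable_fun setT (X t). Proof. exact: measurable_funM. Qed.

Let N_oo : (fun n => N n) @ \oo --> \oo := mul_cvg_infty p_oo.

Let b_gt0 : \forall n \near \oo, 0 < b n.
Proof. exact: (N_oo (norming_gt0 mZ0 alpha0 tail_a)). Qed.

Let tail_b x : 0 < x ->
  (N n)%:R * tail P (Z 0%N) (b n * x) @[n --> \oo] --> x `^ (- alpha).
Proof. by move=> x0; apply: (cvg_comp _ _ N_oo (tail_a x0)). Qed.

Let Av := fine (\int[P]_w (sigma 0%N w `^ alpha)%:E)%E.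

Lemma entry_tail_cvg x : 0 < x ->
  (N n)%:R * tail P (X 0%N) (b n * x) @[n --> \oo] --> Av * x `^ (- alpha).
Proof.
move=> x0; have [C C0 HC] := trunc_moment_norming mZ0 alpha0 tail_a alphak.
apply: (@breiman _ _ _ P (sigma 0%N) (Z 0%N)) (alpha0) (alphak) (b_gt0) tail_b _ _ _ _ x0 => //.
- exact: sigma_noise_independent.
- by exists C => //; exact: (N_oo HC).
- apply: le_lt_trans moment_sigma; apply: le_integral_real => w; first exact: powR_ge0.
  by rewrite /vol_pow ler_powR ?le_max ?lexx ?orbT//; have := alpha0; have := alphak; lra.
- exact: (N_oo (nbhs_infty_gt 0)).
Qed.

Lemma entry_tail_marginal t y : tail P (X t) y = tail P (X 0%N) y.
Proof.
apply: EFin_inj; rewrite !tailE// -!integral_real_indic; try exact: measurable_tail.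
have mA : measurable [set x : R | y < `|x|] by exact: (measurable_tail (Z := fun x : R => x)).
have := product_integral Z_iid sigma_stat sigmaZ t (F := fun x => (\1_[set x : R | y < `|x|] x)%:E).
apply; first by apply/measurable_EFinP; exact: measurable_indic.
by move=> x; rewrite lee_fin indicE.
Qed.

Context (g : R -> R).
Hypothesis g0 : forall x, 0 <= g x.
Hypothesis gP : compact_support_pos g.

Let v n t w := laplace_weight g ((X t w / b n) ^+ 2).
Let mh : measurable_fun setT (laplace_weight g).
Proof. apply: continuous_measurable_fun; exact: (laplace_weightP gP).1. Qed.
Let mv n t : measurable_fun setT (v n t).
Proof.
apply: (measurableT_comp mh); apply: measurable_funX; apply: measurable_funM => //.
Qed.
Let v01 n t w : 0 <= v n t w <= 1.
Proof. by rewrite laplace_weight_ge0//= /v /laplace_weight gerBl expR_ge0. Qed.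
Let v0 n t w : 0 <= v n t w. Proof. by case/andP: (v01 n t w). Qed.
Let I n := fine (\int[P]_w (v n 0%N w)%:E)%E.

Let IE n t : (\int[P]_w (v n t w)%:E)%E = (I n)%:E.
Proof.
rewrite /I fineK; last exact: expectation01_fin_num.
apply: (product_integral Z_iid sigma_stat sigmaZ t
  (F := fun x => (laplace_weight g ((x / b n) ^+ 2))%:E)).
  apply/measurable_EFinP; apply: (measurableT_comp mh); apply: measurable_funX.
  exact: measurable_funM.
by move=> x; rewrite lee_fin laplace_weight_ge0.
Qed.

Let J := fine (\int[mu]_(x in `]0%R, +oo[)
  (laplace_weight g (Av `^ (2 / alpha) * x `^ (- (2 / alpha))))%:E)%E.

Let NI_cvg : (N n)%:R * I n @[n --> \oo] --> J.
Proof.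
have A0 : 0 <= Av by apply: fine_ge0; apply: integral_ge0 => w _; rewrite lee_fin powR_ge0.
have gam0 : 0 < 2 / alpha by rewrite divr_gt0.
have := @power_tail_integral_cvg _ _ _ P Av (2 / alpha) A0 gam0 (laplace_weight g)
  (laplace_weight_ge0 g0) (laplace_weightP gP) (fun n => N n)
  (fun n w => (X 0%N w / b n) ^+ 2).
apply.
  by move=> n; apply: measurable_funX; exact: measurable_funM.
move=> u u0; have su0 : 0 < Num.sqrt u by rewrite sqrtr_gt0.
have := entry_tail_cvg su0.
have -> : Num.sqrt u `^ (- alpha) = u `^ (- (2 / alpha)^-1).
  by rewrite -[Num.sqrt u](powR12_sqrt (ltW u0)) -powRrM; congr (_ `^ _); rewrite invf_div; field.
apply: cvg_trans; apply: near_eq_cvg; near=> n.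
have bn : 0 < b n by near: n; exact: b_gt0.
have sqr_lt x : (b n * Num.sqrt u < `|x|) = (u < (x / b n) ^+ 2).
  rewrite -[u in RHS](sqr_sqrtr (ltW u0)) -[X in _ = (_ < X)]real_normK ?num_real//.
  by rewrite ltr_sqr ?nnegrE ?sqrtr_ge0// normrM normfV (gtr0_norm bn) ltr_pdivlMr// mulrC.
by congr (_ * fine (P _)); apply/seteqP; split => w /=; rewrite sqr_lt.
Unshelve. all: by end_near. Qed.

Let v_pair : exists2 C : R, 0 < C & \forall n \near \oo, forall s t, s != t ->
  (\int[P]_w (v n s w * v n t w)%:E <= (C / (N n)%:R ^+ 2)%:E)%E.
Proof.
have [_ [delta [M [d0 supp]]]] := laplace_weightP gP.
have [C C0 HC] := trunc_sqr_pair_moment Z_iid sigma_ge0 sigma_stat sigmaZ alpha0 tail_a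
  N_oo alphak k2 moment_sigma (lexx (1 : R)).
(* a nonzero weight means y^2 >= delta, so min(|y|, 1)^2 >= e *)
pose e := Num.min delta 1; have e0 : 0 < e by rewrite lt_min d0 ltr01.
exists (e ^- 2 * C); first by rewrite mulr_gt0// invr_gt0 exprn_gt0.
near=> n => s t st; have bn : 0 < b n by near: n; exact: b_gt0.
have v_le j w : v n j w <= e^-1 * trunc_entry 1 (b n) (X j w) ^+ 2.
  have [->|vN0] := eqVneq (v n j w) 0.
    by rewrite mulr_ge0 ?invr_ge0 ?(ltW e0)// sqr_ge0.
  apply: (@le_trans _ _ 1); first by case/andP: (v01 n j w).
  rewrite mulrC ler_pdivlMr// mul1r /trunc_entry.
  have /andP[dy _] := supp _ vN0.
  have [y1|y1] := leP (`|X j w| / b n) 1; last by rewrite expr1n ge_min lexx orbT.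
  rewrite ge_min; apply/orP; left; apply: (le_trans dy).
  by rewrite -[leLHS]real_normK ?num_real// normrM normfV (gtr0_norm bn).
have e2 : 0 <= e ^- 2 by rewrite invr_ge0 exprn_ge0// ltW.
apply: (@le_trans _ _ (\int[P]_w (e ^- 2 * (trunc_entry 1 (b n) (X s w) ^+ 2 *
   trunc_entry 1 (b n) (X t w) ^+ 2))%:E)%E).
  apply: le_integral_real => w; first exact: mulr_ge0.
  apply: (le_trans (ler_pM (v0 _ _ _) (v0 _ _ _) (v_le s w) (v_le t w))).
  by rewrite le_eqVlt; apply/orP; left; apply/eqP; rewrite expr2 invfM; ring.
have mt j : measurable_fun setT (fun w => trunc_entry 1 (b n) (X j w) ^+ 2).
  by apply: measurable_funX; exact: (measurableT_comp (measurable_trunc_entry _ _)).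
rewrite (integral_realZ P (measurable_funM (mt s) (mt t))
  (fun w => mulr_ge0 (sqr_ge0 _) (sqr_ge0 _)) e2).
rewrite -(mulrA (e ^- 2)) [leRHS]EFinM lee_wpmul2l ?lee_fin//.
by move: s t st; near: n.
Unshelve. all: by end_near. Qed.

Definition row_laplace n := fine (\int[P]_w (\prod_(t < n)
  expR (- g ((X (1 + t)%N w / b n) ^+ 2)))%:E)%E.

(** By the Bonferroni inequalities the defect 1 - row_laplace differs from
    n E(1 - exp(- g(y^2))) by at most n^2 times a pair term O(1/N^2), which is
    O(1/p) after multiplication by p. *)
Lemma row_laplace_cvg : row_laplace n ^+ p n @[n --> \oo] --> expR (- J).
Proof.
pose r n w := \prod_(t < n) expR (- g ((X (1 + t)%N w / b n) ^+ 2)).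
have rE n w : r n w = \prod_(t < n) (1 - v n (1 + t)%N w).
  by apply: eq_bigr => t _; rewrite /v /laplace_weight subKr.
have r01 n w : 0 <= r n w <= 1.
  rewrite /r -expR_sum expR_ge0 -expR0 ler_expR; apply: sumr_le0 => t _.
  by rewrite oppr_le0.
have mr n : measurable_fun setT (r n).
  apply: (eq_measurable_fun (fun w => \prod_(t < n) (1 - v n (1 + t)%N w))) => [w _|].
    by rewrite -rE.
  by apply: measurable_prod => t _; exact: measurable_funB.
pose u n := 1 - row_laplace n.
have uE n : (\int[P]_w (1 - r n w)%:E)%E = (u n)%:E.
  have r1 w : 0 <= 1 - r n w by rewrite subr_ge0; case/andP: (r01 n w).
  have r0 w : 0 <= r n w by case/andP: (r01 n w).
  have m1 : measurable_fun setT (fun w => 1 - r n w) by exact: measurable_funB.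
  have := integral_realD P m1 (mr n) r1 r0.
  under eq_integral do rewrite subrK.
  rewrite integral_real_cst -[X in _ = (_ + X)%E]fineK; last exact: expectation01_fin_num.
  rewrite -/(row_laplace n) => H; rewrite /u EFinB H addeK//.
have u01 n : 0 <= u n <= 1.
  rewrite -!lee_fin -uE integral_ge0/=; last first.
    by move=> w _; rewrite lee_fin subr_ge0; case/andP: (r01 n w).
  rewrite -(integral_real_cst P 1); apply: le_integral_real => w.
    by rewrite subr_ge0; case/andP: (r01 n w).
  by rewrite gerBl; case/andP: (r01 n w).
have sumv n : (\int[P]_w (\sum_(t < n) v n (1 + t)%N w)%:E)%E = (n%:R * I n)%:E.
  rewrite integral_real_sum// (eq_bigr (fun=> (I n)%:E)) => [|t _]; last exact: IE.
  by rewrite sumEFin sumr_const card_ord mulr_natl.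
have bnd n w := @prod_one_sub_bounds R (fun t => v n (1 + t)%N w) n (fun t => v01 n (1 + t)%N w).
have u_le n : u n <= n%:R * I n.
  rewrite -lee_fin -uE -sumv; apply: le_integral_real => w.
    by rewrite subr_ge0; case/andP: (r01 n w).
  by rewrite rE; case/andP: (bnd n w).
have [C C0 HC] := v_pair.
have u_ge : \forall n \near \oo, n%:R * I n <= u n + n%:R * (n%:R * (C / (N n)%:R ^+ 2)).
  near=> n.
  have Hn : forall s t, s != t ->
    (\int[P]_w (v n s w * v n t w)%:E <= (C / (N n)%:R ^+ 2)%:E)%E by near: n.
  set c := C / _ in Hn *.
  have c0 : 0 <= c by rewrite divr_ge0 ?(ltW C0)// exprn_ge0.
  have mc (t : 'I_n) : measurable_fun setT (fun w => \sum_(s < t) v n (1 + s)%N w * v n (1 + t)%N w).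
    by apply: measurable_sum => s; exact: measurable_funM.
  have c0' (t : 'I_n) w : 0 <= \sum_(s < t) v n (1 + s)%N w * v n (1 + t)%N w.
    by apply: sumr_ge0 => s _; exact: mulr_ge0.
  rewrite -lee_fin -sumv EFinD -uE.
  apply: (@le_trans _ _ (\int[P]_w ((1 - r n w) + \sum_(t < n) \sum_(s < t)
     v n (1 + s)%N w * v n (1 + t)%N w)%:E)%E).
    apply: le_integral_real => w; first exact: sumr_ge0.
    by rewrite rE; case/andP: (bnd n w) => H _; rewrite -lerBlDr.
  rewrite integral_realD//; last 4 first.
  - exact: measurable_funB.
  - exact: measurable_sum.
  - by move=> w; rewrite subr_ge0; case/andP: (r01 n w).
  - by move=> w; exact: sumr_ge0.
  apply: leeD2l.
  apply: (@le_trans _ _ (\sum_(t < n) \sum_(s < t) c)%:E).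
    apply: integral_sum_le => // t _; apply: integral_sum_le => [s|s w|s _].
    - exact: measurable_funM.
    - exact: mulr_ge0.
    - by apply: Hn; rewrite eqn_add2l neq_ltn ltn_ord.
  rewrite lee_fin; apply: (@le_trans _ _ (\sum_(t < n) n%:R * c)).
    apply: ler_sum => t _; rewrite sumr_const card_ord -[c *+ _]mulr_natl ler_wpM2r// ler_nat.
    exact: ltnW.
  by rewrite sumr_const card_ord -[_ *+ n]mulr_natl.
have err_cvg : C / (p n)%:R @[n --> \oo] --> (0 : R).
  have p_gt0 : \forall n \near \oo, 0 < (p n)%:R :> R.
    by near=> n; rewrite ltr0n; near: n; exact: (p_oo (nbhs_infty_gt 0)).
  rewrite -(mulr0 C); apply: cvgM; first exact: cvg_cst.
  by apply/(gtr0_cvgV0 p_gt0); apply: (cvg_comp _ _ p_oo); exact: cvgr_idn.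
have -> : (fun n => row_laplace n ^+ p n) = (fun n => (1 - u n) ^+ p n).
  by apply/funext => n; rewrite /u subKr.
apply: expr_one_sub_cvg => //.
apply: (@squeeze_cvgr _ _ _ _ (fun n => (N n)%:R * I n - C / (p n)%:R)
  (fun n => (N n)%:R * I n)).
- near=> n.
  have p1 : 0 < (p n)%:R :> R by rewrite ltr0n; near: n; exact: (p_oo (nbhs_infty_gt 0)).
  have n1 : 0 < n%:R :> R by rewrite ltr0n; near: n; exact: nbhs_infty_gt.
  have ug : n%:R * I n <= u n + n%:R * (n%:R * (C / (N n)%:R ^+ 2)) by near: n.
  rewrite natrM [n%:R * _]mulrC -!mulrA; apply/andP; split; last by rewrite ler_pM2l.
  rewrite lerBlDr.
  have -> : (p n)%:R * u n + C / (p n)%:R =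
      (p n)%:R * (u n + n%:R * (n%:R * (C / (N n)%:R ^+ 2))).
    by rewrite natrM; field; rewrite !gt_eqF.
  by rewrite ler_pM2l.
- by rewrite -[J]subr0; apply: cvgB.
- exact: NI_cvg.
Unshelve. all: by end_near. Qed.

End RowLaplace.

(** * The Laplace functional of the sample spectrum *)

Lemma expR_oppr_lipschitz {R : realType} (x y : R) : 0 <= x -> 0 <= y ->
  `|expR (- x) - expR (- y)| <= `|x - y|.
Proof.
wlog xy : x y / x <= y => [H|] x0 y0.
  by have [|/ltW] := leP x y => xy; [|rewrite distrC [leRHS]distrC]; exact: H.
rewrite [leRHS]distrC !ger0_norm ?subr_ge0 ?ler_expR ?lerN2//.
have -> : expR (- y) = expR (- x) * expR (x - y) by rewrite -expRD; congr expR; ring.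
have e1 : expR (- x) <= 1 by rewrite -expR0 ler_expR oppr_le0.
have e2 := expR_ge1Dx (x - y).
apply: (@le_trans _ _ (expR (- x) * (y - x))).
  by rewrite -[X in X - _]mulr1 -mulrBr ler_wpM2l ?expR_ge0//; lra.
by rewrite ler_piMl// subr_ge0.
Qed.

Section MatrixLaplace.
Context {R : realType} d (T : measurableType d) (P : probability T R)
  (X0 : nat -> T -> R) (mX0 : forall t, measurable_fun setT (X0 t)).
Context d' (T' : measurableType d') (Q : probability T' R) (p n : nat)
  (X : 'I_p -> 'I_n -> {RV Q >-> R}).
Hypothesis Xind : independent_families Q (fun i t => X i t).
Hypothesis Xlaw : forall i : 'I_p,
  eq_law Q P (fun w => [tuple X i t w | t < n]) (window X0 1 n).
Context (l : T' -> nat -> R).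
Hypothesis eigl : forall w,
  let M : 'M[R]_(p, n) := \matrix_(i, t) X i t w in eigenvalues_of (M *m M^T) (l w).
Context (g : R -> R).
Hypothesis g0 : forall x, 0 <= g x.
Hypothesis cg : continuous g.
Context (b K e C : R).
Hypotheses (b0 : 0 < b) (K0 : 0 <= K) (e0 : 0 <= e) (C0 : 0 <= C).
Hypothesis close : forall m k (y : 'I_m -> 'I_k -> R) l, eigenvalues_of (gram_mx y) l ->
  `|\sum_(k < m) g (l k) - \sum_i \sum_t g (y i t ^+ 2)| <=
  e * (\sum_i \sum_t y i t ^+ 2) + C * (row_cross y + entry_cross y).

Let m w i t := trunc_entry K b (X i t w).
Let bad := [set w | exists i t, b * K < `|X i t w|].
Let err w := e * (\sum_i \sum_t m w i t ^+ 2) + C * (row_cross (m w) + entry_cross (m w)).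

Lemma sample_gram_eigenvalues w :
  eigenvalues_of (gram_mx (fun i t => X i t w / b)) (fun k => b ^- 2 * l w k).
Proof.
have bN0 : b ^- 2 != 0 by rewrite invr_eq0 expf_eq0/= gt_eqF.
have := eigenvalues_of_scale bN0 (eigl w); congr eigenvalues_of.
apply/matrixP => i j; rewrite !mxE mulr_sumr; apply: eq_bigr => t _.
by rewrite !mxE expr2 invfM; ring.
Qed.

(** Outside of the event bad the truncation is inactive, so the deterministic
    comparison applies to the truncated entries; on it, 1 is a bound. *)
Lemma sample_laplace_close w :
  `|expR (- \sum_(k < p) g (b ^- 2 * l w k)) -
    \prod_i \prod_t expR (- g ((X i t w / b) ^+ 2))| <= \1_bad w + err w.
Proof.
have S0 : 0 <= \sum_(k < p) g (b ^- 2 * l w k) by exact: sumr_ge0.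
have S0' : 0 <= \sum_i \sum_t g ((X i t w / b) ^+ 2).
  by apply: sumr_ge0 => i _; exact: sumr_ge0.
have r0 : 0 <= row_cross (m w).
  by apply: sumr_ge0 => i _; apply: sumr_ge0 => j _; exact: sqr_ge0.
have c0 : 0 <= entry_cross (m w).
  apply: sumr_ge0 => i _; apply: sumr_ge0 => t _; apply: sumr_ge0 => s _.
  by rewrite mulr_ge0// sqr_ge0.
have s0 : 0 <= \sum_i \sum_t m w i t ^+ 2.
  by apply: sumr_ge0 => i _; apply: sumr_ge0 => t _; exact: sqr_ge0.
have err0 : 0 <= err w by rewrite addr_ge0// mulr_ge0// addr_ge0.
have -> : \prod_i \prod_t expR (- g ((X i t w / b) ^+ 2)) =
    expR (- \sum_i \sum_t g ((X i t w / b) ^+ 2)).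
  by rewrite -sumrN expR_sum; apply: eq_bigr => i _; rewrite -sumrN expR_sum.
have exp1 (x : R) : 0 <= x -> 0 <= expR (- x) <= 1.
  by move=> x0; rewrite expR_ge0 -expR0 ler_expR oppr_le0.
have [Bad|good] := boolP (w \in bad).
  rewrite indicE Bad; apply: (@le_trans _ _ 1); last by rewrite lerDl.
  by rewrite ler_norml; case/andP: (exp1 _ S0); case/andP: (exp1 _ S0'); lra.
rewrite indicE (negbTE good) add0r.
have mE i t : m w i t = `|X i t w / b|.
  have le : `|X i t w| <= b * K.
    by rewrite leNgt; apply/negP => H; case/negP: good; rewrite inE; exists i, t.
  rewrite /m /trunc_entry normrM normfV (gtr0_norm b0) min_l//.
  by rewrite ler_pdivrMr// mulrC.
apply: (le_trans (expR_oppr_lipschitz S0 S0')).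
apply: (le_trans (close (sample_gram_eigenvalues w))).
have sqrE i t : (X i t w / b) ^+ 2 = m w i t ^+ 2.
  by rewrite mE real_normK ?num_real.
apply: lerD.
  rewrite ler_wpM2l//; apply: ler_sum => i _; apply: ler_sum => t _.
  by rewrite sqrE.
rewrite ler_wpM2l//; apply: lerD; last first.
  apply: ler_sum => i _; apply: ler_sum => t _; apply: ler_sum => s _.
  by rewrite !sqrE.
apply: ler_sum => i _; apply: ler_sum => j _.
rewrite -[leLHS]real_normK ?num_real// lerXn2r ?nnegrE//.
  by apply: sumr_ge0 => t _; rewrite !mE mulr_ge0.
by apply: (le_trans (ler_norm_sum _ _ _)); apply: ler_sum => t _; rewrite normrM !mE.
Qed.

Let mm i t : measurable_fun setT (fun w => m w i t).
Proof. exact: (measurableT_comp (measurable_trunc_entry K b)). Qed.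

Lemma matrix_laplace_product :
  (\int[Q]_w (\prod_i \prod_t expR (- g ((X i t w / b) ^+ 2)))%:E =
   (fine (\int[P]_w (\prod_(t < n) expR (- g ((X0 (1 + t)%N w / b) ^+ 2)))%:E)%E ^+ p)%:E)%E.
Proof.
pose F (u : n.-tuple R) := \prod_(t < n) expR (- g ((tnth u t / b) ^+ 2)).
have F01 u : 0 <= F u <= 1.
  by rewrite /F -expR_sum expR_ge0 -expR0 ler_expR sumr_le0// => t _; rewrite oppr_le0.
have mF : measurable_fun setT F.
  apply: measurable_prod => t _.
  apply: (measurable_tnth_comp (f := fun x => expR (- g ((x / b) ^+ 2)))).
  apply: measurableT_comp => //; apply: measurableT_comp => //.
  apply: (measurableT_comp (continuous_measurable_fun cg)).
  by apply: measurable_funX; exact: measurable_funM.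
have F0 u : 0 <= F u by case/andP: (F01 u).
have FE w : F (window X0 1 n w) = \prod_(t < n) expR (- g ((X0 (1 + t)%N w / b) ^+ 2)).
  by apply: eq_bigr => t _; rewrite tnth_mktuple.
have IE : (\int[P]_w (F (window X0 1 n w))%:E)%E =
    (fine (\int[P]_w (\prod_(t < n) expR (- g ((X0 (1 + t)%N w / b) ^+ 2)))%:E)%E)%:E.
  rewrite fineK; last by apply: expectation01_fin_num => w; rewrite -FE.
  by apply: eq_integral => w _; rewrite FE.
transitivity (\int[Q]_w (\prod_(i <- index_enum 'I_p) F [tuple X i t w | t < n])%:E)%E.
  apply: eq_integral => w _; congr EFin; apply: eq_bigr => i _; apply: eq_bigr => t _.
  by rewrite tnth_mktuple.
rewrite (rows_expectation_prod mX0 Xind Xlaw mF F0 (index_enum_uniq 'I_p)).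
by rewrite IE prodEFin prodr_const card_ord.
Qed.

Context (q1 q2 q3 q4 : R).
Hypothesis q30 : 0 <= q3.
Hypothesis sqr_le : forall t, (\int[P]_w (trunc_entry K b (X0 t w) ^+ 2)%:E <= q1%:E)%E.
Hypothesis pair_le : forall s t, s != t ->
  (\int[P]_w (trunc_entry K b (X0 s w) * trunc_entry K b (X0 t w))%:E <= q2%:E)%E.
Hypothesis sqr_pair_le : forall s t, s != t ->
  (\int[P]_w (trunc_entry K b (X0 s w) ^+ 2 * trunc_entry K b (X0 t w) ^+ 2)%:E <= q3%:E)%E.
Hypothesis exceed_le : forall t, (P [set w | (b * K < `|X0 t w|)%R] <= q4%:E)%E.

(** The four terms of the bound come from the event bad, the trace, the
    off-diagonal squares and the cross products of the truncated entries. *)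
Lemma matrix_laplace_close :
  `|fine (\int[Q]_w (expR (- \sum_(k < p) g (b ^- 2 * l w k)))%:E)%E -
    fine (\int[P]_w (\prod_(t < n) expR (- g ((X0 (1 + t)%N w / b) ^+ 2)))%:E)%E ^+ p| <=
  p%:R * (n%:R * q4) + (e * (p%:R * (n%:R * q1)) +
  C * (p%:R * (p%:R * (n%:R * q1 ^+ 2 + n%:R * (n%:R * q2 ^+ 2))) +
       p%:R * (n%:R * (n%:R * q3)))).
Proof.
rewrite -[X in _ - X]/(fine _%:E) -matrix_laplace_product.
have mf := measurable_trunc_entry K b.
have f0 x : 0 <= trunc_entry K b x by exact: trunc_entry_ge0.
have exp1 (x : R) : 0 <= x -> 0 <= expR (- x) <= 1.
  by move=> x0; rewrite expR_ge0 -expR0 ler_expR oppr_le0.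
have mS : measurable_fun setT (fun w => \sum_i \sum_t m w i t ^+ 2).
  by apply: measurable_sum => i; apply: measurable_sum => t; exact: measurable_funX.
have mR : measurable_fun setT (fun w => row_cross (m w)).
  apply: measurable_sum => i; apply: measurable_sum_if => j; apply: measurable_funX.
  by apply: measurable_sum => t; exact: measurable_funM.
have mC : measurable_fun setT (fun w => entry_cross (m w)).
  apply: measurable_sum => i; apply: measurable_sum => t; apply: measurable_sum_if => s.
  by apply: measurable_funM; exact: measurable_funX.
have r0 w : 0 <= row_cross (m w).
  by apply: sumr_ge0 => i _; apply: sumr_ge0 => j _; exact: sqr_ge0.
have c0 w : 0 <= entry_cross (m w).
  apply: sumr_ge0 => i _; apply: sumr_ge0 => t _; apply: sumr_ge0 => s _.
  by rewrite mulr_ge0// sqr_ge0.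
have s0 w : 0 <= \sum_i \sum_t m w i t ^+ 2.
  by apply: sumr_ge0 => i _; apply: sumr_ge0 => t _; exact: sqr_ge0.
have mbad : measurable bad.
  rewrite (_ : bad = \bigcup_i \bigcup_t [set w | b * K < `|X i t w|]); last first.
    apply/seteqP; split => [w [i [t H]]|w [i _ [t _ H]]]; last by exists i, t.
    by exists i => //; exists t.
  apply: fin_bigcup_measurable => // i _; apply: fin_bigcup_measurable => // t _.
  exact: measurable_tail.
have rc0 w : 0 <= row_cross (m w) + entry_cross (m w) by exact: addr_ge0.
have mRC : measurable_fun setT (fun w => row_cross (m w) + entry_cross (m w)).
  exact: measurable_funD.
have mE1 : measurable_fun setT (fun w => e * (\sum_i \sum_t m w i t ^+ 2)).
  exact: measurable_funM.
have mE2 : measurable_fun setT (fun w => C * (row_cross (m w) + entry_cross (m w))).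
  exact: measurable_funM.
have E10 w : 0 <= e * (\sum_i \sum_t m w i t ^+ 2) by exact: mulr_ge0.
have E20 w : 0 <= C * (row_cross (m w) + entry_cross (m w)) by exact: mulr_ge0.
have merr : measurable_fun setT err by exact: measurable_funD.
have err0 w : 0 <= err w by exact: addr_ge0.
have mI : measurable_fun setT (\1_bad : T' -> R) by exact: measurable_indic.
have I0 w : 0 <= (\1_bad w : R) by rewrite indicE.
apply: (expectation01_close (err := fun w => \1_bad w + err w)) => //.
- by move=> w; apply: exp1; exact: sumr_ge0.
- move=> w; rewrite (eq_bigr (fun i => expR (- \sum_t g ((X i t w / b) ^+ 2)))).
    by rewrite -expR_sum sumrN; apply: exp1; apply: sumr_ge0 => i _; exact: sumr_ge0.
  by move=> i _; rewrite -sumrN expR_sum.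
- apply: measurable_prod => i _; apply: measurable_prod => t _.
  apply: measurableT_comp => //; apply: measurableT_comp => //.
  apply: (measurableT_comp (continuous_measurable_fun cg)).
  by apply: measurable_funX; exact: measurable_funM.
- exact: measurable_funD.
- by move=> w; exact: addr_ge0.
- exact: sample_laplace_close.
rewrite (integral_realD Q mI merr I0 err0) EFinD; apply: leeD.
  exact: (matrix_exceed_le mX0 Xlaw exceed_le).
rewrite (integral_realD Q mE1 mE2 E10 E20) EFinD; apply: leeD.
  rewrite (integral_realZ Q mS s0 e0) EFinM lee_wpmul2l ?lee_fin//.
  exact: (matrix_sqr_sum_le mX0 Xlaw mf sqr_le).
rewrite (integral_realZ Q mRC rc0 C0) EFinM lee_wpmul2l ?lee_fin//.
rewrite (integral_realD Q mR mC r0 c0) EFinD; apply: leeD.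
  exact: (matrix_row_cross_le mX0 Xind Xlaw mf f0 sqr_le pair_le).
exact: (matrix_entry_cross_le mX0 Xlaw mf q30 sqr_pair_le).
Qed.

End MatrixLaplace.

Section SpectrumLaplace.
Context {R : realType} d (T : measurableType d) (P : probability T R)
  (Z sigma : nat -> {RV P >-> R}).
Hypothesis Z_iid : iid P Z.
Hypothesis sigma_ge0 : forall t w, 0 <= sigma t w.
Hypothesis sigma_stat : stationary P sigma.
Hypothesis sigmaZ : independent_pair P sigma Z.
Context (alpha : R) (a : nat -> R) (p : nat -> nat).
Hypothesis alpha0 : 0 < alpha.
Hypothesis tail_a : forall x : R, 0 < x ->
  n%:R * tail P (Z 0%N) (a n * x) @[n --> \oo] --> x `^ (- alpha).
Hypothesis p_oo : p @ \oo --> \oo.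
Context (k : R).
Hypotheses (alphak : alpha < k) (k2 : k <= 2).
Hypothesis moment_sigma : (\int[P]_w (vol_pow (2 * k) (sigma 0%N w))%:E < +oo)%E.
Context (dX : nat -> measure_display) (TX : forall n, measurableType (dX n))
  (PX : forall n, probability (TX n) R)
  (X : forall n, 'I_(p n) -> 'I_n -> {RV (PX n) >-> R}).
Hypothesis Xind : forall n, independent_families (PX n) (fun i t => @X n i t).
Hypothesis Xlaw : forall n (i : 'I_(p n)),
  eq_law (PX n) P (fun w => [tuple @X n i t w | t < n])
    (window (fun t w => sigma t w * Z t w) 1 n).
Context (lambda : forall n, TX n -> nat -> R).
Hypothesis eig_lambda : forall n w,
  let M : 'M[R]_(p n, n) := \matrix_(i, t) @X n i t w in
  eigenvalues_of (M *m M^T) (@lambda n w).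
Context (g : R -> R).
Hypothesis g0 : forall x, 0 <= g x.
Hypothesis gP : compact_support_pos g.

Local Notation N n := (n * p n)%N.
Local Notation b n := (a (N n)).
Local Notation mu := (@lebesgue_measure R).
Let X0 t w := sigma t w * Z t w.
Let mZ0 : measurable_fun setT (Z 0%N) := measurable_funP (Z 0%N).
Let mX0 t : measurable_fun setT (X0 t). Proof. exact: measurable_funM. Qed.

Let spectrum_laplace n :=
  fine (\int[PX n]_w (expR (- \sum_(k < p n) g (b n ^- 2 * @lambda n w k)))%:E)%E.
Let theta n := row_laplace Z sigma a p g n.

Let close_cvg eta : 0 < eta -> \forall n \near \oo,
  `|spectrum_laplace n - theta n ^+ p n| <= eta.
Proof.
move=> eta0; pose e1 := eta / 8; have e10 : 0 < e1 by rewrite divr_gt0.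
have N_oo : (fun n => N n) @ \oo --> \oo := mul_cvg_infty p_oo.
have bgt := N_oo _ (norming_gt0 mZ0 alpha0 tail_a).
pose A := fine (\int[P]_w (sigma 0%N w `^ alpha)%:E)%E.
(* K comes first, then the accuracy e1 / C1 of the comparison, which fixes C *)
have [K K1 HK] : exists2 K : R, 1 <= K & A * K `^ (- alpha) < e1.
  have c0 : A * n%:R `^ (- alpha) @[n --> \oo] --> (0 : R).
    rewrite -(mulr0 A); apply: cvgM; first exact: cvg_cst.
    by apply: cvg_powRN => //; exact: cvgr_idn.
  have H1 : \forall n \near \oo, A * n%:R `^ (- alpha) < e1 by apply: (cvgr_lt _ c0).
  have H2 : \forall n \near \oo, (1 <= n)%N by exact: nbhs_infty_ge.
  have [n [? ?]] := filter_ex (filterI H1 H2).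
  by exists n%:R => //; rewrite ler1n.
have K0 : 0 < K by exact: lt_le_trans K1.
have Hexc : \forall n \near \oo, (N n)%:R * tail P (X0 0%N) (b n * K) < e1.
  have := entry_tail_cvg sigma_ge0 sigmaZ alpha0 tail_a p_oo alphak moment_sigma K0.
  by move=> /cvgr_lt; apply.
have [C1 C10 H1] := trunc_sqr_moment Z_iid sigma_ge0 sigma_stat sigmaZ alpha0 tail_a
  N_oo alphak k2 moment_sigma K1.
have e0 : 0 < e1 / C1 by rewrite divr_gt0.
have [C C0 close] := eigen_entries_close gP e0.
have [C3 C30 H3] := trunc_sqr_pair_moment Z_iid sigma_ge0 sigma_stat sigmaZ alpha0 tail_a
  N_oo alphak k2 moment_sigma K1.
(* chosen so that C e2^2, the limit of the off-diagonal term, equals e1 *)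
pose e2 := Num.sqrt (e1 / C).
have e20 : 0 < e2 by rewrite sqrtr_gt0 divr_gt0.
have H2 := trunc_pair_moment Z_iid sigma_ge0 sigma_stat sigmaZ alpha0 tail_a
  N_oo alphak k2 moment_sigma K1 e20.
have inv_small (u : nat -> nat) c : u @ \oo --> \oo -> \forall n \near \oo, c / (u n)%:R < e1.
  move=> uoo; have u_gt0 : \forall n \near \oo, 0 < (u n)%:R :> R.
    by near=> n; rewrite ltr0n; near: n; exact: (uoo _ (nbhs_infty_gt 0)).
  have c0 : c / (u n)%:R @[n --> \oo] --> (0 : R).
    rewrite -(mulr0 c); apply: cvgM; first exact: cvg_cst.
    by apply/(gtr0_cvgV0 u_gt0); apply: (cvg_comp _ _ uoo); exact: cvgr_idn.
  exact: (cvgr_lt _ c0).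
have S1 := inv_small p (C * C3) p_oo.
have S2 := inv_small id (C * C1 ^+ 2) (@cvg_id _ _).
near=> n.
have bn : 0 < b n by near: n.
have n1 : 0 < n%:R :> R by rewrite ltr0n; near: n; exact: nbhs_infty_gt.
have p1 : 0 < (p n)%:R :> R by rewrite ltr0n; near: n; exact: (p_oo (nbhs_infty_gt 0)).
have c1 : 0 <= C1 / (N n)%:R by rewrite divr_ge0// ltW.
have c3 : 0 <= C3 / (N n)%:R ^+ 2 by rewrite divr_ge0 ?exprn_ge0// ltW.
have h1 : forall t, (\int[P]_w (trunc_entry K (b n) (X0 t w) ^+ 2)%:E <=
  (C1 / (N n)%:R)%:E)%E by near: n.
have h2 : forall s t, s != t -> (\int[P]_w (trunc_entry K (b n) (X0 s w) *
  trunc_entry K (b n) (X0 t w))%:E <= (e2 / (N n)%:R)%:E)%E by near: n.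
have h3 : forall s t, s != t -> (\int[P]_w (trunc_entry K (b n) (X0 s w) ^+ 2 *
  trunc_entry K (b n) (X0 t w) ^+ 2)%:E <= (C3 / (N n)%:R ^+ 2)%:E)%E by near: n.
have h4 t : (P [set w | (b n * K < `|X0 t w|)%R] <= (tail P (X0 0%N) (b n * K))%:E)%E.
  by rewrite -tailE// (entry_tail_marginal Z_iid sigma_stat sigmaZ).
have := matrix_laplace_close mX0 (@Xind n) (@Xlaw n) (@eig_lambda n) g0 gP.1 bn (ltW K0)
  (ltW e0) (ltW C0) close c3 h1 h2 h3 h4.
rewrite -/(spectrum_laplace n) -/(theta n) => /le_trans; apply.
have x4 : (p n)%:R * (n%:R * tail P (X0 0%N) (b n * K)) < e1.
  by rewrite mulrA -natrM mulnC; near: n.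
have x1 : e1 / C1 * ((p n)%:R * (n%:R * (C1 / (N n)%:R))) = e1.
  by rewrite natrM; field; rewrite !gt_eqF.
have x2 : C * ((p n)%:R * ((p n)%:R * (n%:R * (C1 / (N n)%:R) ^+ 2 +
      n%:R * (n%:R * (e2 / (N n)%:R) ^+ 2))) +
    (p n)%:R * (n%:R * (n%:R * (C3 / (N n)%:R ^+ 2)))) =
    C * C1 ^+ 2 / n%:R + C * e2 ^+ 2 + C * C3 / (p n)%:R.
  by rewrite natrM; field; rewrite !gt_eqF.
have x3 : C * e2 ^+ 2 = e1.
  by rewrite sqr_sqrtr ?(ltW (divr_gt0 _ _))// mulrC divfK// gt_eqF.
rewrite x1 x2 x3.
have s1 : C * C3 / (p n)%:R < e1 by near: n.
have s2 : C * C1 ^+ 2 / n%:R < e1 by near: n.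
have : e1 = eta / 8 by [].
lra.
Unshelve. all: by end_near. Qed.

Lemma spectrum_laplace_cvg :
  spectrum_laplace n @[n --> \oo] -->
  expR (- fine (\int[mu]_(x in `]0%R, +oo[) (laplace_weight g
    (fine (\int[P]_w (sigma 0%N w `^ alpha)%:E)%E `^ (2 / alpha) *
     x `^ (- (2 / alpha))))%:E)%E).
Proof.
have theta_cvg := row_laplace_cvg Z_iid sigma_ge0 sigma_stat sigmaZ alpha0 tail_a p_oo
  alphak k2 moment_sigma g0 gP.
have diff_cvg : spectrum_laplace n - theta n ^+ p n @[n --> \oo] --> (0 : R).
  apply/cvgr0Pnorm_le => eta eta0; exact: close_cvg.
have -> : spectrum_laplace =
    (fun n => (spectrum_laplace n - theta n ^+ p n) + theta n ^+ p n).
  by apply/funext => n; rewrite subrK.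
by rewrite -[X in _ --> X]add0r; exact: cvgD.
Qed.

End SpectrumLaplace.

(** * Convergence of the point processes *)

Theorem theorem3p1 (R : realType)
  (* the stochastic volatility sequence X_t = sigma_t Z_t *)
  (d : measure_display) (T : measurableType d) (P : probability T R)
  (Z sigma : nat -> {RV P >-> R})
  (alpha q : R) (a : nat -> R)
  (halpha : 0 < alpha < 2)
  (hZ : iid P Z)
  (hZtail : forall x : R, 0 < x ->
     n%:R * fine (P [set w | a n * x < `|Z 0%N w|]) @[n --> \oo]
       --> x `^ (- alpha))
  (hq : 0 <= q <= 1)
  (hZbal : fine (P [set w | x < Z 0%N w]) / fine (P [set w | x < `|Z 0%N w|])
             @[x --> +oo] --> q)
  (hsigma0 : forall t w, 0 <= sigma t w)
  (hsigma : stationary P sigma)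
  (hsigmaZ : independent_pair P sigma Z)
  (hmoment : ('E_P[fun w => ((sigma 0%N w) `^ (4 * alpha))%R] < +oo)%E)
  (* the number of rows *)
  (p : nat -> nat) (beta1 beta2 : R)
  (hp0 : forall n, (0 < n)%N -> (0 < p n)%N)
  (hp : p @ \oo --> \oo)
  (hbeta1 : 0 < beta1) (hbeta12 : beta1 < beta2)
  (hbeta2 : 1 < alpha < 2 -> beta2 < (2 - alpha) / (alpha - 1))
  (hpinf : (0 < limn_einf (fun n => ((p n)%:R / n%:R `^ beta1)%:E))%E)
  (hpsup : (limn_esup (fun n => ((p n)%:R / n%:R `^ beta2)%:E) < +oo)%E)
  (* for every n, a p_n x n random matrix on a space of its own, whose rows
     are independent copies of (X_1, ..., X_n) *)
  (dX : nat -> measure_display) (TX : forall n, measurableType (dX n))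
  (PX : forall n, probability (TX n) R)
  (X : forall n, 'I_(p n) -> 'I_n -> {RV (PX n) >-> R})
  (hXind : forall n, independent_families (PX n) (fun i t => X n i t))
  (hXlaw : forall n (i : 'I_(p n)),
     eq_law (PX n) P (fun w => [tuple X n i t w | t < n])
       (window (fun t w => sigma t w * Z t w) 1 n))
  (lambda : forall n, TX n -> nat -> R)
  (hlambda : forall n w,
     let M : 'M[R]_(p n, n) := \matrix_(i, t) X n i t w in
     eigenvalues_of (M *m M^T) (lambda n w))
  (* i.i.d. standard exponential variables; E_1, E_2, ... are E 0, E 1, ... *)
  (dE : measure_display) (TE : measurableType dE) (PE : probability TE R)
  (E : nat -> {RV PE >-> R})
  (hEiid : iid PE E)
  (hE : forall k, std_exponential (E k)) :
  let Gamma i w := \sum_(k < i.+1) E k w in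
  let c := fine ('E_P[fun w => ((sigma 0%N w) `^ alpha)%R])%E `^ (2 / alpha) in
  cvg_point_process PX
    (fun n w => point_measure (p n)
       (fun i => (a (n * p n)%N) ^- 2 * lambda n w i))
    PE
    (fun w => point_measure_inf
       (fun i => c * (Gamma i w) `^ (- (2 / alpha)))).
Proof.
move=> Gamma c f tf.
have /andP[alpha0 alpha2] := halpha.
(* k > alpha makes the truncated moments O(1/N), k <= 2 lets k-th powers
   dominate squares, and 2 k <= 4 alpha is what the moment of sigma allows *)
pose k := Num.min 2 (2 * alpha).
have alphak : alpha < k by rewrite lt_min alpha2/=; lra.
have k2 : k <= 2 by rewrite ge_min lexx.
have moment_sigma : (\int[P]_w (vol_pow (2 * k) (sigma 0%N w))%:E < +oo)%E.
  have ms : measurable_fun setT (fun w => sigma 0%N w `^ (4 * alpha)).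
    exact: (measurableT_comp (measurable_powR _)).
  apply: (@le_lt_trans _ _ (\int[P]_w (1 + sigma 0%N w `^ (4 * alpha))%:E)%E).
    apply: le_integral_real => w; first exact: powR_ge0.
    rewrite /vol_pow; have [s1|s1] := leP (sigma 0%N w) 1.
      by rewrite powR1 lerDl powR_ge0.
    rewrite ler_wpDl// ler_powR ?(ltW s1)//.
    have : k <= 2 * alpha by rewrite ge_min lexx orbT.
    lra.
  rewrite integral_realD//; last by move=> w; exact: powR_ge0.
  rewrite integral_real_cst lte_add_pinfty ?ltry//.
  by move: hmoment; rewrite unlock.
pose g := zero_extension f.
have g0 x : 0 <= g x by exact: zero_extension_ge0.
have gP : compact_support_pos g by exact: zero_extension_compact_support.
have gam0 : 0 < 2 / alpha by rewrite divr_gt0.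
have cE : c = fine (\int[P]_w (sigma 0%N w `^ alpha)%:E)%E `^ (2 / alpha).
  by rewrite /c unlock.
have c0 : 0 <= c by exact: powR_ge0.
have -> : laplace_functional PE (fun w => point_measure_inf
    (fun i => c * (Gamma i w) `^ (- (2 / alpha)))) f =
    (expR (- laplace_exponent
      (zero_extension (fun x => g (c * x `^ (- (2 / alpha)))))))%:E.
  exact: (laplace_functional_arrivals hEiid hE tf c0 gam0).
have H := spectrum_laplace_cvg hZ hsigma0 hsigma hsigmaZ alpha0 hZtail hp alphak k2
  moment_sigma hXind hXlaw hlambda g0 gP.
set G := zero_extension (fun x => g (c * x `^ (- (2 / alpha)))).
have G0 x : 0 <= G x by rewrite /G /zero_extension; case: ifP.
have GP : compact_support_pos G by exact: zero_extension_power_compact_support.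
have JE : fine (\int[@lebesgue_measure R]_(x in `]0%R, +oo[) (laplace_weight g
    (fine (\int[P]_w (sigma 0%N w `^ alpha)%:E)%E `^ (2 / alpha) *
     x `^ (- (2 / alpha))))%:E)%E = laplace_exponent G.
  rewrite -[RHS]/(fine (laplace_exponent G)%:E) -(laplace_exponentE GP).
  congr fine; apply: eq_integral => x; rewrite inE/= in_itv/= andbT => x0.
  by rewrite -cE /laplace_weight /G /zero_extension x0.
rewrite JE in H.
pose S n := (\int[PX n]_w (expR (- \sum_(k < p n)
  g (a (n * p n)%N ^- 2 * lambda n w k)))%:E)%E.
have Sfin n : S n \is a fin_num.
  apply: expectation01_fin_num => w; rewrite expR_ge0 -expR0 ler_expR oppr_le0.
  exact: sumr_ge0.
have SE n : laplace_functional (PX n) (fun w => point_measure (p n)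
    (fun i => a (n * p n)%N ^- 2 * lambda n w i)) f = S n.
  apply: eq_integral => w _; rewrite integral_point_measure//.
  rewrite (eq_bigr (fun i : 'I_(p n) => (g (a (n * p n)%N ^- 2 * lambda n w i))%:E)).
    by rewrite sumEFin.
  by move=> i _; rewrite /g /zero_extension; case: ifP.
apply: (@cvg_trans _ (S n @[n --> \oo])).
  by apply: near_eq_cvg; near=> n; rewrite /= SE.
by apply/fine_cvgP; split; [near=> n|exact: H].
Unshelve. all: by end_near. Qed.
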